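(* Let $F:\mathcal{G}\to\mathbb{R}$ be a Koszul contrast function on a Lie groupoid $\mathcal{G}\rightrightarrows M$ with Lie algebroid $E=\mathrm{Lie}(\mathcal{G})$, let $F^\ast=F\circ\mathrm{inv}$, let $K^F\subset E$ be the kernel of $g^F$ and $L^F=E/K^F$. Let $\nabla^{[F]}_X\bar Y$ and $\nabla^{[F^\ast]}_X\bar Y$ be the sections of $L^F$ determined by $$g^{[F]}(\nabla^{[F]}_X\bar Y,\bar Z)=X^LY^LZ^RF|_M,\qquad g^{[F]}(\nabla^{[F^\ast]}_X\bar Y,\bar Z)=X^LY^LZ^RF^\ast|_M$$ for $X,Y,Z\in\mathrm{Sec}(E)$, where the bar denotes the class in $L^F$. Then $\nabla^{[F]}$ and $\nabla^{[F^\ast]}$ are $E$-connections on the vector bundle $L^F$, and they are dual with respect to $g^{[F]}$, i.e. $$\alpha(X)\,g^{[F]}(\bar Y,\bar Z)=g^{[F]}(\nabla^{[F]}_X\bar Y,\bar Z)+g^{[F]}(\bar Y,\nabla^{[F^\ast]}_X\bar Z)$$ for all $X,Y,Z\in\mathrm{Sec}(E)$. Moreover they are torsion-free in the sense that, for all $X,Y\in\mathrm{Sec}(E)$, $$\nabla^{[F]}_X\bar Y-\nabla^{[F]}_Y\bar X=\overline{[X,Y]},$$ and likewise for $\nabla^{[F^\ast]}$.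
   Context: Conventions. $\mathcal{G}\rightrightarrows M$ is a Lie groupoid with source $\mathsf{s}$, target $\mathsf{t}$, inverse map $\mathrm{inv}$, and $M\subset\mathcal{G}$ embedded as units; $g_1\circ g_2$ is defined when $\mathsf{s}(g_1)=\mathsf{t}(g_2)$. Its Lie algebroid is the normal bundle $E=\mathrm{Lie}(\mathcal{G})=T\mathcal{G}|_M/TM$ with anchor $\alpha:E\to TM$ induced by $T\mathsf{s}-T\mathsf{t}$. For $X\in\mathrm{Sec}(E)$, $X^L$ is the unique left-invariant vector field on $\mathcal{G}$ (tangent to the $\mathsf{t}$-fibers) and $X^R$ the unique right-invariant vector field (tangent to the $\mathsf{s}$-fibers) whose restrictions to $M$ represent $X$ in the normal bundle. The bracket on $\mathrm{Sec}(E)$ is characterized by $[X^L,Y^L]=[X,Y]^L$, $[X^L,Y^R]=0$, $[X^R,Y^R]=-[X,Y]^R$. A contrast function is a smooth $F:\mathcal{G}\to\mathbb{R}$ with $F|_M=0$ and $dF|_M=0$. It defines the symmetric 2-form on $E$ given by $g^F(X,Y)=X^LY^LF|_M=X^LY^RF|_M=X^RY^RF|_M$; one has $g^{F^\ast}=g^F$ for $F^\ast=F\circ\mathrm{inv}$. $F$ is regular if $K^F=\{X\in E: g^F(X,\cdot)=0\}$ is a constant-rank subbundle of $E$; then $g^F$ induces the nondegenerate symmetric form $g^{[F]}(\bar X,\bar Y)=g^F(X,Y)$ on $L^F=E/K^F$. A regular contrast function $F$ is a Koszul contrast function if for all $X,Y\in\mathrm{Sec}(E)$ and $Z\in\mathrm{Sec}(K^F)$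 one has $X^LY^LZ^RF|_M=0$ and $X^LY^LZ^RF^\ast|_M=-X^RY^RZ^LF|_M=0$. For a Koszul contrast function, the right-hand sides of the equations determining $\nabla^{[F]}$, $\nabla^{[F^\ast]}$ depend on $Y$ and $Z$ only through $\bar Y,\bar Z$. An $E$-connection on a vector bundle $V\to M$ is an $\mathbb{R}$-bilinear map $\nabla:\mathrm{Sec}(E)\times\mathrm{Sec}(V)\to\mathrm{Sec}(V)$ with $\nabla_{fX}\sigma=f\nabla_X\sigma$ and $\nabla_X(f\sigma)=f\nabla_X\sigma+\alpha(X)(f)\sigma$ for $f\in C^\infty(M)$. *)

(* Defs.v *)
From HB Require Import structures.
From mathcomp Require Import all_boot all_order all_algebra.
From mathcomp Require Import all_classical all_reals all_analysis.
From mathcomp Require Import ring ring_quotient generic_quotient.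
Set Implicit Arguments.
Unset Strict Implicit.
Unset Printing Implicit Defensive.
Import Order.TTheory GRing.Theory Num.Theory numFieldNormedType.Exports.
Local Open Scope classical_set_scope.
Local Open Scope ring_scope.

Lemma near_open (T : topologicalType) (U : set T) (P : T -> Prop) x :
  open U -> U x -> (forall y, U y -> P y) -> \forall y \near x, P y.
Proof.
move=> oU Ux UP; apply: (@filterS _ (nbhs x) _ U) => //.
exact: open_nbhs_nbhs.
Qed.

Section Diff.
Variables (R : realType) (V W : normedModType R).

Lemma near0_differentiable (h : V -> W) x :
  (\forall y \near x, h y = 0) -> differentiable h x.
Proof.
move=> h0.
have hE : h \o shift x = cst (h x) + (\0 : V -> W) +o_ 0 id.
  apply/eqaddoP => e e0 /=.
  have : \forall y \near 0, h (y + x) = 0.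
    rewrite (near_shift x) /=.
    by apply: filterS h0 => y; rewrite /= sub0r addrNK.
  apply: filterS => y /= hy.
  rewrite !fctE /= hy (nbhs_singleton h0) addr0 subrr normr0.
  by rewrite mulr_ge0 // ltW.
apply/diff_locallyP.
have E : 'd h x = \0 :> (V -> W).
  by apply: diff_unique => //; exact: cst_continuous.
by rewrite E; split => //; exact: cst_continuous.
Qed.

Lemma near_eq_differentiable (f g : V -> W) x :
  (\forall y \near x, f y = g y) -> differentiable f x -> differentiable g x.
Proof.
move=> fg df; have -> : g = f + (g - f) by rewrite addrC subrK.
apply: differentiableD => //; apply: near0_differentiable.
by apply: filterS fg => y; rewrite !fctE => ->; rewrite subrr.
Qed.

Lemma near_eq_continuous (T : topologicalType) (f g : T -> W) x :
  (\forall y \near x, f y = g y) -> {for x, continuous f} -> {for x, continuous g}.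
Proof.
move=> fg cf; rewrite /prop_for /continuous_at -(nbhs_singleton fg).
by apply: cvg_trans cf; apply: near_eq_cvg; apply: filterS fg => y ->.
Qed.
End Diff.

Section SmoothEuclidean.
Variable R : realType.

(* Only used for open U. *)
Fixpoint Ck n (k : nat) (U : set 'rV[R]_n) (f : 'rV[R]_n -> R) : Prop :=
  if k is k'.+1 then
    (forall x, U x -> differentiable f x) /\
    (forall i, Ck k' U (fun x => 'D_(delta_mx 0 i) f x))
  else forall x, U x -> {for x, continuous f}.

Definition smooth_on n (U : set 'rV[R]_n) (f : 'rV[R]_n -> R) : Prop :=
  forall k, Ck k U f.

Definition smooth_map_on n m (U : set 'rV[R]_n) (h : 'rV[R]_n -> 'rV[R]_m) :=
  forall j, smooth_on U (fun x => h x 0 j).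

Lemma Ck_cont n k U (f : 'rV[R]_n -> R) :
  Ck k U f -> forall x, U x -> {for x, continuous f}.
Proof.
case: k => [//|k] [df _] x Ux; exact: differentiable_continuous (df x Ux).
Qed.

Lemma CkS n k U (f : 'rV[R]_n -> R) : Ck k.+1 U f -> Ck k U f.
Proof.
elim: k f => [|k IH] f H; first exact: Ck_cont H.
by split; [case: H | move=> i; apply: IH; case: H => _; apply].
Qed.

Lemma Ck_ext n k U (f g : 'rV[R]_n -> R) :
  open U -> (forall x, U x -> f x = g x) -> Ck k U f -> Ck k U g.
Proof.
move=> oU; elim: k f g => [|k IH] f g fg.
  move=> cf x Ux; apply: near_eq_continuous (cf x Ux).
  exact: near_open oU Ux fg.
case=> df Df; split.
  move=> x Ux; apply: near_eq_differentiable (df x Ux).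
  exact: near_open oU Ux fg.
move=> i; apply: IH (Df i) => x Ux /=; apply: near_eq_derive.
exact: near_open oU Ux fg.
Qed.

Lemma CkW n k (U V : set 'rV[R]_n) (f : 'rV[R]_n -> R) :
  V `<=` U -> Ck k U f -> Ck k V f.
Proof.
move=> VU; elim: k f => [|k IH] f; first by move=> cf x /VU; exact: cf.
by case=> df Df; split=> [x /VU|i]; [exact: df | exact: IH (Df i)].
Qed.

Lemma Ck_local n k (U : set 'rV[R]_n) (f : 'rV[R]_n -> R) :
  (forall x, U x -> exists2 V : set 'rV[R]_n, V x & Ck k V f) -> Ck k U f.
Proof.
elim: k f => [|k IH] f H.
  by move=> x /H[V Vx /(_ x Vx)].
split=> [x /H[V Vx [df _]]|i]; first exact: df.
by apply: IH => x /H[V Vx [_ Df]]; exists V => //; exact: Df.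
Qed.

Lemma Ck_cst n k U (a : R) : Ck k U (fun _ : 'rV[R]_n => a).
Proof.
elim: k a => [|k IH] a /=; first by move=> x _; exact: cst_continuous.
split=> [x _|i]; first exact: differentiable_cst.
by have -> : (fun x => 'D_(delta_mx 0 i) (fun _ : 'rV[R]_n => a) x) = cst 0;
  [apply/funext => x; exact: derive_cst | exact: IH].
Qed.

Lemma CkD n k U (f g : 'rV[R]_n -> R) : open U ->
  Ck k U f -> Ck k U g -> Ck k U (fun x => f x + g x).
Proof.
move=> oU; elim: k f g => [|k IH] f g.
  by move=> cf cg x Ux; apply: continuousD; [exact: cf|exact: cg].
case=> df Df [dg Dg]; split.
  by move=> x Ux; apply: differentiableD; [exact: df|exact: dg].
move=> i; apply: (Ck_ext oU _ (IH _ _ (Df i) (Dg i))) => x Ux /=.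
by rewrite deriveD //; apply: diff_derivable; [exact: df|exact: dg].
Qed.

Lemma CkM n k U (f g : 'rV[R]_n -> R) : open U ->
  Ck k U f -> Ck k U g -> Ck k U (fun x => f x * g x).
Proof.
move=> oU; elim: k f g => [|k IH] f g.
  by move=> cf cg x Ux; apply: continuousM; [exact: cf|exact: cg].
move=> F G; have F' := CkS F; have G' := CkS G.
case: F G => df Df [dg Dg]; split.
  by move=> x Ux; apply: differentiableM; [exact: df|exact: dg].
move=> i; apply: (Ck_ext oU _ (CkD oU (IH _ _ F' (Dg i)) (IH _ _ G' (Df i)))) => x Ux /=.
by rewrite deriveM //; apply: diff_derivable; [exact: df|exact: dg].
Qed.

Lemma Ck_sum n k U m (f : 'I_m -> 'rV[R]_n -> R) : open U ->
  (forall i, Ck k U (f i)) -> Ck k U (fun x => \sum_i f i x).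
Proof.
move=> oU H; elim: (index_enum _) => [|i s IH].
  by apply: (Ck_ext oU _ (Ck_cst k U 0)) => x _; rewrite big_nil.
by apply: (Ck_ext oU _ (CkD oU (H i) IH)) => x _; rewrite big_cons.
Qed.

Lemma differentiable_rV n m (h : 'rV[R]_m -> 'rV[R]_n) x :
  (forall j, differentiable (fun y => h y 0 j) x) -> differentiable h x.
Proof.
move=> H.
have -> : h = \sum_j (fun y => (h y 0 j) *: (delta_mx 0 j : 'rV[R]_n)).
  by apply/funext => y; rewrite fct_sumE -row_sum_delta.
by apply: differentiable_sum => j; exact: differentiableZl.
Qed.

Lemma derive_comp_rV n m (h : 'rV[R]_m -> 'rV[R]_n) (f : 'rV[R]_n -> R) x v :
  differentiable h x -> differentiable f (h x) ->
  'D_v (f \o h) x =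
  \sum_j 'D_(delta_mx 0 j) f (h x) * 'D_v (fun y => h y 0 j) x.
Proof.
move=> dh df; have dfh := differentiable_comp dh df.
rewrite (deriveE v dfh) diff_comp //= -(deriveE v dh).
rewrite [in LHS](row_sum_delta ('D_v h x)) linear_sum /=.
apply: eq_bigr => j _; rewrite linearZ /= -(deriveE _ df) derive_mx; last first.
  exact: diff_derivable.
by rewrite mxE mulrC.
Qed.

Lemma Ck_comp n m k (U : set 'rV[R]_n) (V : set 'rV[R]_m) h f :
  open V -> (forall x, V x -> U (h x)) ->
  (forall j, Ck k V (fun x => h x 0 j)) -> Ck k U f -> Ck k V (f \o h).
Proof.
move=> oV hVU; elim: k f => [|k IH] f.
  move=> ch cf x Vx; apply: continuous_comp; last exact/cf/hVU.
  have FF : Filter (nbhs x) by exact: nbhs_filter.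
  apply/(@cvgrPdist_lt _ _ _ (nbhs x) FF) => e e0.
  have H : \forall y \near nbhs x, forall j, `|h x 0 j - h y 0 j| < e.
    apply: filter_forall => j.
    exact: (@cvgrPdist_lt _ _ _ (nbhs x) FF _ _).1 (ch j x Vx) e e0.
  apply: (@filterS _ (nbhs x) FF _ _ _ H) => y Hy.
  rewrite /Num.Def.normr/= mx_normrE; apply/bigmax_lt => // -[i j] _ /=.
  by rewrite !mxE (ord1 i); exact: Hy.
move=> ch [df Df].
have dh x : V x -> differentiable h x.
  by move=> Vx; apply: differentiable_rV => j; exact: (ch j).1.
split=> [x Vx|i].
  by apply: differentiable_comp; [exact: dh | exact/df/hVU].
have K : Ck k V (fun x => \sum_j ((fun y => 'D_(delta_mx 0 j) f y) \o h) x *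
     'D_(delta_mx 0 i) (fun y => h y 0 j) x).
  apply: Ck_sum => // j; apply: CkM => //; last exact: (ch j).2.
  by apply: IH; [move=> l; exact: CkS | exact: Df].
apply: (Ck_ext oV _ K) => x Vx; rewrite derive_comp_rV //; first exact: dh.
exact/df/hVU.
Qed.

End SmoothEuclidean.
Section Manifolds.
Variable R : realType.

(* chart_map and chart_inv are total; they only matter on chart_dom and on the
   coordinate domain chart_cod respectively. *)
Record chart (T : topologicalType) (n : nat) := Chart {
  chart_dom : set T;
  chart_map : T -> 'rV[R]_n;
  chart_inv : 'rV[R]_n -> T;
  chart_dom_open : open chart_dom;
  chart_cod_open : open (chart_map @` chart_dom);
  chart_mapK : forall x, chart_dom x -> chart_inv (chart_map x) = x;
  chart_map_continuous : forall x, chart_dom x -> {for x, continuous chart_map};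
  chart_inv_continuous :
    forall y, (chart_map @` chart_dom) y -> {for y, continuous chart_inv} }.

Arguments chart_dom_open {T n} c.
Arguments chart_cod_open {T n} c.

Definition chart_cod T n (c : chart T n) := chart_map c @` chart_dom c.

Record manifold := Manifold {
  carrier :> topologicalType;
  mfd_dim : nat;
  atlas : set (chart carrier mfd_dim);
  manifold_hausdorff : hausdorff_space carrier;
  manifold_second_countable : @second_countable carrier;
  atlas_cover : forall x, exists2 c, atlas c & chart_dom c x;
  atlas_compatible : forall c d, atlas c -> atlas d ->
    smooth_map_on (chart_map c @` (chart_dom c `&` chart_dom d))
                  (chart_map d \o chart_inv c) }.

Definition smooth_fun (M : manifold) : {pred M -> R} := fun f =>
  `[< forall c, atlas c -> smooth_on (chart_cod c) (f \o chart_inv c) >].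

Definition smooth_map (M N : manifold) (h : M -> N) : Prop :=
  continuous h /\
  forall c d, atlas c -> atlas d ->
    smooth_map_on (chart_map c @` (chart_dom c `&` h @^-1` chart_dom d))
                  (chart_map d \o h \o chart_inv c).

Lemma open_chart_image (T : topologicalType) n (c : chart T n) (A : set T) :
  open A -> open (chart_map c @` (chart_dom c `&` A)).
Proof.
move=> oA; rewrite openE => _ [x [cx Ax] <-]; rewrite /interior.
have cod : chart_cod c (chart_map c x) by exists x.
have iA : nbhs (chart_map c x) (chart_inv c @^-1` A).
  apply: (chart_inv_continuous cod); rewrite chart_mapK //.
  exact: open_nbhs_nbhs.
have iC : nbhs (chart_map c x) (chart_cod c).
  by apply: open_nbhs_nbhs; split; first exact: chart_cod_open.
apply: (@filterS _ (nbhs (chart_map c x)) _ _ _ _ (filterI iA iC)).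
move=> y [Ay [z cz zy]]; exists z => //; split=> //.
by move: Ay; rewrite /preimage /= -zy chart_mapK.
Qed.

Lemma open_preimage_map (S T : topologicalType) (h : S -> T) (A : set T) :
  continuous h -> open A -> open (h @^-1` A).
Proof. by move=> /continuousP; apply. Qed.

Lemma smooth_fun_local (M : manifold) (f : M -> R) :
  (forall x : M, exists2 g, g \in @smooth_fun M & \forall y \near x, f y = g y) ->
  f \in @smooth_fun M.
Proof.
move=> H; apply/asboolP => c ac k; apply: Ck_local => _ [x cx <-].
have [g /asboolP gs nfg] := H x.
have [A [oA Ax] fg] : exists2 A : set M, open_nbhs x A & A `<=` [set y | f y = g y].
  by move: nfg; rewrite /prop_near1 nbhsE.
exists (chart_map c @` (chart_dom c `&` A)); first by exists x.
apply: (@Ck_ext _ _ _ _ (g \o chart_inv c)).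
- exact: open_chart_image.
- by move=> _ [y [cy Ay] <-] /=; rewrite chart_mapK //; apply/esym/fg.
- by apply: CkW (gs c ac k) => _ [y [cy Ay] <-]; exists y.
Qed.

Lemma smooth_fun_comp (M N : manifold) (h : M -> N) (f : N -> R) :
  smooth_map h -> f \in @smooth_fun N -> f \o h \in @smooth_fun M.
Proof.
move=> [ch sh] /asboolP sf; apply/asboolP => c ac k.
apply: Ck_local => _ [x cx <-].
have [d ad dhx] := atlas_cover (h x).
have oA : open (h @^-1` chart_dom d).
  by apply: open_preimage_map => //; exact: chart_dom_open.
exists (chart_map c @` (chart_dom c `&` h @^-1` chart_dom d)); first by exists x.
apply: (@Ck_ext _ _ _ _ ((f \o chart_inv d) \o (chart_map d \o h \o chart_inv c))).
- exact: open_chart_image.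
- by move=> _ [y [cy dy] <-] /=; rewrite chart_mapK // chart_mapK.
apply: (@Ck_comp _ _ _ _ (chart_cod d)).
- exact: open_chart_image.
- by move=> _ [y [cy dy] <-] /=; rewrite chart_mapK //; exists (h y).
- by move=> j; exact: sh.
- exact: sf.
Qed.

Lemma smooth_cst (M : manifold) a : cst a \in @smooth_fun M.
Proof. by apply/asboolP => c ac k; exact: Ck_cst. Qed.

Lemma smooth_subring M : subring_closed (@smooth_fun M).
Proof.
have mul_smooth f g : f \in @smooth_fun M -> g \in @smooth_fun M ->
    f * g \in @smooth_fun M.
  move=> /asboolP sf /asboolP sg; apply/asboolP => c ac k.
  exact: (CkM (chart_cod_open c) (sf c ac k) (sg c ac k)).
split=> [|f g sf sg|]; [exact: smooth_cst| |exact: mul_smooth].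
have /asboolP sg' := mul_smooth _ _ (smooth_cst M (-1)) sg.
move/asboolP: sf => sf; apply/asboolP => c ac k.
apply: (Ck_ext (chart_cod_open c) _ (CkD (chart_cod_open c) (sf c ac k) (sg' c ac k))).
by move=> y _ /=; rewrite !fctE /= mulN1r.
Qed.

HB.instance Definition _ (M : manifold) :=
  GRing.isSubringClosed.Build (M -> R) (@smooth_fun M) (smooth_subring M).

Lemma smooth_submod M : submod_closed (@smooth_fun M).
Proof.
split=> [|a f g sf sg]; first exact: rpred0.
have -> : a *: f + g = (cst a : M -> R) * f + g by [].
apply: rpredD => //; apply: rpredM => //.
exact: smooth_cst.
Qed.

HB.instance Definition _ (M : manifold) :=
  GRing.isSubmodClosed.Build R (M -> R) (@smooth_fun M) (smooth_submod M).

Record Cinf (M : manifold) := MkCinf {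
  cinf_fun :> M -> R; cinfP : cinf_fun \in @smooth_fun M }.

HB.instance Definition _ (M : manifold) := [isSub of Cinf M for @cinf_fun M].
HB.instance Definition _ (M : manifold) := [Choice of Cinf M by <:].
HB.instance Definition _ (M : manifold) := 
  GRing.SubChoice_isSubComPzRing.Build (M -> R) _ (Cinf M) (@smooth_subring M).
HB.instance Definition _ (M : manifold) := [SubZmodule_isSubLmodule of Cinf M by <:].

Definition cinf_cst (M : manifold) (a : R) : Cinf M := MkCinf (smooth_cst M a).

Record smap (M N : manifold) := Smap {
  smap_fun :> M -> N; smapP : smooth_map smap_fun }.

Definition pullback M N (h : smap M N) (f : Cinf N) : Cinf M :=
  MkCinf (smooth_fun_comp (smapP h) (cinfP f)).

Lemma smooth_id (M : manifold) : smooth_map (@id M).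
Proof.
split=> [x|c d ac ad]; first exact: cvg_id.
exact: atlas_compatible.
Qed.

Definition idmap M : smap M M := Smap (smooth_id M).

End Manifolds.

Section Quotients.
Variables (K : pzRingType) (V : lmodType K).

(* The linear span of P. *)
Definition span_of (P : set V) : {pred V} := fun v =>
  `[< forall W : set V, W 0 -> (forall a u w, W u -> W w -> W (a *: u + w)) ->
        P `<=` W -> W v >].

Lemma span_of_submod P : submod_closed (span_of P).
Proof.
split=> [|a u v /asboolP Pu /asboolP Pv]; first by apply/asboolP => W W0 _ _.
by apply/asboolP => W W0 WL PW; apply: (WL); [exact: Pu|exact: Pv].
Qed.

HB.instance Definition _ P :=
  GRing.isSubmodClosed.Build K V (span_of P) (span_of_submod P).

(* V / span P; for P a linear subspace this is the usual quotient V / P. *)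
Definition quotmod (P : set V) := Quotient.quot (span_of P).

HB.instance Definition _ P := GRing.Zmodule.on (quotmod P).
HB.instance Definition _ P := EqQuotient.on (quotmod P).

Variable P : set V.
Local Notation Q := (quotmod P).

Definition proj_quot (v : V) : Q := (\pi_Q v)%qT.

Definition scale_quot (a : K) (q : Q) : Q := proj_quot (a *: repr q).

Lemma proj_quot_eq u v : (proj_quot u == proj_quot v) = (u - v \in span_of P).
Proof. by rewrite -Quotient.idealrBE. Qed.

Lemma proj_quotD u v : proj_quot (u + v) = proj_quot u + proj_quot v.
Proof. exact: (@pi_addr _ _ _ _ _ (Quotient.quot (span_of P))). Qed.

Lemma scale_quotE a v : scale_quot a (proj_quot v) = proj_quot (a *: v).
Proof.
apply/eqP; rewrite proj_quot_eq -scalerBr rpredZ // -proj_quot_eq.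
by rewrite /proj_quot reprK.
Qed.

Lemma proj_quotP (q : Q) : exists v, q = proj_quot v.
Proof. by exists (repr q); rewrite /proj_quot reprK. Qed.

Fact scale_quotA a b q : scale_quot a (scale_quot b q) = scale_quot (a * b) q.
Proof. by have [v ->] := proj_quotP q; rewrite !scale_quotE scalerA. Qed.
Fact scale_quot1 q : scale_quot 1 q = q.
Proof. by have [v ->] := proj_quotP q; rewrite !scale_quotE scale1r. Qed.
Fact scale_quotDr : right_distributive scale_quot +%R.
Proof.
move=> a q q'; have [v ->] := proj_quotP q; have [v' ->] := proj_quotP q'.
by rewrite -proj_quotD !scale_quotE scalerDr proj_quotD.
Qed.
Fact scale_quotDl q a b : scale_quot (a + b) q = scale_quot a q + scale_quot b q.
Proof.
by have [v ->] := proj_quotP q; rewrite !scale_quotE scalerDl proj_quotD.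
Qed.

HB.instance Definition _ := GRing.Zmodule_isLmodule.Build K Q
  scale_quotA scale_quot1 scale_quotDr scale_quotDl.

Lemma proj_quotZ a v : proj_quot (a *: v) = a *: proj_quot v.
Proof. by rewrite -scale_quotE. Qed.

End Quotients.

Arguments proj_quot {K V} P v.

Section Tangent.
Variable R : realType.
Local Notation manifold := (manifold R).

Definition derivation_at (M : manifold) (x : M) : {pred Cinf M -> R} := fun v =>
  `[< (forall a f g, v (a *: f + g) = a * v f + v g) /\
      (forall f g, v (f * g) = v f * g x + f x * v g) >].

Lemma derivation_at_submod (M : manifold) (x : M) : submod_closed (derivation_at x).
Proof.
split=> [|a u v /asboolP[uL uM] /asboolP[vL vM]]; apply/asboolP; split.
- by move=> a f g; rewrite mulr0 addr0.
- by move=> f g; rewrite mul0r mulr0 addr0.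
- move=> b f g; have E w : (a *: u + v) w = a * u w + v w by [].
  by rewrite !E uL vL; ring.
- move=> f g; have E w : (a *: u + v) w = a * u w + v w by [].
  by rewrite !E uM vM; ring.
Qed.

HB.instance Definition _ (M : manifold) (x : M) :=
  GRing.isSubmodClosed.Build R (Cinf M -> R) (derivation_at x)
    (derivation_at_submod x).

Record tangent (M : manifold) (x : M) := MkTangent {
  tangent_fun :> Cinf M -> R; tangentP : tangent_fun \in derivation_at x }.

HB.instance Definition _ (M : manifold) (x : M) :=
  [isSub of tangent x for @tangent_fun M x].
HB.instance Definition _ (M : manifold) (x : M) := [Choice of tangent x by <:].
HB.instance Definition _ (M : manifold) (x : M) :=
  [SubChoice_isSubLmodule of tangent x by <:].

Fact push_subproof (M N : manifold) (h : smap M N) (x : M) (v : tangent x) :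
  (fun f : Cinf N => v (pullback h f)) \in derivation_at (h x).
Proof.
have /asboolP[vL vM] := tangentP v.
apply/asboolP; split=> [a f g|f g].
- by rewrite -vL; congr (tangent_fun v _); exact: val_inj.
- rewrite -[RHS](vM (pullback h f) (pullback h g)).
  by congr (tangent_fun v _); exact: val_inj.
Qed.

(* The tangent map T_x h. *)
Definition push (M N : manifold) (h : smap M N) (x : M) (v : tangent x) :
  tangent (h x) := MkTangent (push_subproof h v).

(* A vector bundle over M, given by its fibres and its C^oo(M)-module of smooth
   sections. Local triviality is not a field: it is a property of the instances
   below (for the quotient by a family of subspaces, when the family is a smooth
   subbundle). *)
Record bundle (M : manifold) := Bundle {
  fiber : M -> lmodType R;
  smooth_section : (forall x, fiber x) -> Prop;
  smooth_section0 : smooth_section (fun _ => 0);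
  smooth_sectionD : forall s t, smooth_section s -> smooth_section t ->
    smooth_section (fun x => s x + t x);
  smooth_sectionZ : forall (f : Cinf M) s, smooth_section s ->
    smooth_section (fun x => f x *: s x) }.

Record sec (M : manifold) (V : bundle M) := MkSec {
  sec_fun :> forall x, fiber V x; secP : smooth_section sec_fun }.

Section SecModule.
Variables (M : manifold) (V : bundle M).
Implicit Types (s t : sec V) (f : Cinf M).

Lemma sec_ext s t : (forall x, s x = t x) -> s = t.
Proof.
case: s t => [s sP] [t tP] /= st.
have E : s = t by exact: functional_extensionality_dep.
by case: _ / E in tP *; congr MkSec; exact: Prop_irrelevance.
Qed.

Definition sec0 : sec V := MkSec (smooth_section0 V).
Definition secD s t : sec V := MkSec (smooth_sectionD (secP s) (secP t)).
Definition secZ f s : sec V := MkSec (smooth_sectionZ f (secP s)).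
Definition secN s : sec V := secZ (- 1) s.

HB.instance Definition _ := gen_eqMixin (sec V).
HB.instance Definition _ := gen_choiceMixin (sec V).

Fact secDA : associative secD.
Proof. by move=> s t u; apply: sec_ext => x /=; rewrite addrA. Qed.
Fact secDC : commutative secD.
Proof. by move=> s t; apply: sec_ext => x /=; rewrite addrC. Qed.
Fact sec0D : left_id sec0 secD.
Proof. by move=> s; apply: sec_ext => x /=; rewrite add0r. Qed.
Fact secND : left_inverse sec0 secN secD.
Proof. by move=> s; apply: sec_ext => x /=; rewrite scaleN1r addNr. Qed.

HB.instance Definition _ := GRing.isZmodule.Build (sec V) secDA secDC sec0D secND.

Fact secZA f g s : secZ f (secZ g s) = secZ (f * g) s.
Proof. by apply: sec_ext => x /=; rewrite scalerA. Qed.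
Fact secZ1 s : secZ 1 s = s.
Proof. by apply: sec_ext => x /=; rewrite scale1r. Qed.
Fact secZDr : right_distributive secZ +%R.
Proof. by move=> f s t; apply: sec_ext => x /=; rewrite scalerDr. Qed.
Fact secZDl s f g : secZ (f + g) s = secZ f s + secZ g s.
Proof. by apply: sec_ext => x /=; rewrite scalerDl. Qed.

HB.instance Definition _ := GRing.Zmodule_isLmodule.Build (Cinf M) (sec V)
  secZA secZ1 secZDr secZDl.
End SecModule.

(* The pullback bundle h^* TN; smoothness is tested on C^oo(N). *)
Section Along.
Variables (M N : manifold) (h : smap M N).

Definition smooth_along (X : forall x : M, tangent (h x)) : Prop :=
  forall f : Cinf N, (fun x => X x f) \in smooth_fun (M := M).

Fact smooth_along0 : smooth_along (fun _ => 0).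
Proof. by move=> f; exact: rpred0. Qed.
Fact smooth_alongD X Y : smooth_along X -> smooth_along Y ->
  smooth_along (fun x => X x + Y x).
Proof. by move=> sX sY f; exact: (rpredD (sX f) (sY f)). Qed.
Fact smooth_alongZ (g : Cinf M) X : smooth_along X ->
  smooth_along (fun x => g x *: X x).
Proof. by move=> sX f; exact: (rpredM (cinfP g) (sX f)). Qed.

Definition tangent_along : bundle M :=
  Bundle smooth_along0 smooth_alongD smooth_alongZ.

Definition act_along (X : sec tangent_along) (f : Cinf N) : Cinf M :=
  MkCinf (secP X f).
End Along.

Definition vfield (M : manifold) := sec (tangent_along (idmap M)).

Definition vact (M : manifold) (X : vfield M) (f : Cinf M) : Cinf M :=
  act_along X f.

End Tangent.

Section QuotientBundle.
Variables (R : realType) (M : manifold R) (V : bundle M).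
Variable P : forall x : M, set (fiber V x).
Arguments P x : clear implicits.

Definition quot_fiber (x : M) : lmodType R := quotmod (P x).

(* Smooth sections of V / P are those that locally lift to smooth sections of V. *)
Definition smooth_quot (s : forall x, quot_fiber x) : Prop :=
  forall x : M, exists t : sec V, \forall y \near x, s y = proj_quot (P y) (t y).

Fact smooth_quot0 : smooth_quot (fun _ => 0).
Proof.
move=> x; exists 0; apply: (@filterS _ (nbhs x) _ setT) => [y _|].
  by apply/esym; rewrite -[X in proj_quot _ X](scale0r 0) proj_quotZ scale0r.
exact: filterT.
Qed.

Fact smooth_quotD s t : smooth_quot s -> smooth_quot t ->
  smooth_quot (fun x => s x + t x).
Proof.
move=> ss st x; have [s' Hs] := ss x; have [t' Ht] := st x.
exists (s' + t'); apply: (@filterS2 _ (nbhs x) _ _ _ _ _ Hs Ht) => y -> ->.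
by rewrite -proj_quotD.
Qed.

Fact smooth_quotZ (f : Cinf M) s : smooth_quot s ->
  smooth_quot (fun x => f x *: s x).
Proof.
move=> ss x; have [s' Hs] := ss x.
exists (f *: s'); apply: (@filterS _ (nbhs x) _ _ _ _ Hs) => y ->.
by rewrite -proj_quotZ.
Qed.

Definition quot_bundle : bundle M :=
  Bundle smooth_quot0 smooth_quotD smooth_quotZ.

Fact class_subproof (s : sec V) : smooth_quot (fun x => proj_quot (P x) (s x)).
Proof. by move=> x; exists s; exact: filterE. Qed.

Definition class_sec (s : sec V) : sec quot_bundle :=
  @MkSec R M quot_bundle (fun x => proj_quot (P x) (s x)) (class_subproof s).

(* P is a smooth subbundle of V of rank k: locally it has a smooth frame. *)
Definition is_subbundle (k : nat) : Prop :=
  forall x : M, exists e : 'I_k -> sec V, \forall y \near x,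
    (forall v, P y v <-> exists a : 'I_k -> R, v = \sum_i a i *: e i y) /\
    (forall a : 'I_k -> R, \sum_i a i *: e i y = 0 -> forall i, a i = 0).

End QuotientBundle.

Arguments class_sec {R M V} P s.
Arguments is_subbundle {R M V} P k.

Section Groupoid.
Variable R : realType.

(* Smoothness of the partial multiplication on the fibre product
   {(g, h) | src g = tgt h}: in charts, it locally extends to a smooth map on an
   open subset of the ambient product. *)
Definition smooth_mul (G M : manifold R) (src tgt : G -> M) (mul : G -> G -> G) :=
  forall (g0 h0 : G) (a b c : chart R G (mfd_dim G)), src g0 = tgt h0 ->
    atlas a -> atlas b -> atlas c ->
    chart_dom a g0 -> chart_dom b h0 -> chart_dom c (mul g0 h0) ->
  exists (W : set 'rV[R]_(mfd_dim G + mfd_dim G)) (m : 'rV[R]_(mfd_dim G + mfd_dim G) -> 'rV[R]_(mfd_dim G)),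
    [/\ open W, W (row_mx (chart_map a g0) (chart_map b h0)), smooth_map_on W m &
      forall g h, src g = tgt h -> chart_dom a g -> chart_dom b h ->
        W (row_mx (chart_map a g) (chart_map b h)) ->
        chart_dom c (mul g h) /\
        chart_map c (mul g h) = m (row_mx (chart_map a g) (chart_map b h))].

Definition submersion (N M : manifold R) (h : smap N M) : Prop :=
  forall (x : N) (w : tangent (h x)), exists v : tangent x, push h v = w.

(* gmul g h is only meaningful when src g = tgt h. *)
Record lie_groupoid := LieGroupoid {
  base : manifold R;
  arrows : manifold R;
  src : smap arrows base;
  tgt : smap arrows base;
  units : smap base arrows;
  ginv : smap arrows arrows;
  gmul : arrows -> arrows -> arrows;
  src_submersion : submersion src;
  tgt_submersion : submersion tgt;
  mul_smooth : smooth_mul src tgt gmul;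
  src_mul : forall g h, src g = tgt h -> src (gmul g h) = src h;
  tgt_mul : forall g h, src g = tgt h -> tgt (gmul g h) = tgt g;
  mulA : forall g h k, src g = tgt h -> src h = tgt k ->
    gmul g (gmul h k) = gmul (gmul g h) k;
  src_unit : forall x, src (units x) = x;
  tgt_unit : forall x, tgt (units x) = x;
  mul_unitl : forall g, gmul (units (tgt g)) g = g;
  mul_unitr : forall g, gmul g (units (src g)) = g;
  src_inv : forall g, src (ginv g) = tgt g;
  tgt_inv : forall g, tgt (ginv g) = src g;
  mul_invl : forall g, gmul (ginv g) g = units (src g);
  mul_invr : forall g, gmul g (ginv g) = units (tgt g) }.

Variable G : lie_groupoid.
Local Notation M := (base G).
Local Notation GG := (arrows G).

(* The normal bundle TG|_M / TM of the units. *)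
Definition lie_algebroid : bundle M :=
  quot_bundle (V := tangent_along (units G)) (fun x => range (push (units G) (x := x))).
Local Notation E := lie_algebroid.

(* The action of T_x s - T_x t on a class modulo TM, on which it is well defined. *)
Fact anchor_pt_subproof (x : M) (e : fiber E x) :
  (fun f : Cinf M => repr e (pullback (src G) f) - repr e (pullback (tgt G) f))
    \in derivation_at x.
Proof.
have /asboolP[vL vM] := tangentP (repr e).
apply/asboolP; split=> [a f g|f g].
- have EL (h : smap GG M) :
     pullback h (a *: f + g) = a *: pullback h f + pullback h g by exact: val_inj.
  by rewrite !EL !vL; ring.
- have EM (h : smap GG M) :
     pullback h (f * g) = pullback h f * pullback h g by exact: val_inj.
  by rewrite !EM !vM /= src_unit tgt_unit; ring.
Qed.

Definition anchor_pt (x : M) (e : fiber E x) : tangent x :=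
  MkTangent (anchor_pt_subproof e).

Lemma span_unit_tangent (x : M) (v : tangent (units G x)) :
  v \in span_of (range (push (units G) (x := x))) ->
  forall f : Cinf M, v (pullback (src G) f) = v (pullback (tgt G) f).
Proof.
move=> /asboolP H f.
apply: (H [set v | v (pullback (src G) f) = v (pullback (tgt G) f)]) => //.
- by move=> a u w /= Hu Hw; rewrite -[LHS]/(a * u _ + w _) Hu Hw.
- move=> _ [w _ <-] /=; congr (tangent_fun w _); apply: val_inj.
  by apply/funext => y /=; rewrite src_unit tgt_unit.
Qed.

Fact anchor_subproof (X : sec E) :
  smooth_along (h := idmap M) (fun x => anchor_pt (X x)).
Proof.
move=> f; apply: smooth_fun_local => x.
have [V HV] := secP X x.
exists (act_along V (pullback (src G) f) - act_along V (pullback (tgt G) f)).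
  exact: cinfP.
apply: (@filterS _ (nbhs x) _ _ _ _ HV) => y Hy.
have : proj_quot (range (push (units G) (x := y))) (repr (X y)) == proj_quot _ (V y).
  by rewrite -Hy /proj_quot reprK.
rewrite proj_quot_eq => /span_unit_tangent/(_ f) Hf.
have Q (a b c d : R) : a - c = b - d -> a - b = c - d.
  by move=> H; rewrite -(subrK c a) H; ring.
exact: Q Hf.
Qed.

Definition anchor (X : sec E) : vfield M := @MkSec R M (tangent_along (idmap M)) _ (anchor_subproof X).

(* Tangency to the t-fibres together with d(L_g)_h (X_h) = X_{gh}, where
   L_g : t^{-1}(s(g)) -> t^{-1}(t(g)); as L_g is only defined on a t-fibre, d(L_g)
   is evaluated on f through arbitrary smooth local extensions of f o L_g. *)
Definition left_invariant (X : vfield GG) : Prop :=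
  (forall g : GG, push (tgt G) (X g) = 0) /\
  (forall (g h : GG) (f f' : Cinf GG), src G g = tgt G h ->
     (\forall k \near h, tgt G k = src G g -> f' k = f (gmul g k)) ->
     X h f' = X (gmul g h) f).

Definition right_invariant (X : vfield GG) : Prop :=
  (forall g : GG, push (src G) (X g) = 0) /\
  (forall (g h : GG) (f f' : Cinf GG), src G h = tgt G g ->
     (\forall k \near h, src G k = tgt G g -> f' k = f (gmul k g)) ->
     X h f' = X (gmul h g) f).

Fact restrict_units_subproof (X : vfield GG) :
  smooth_along (h := units G) (fun x => X (units G x)).
Proof. by move=> f; exact: cinfP (pullback (units G) (vact X f)). Qed.

Definition restrict_units (X : vfield GG) : sec (tangent_along (units G)) :=
  @MkSec R M (tangent_along (units G)) _ (restrict_units_subproof X).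

Definition represents (XX : vfield GG) (X : sec E) : Prop :=
  class_sec _ (restrict_units XX) = X.

(* X^L and X^R, by definite description: exactly one vector field satisfies the
   condition, so the default value 0 is never used. *)
Definition left_ext (X : sec E) : vfield GG :=
  xget 0 [set XX | left_invariant XX /\ represents XX X].
Definition right_ext (X : sec E) : vfield GG :=
  xget 0 [set XX | right_invariant XX /\ represents XX X].

End Groupoid.

Section Commutator.
Variables (R : realType) (M : manifold R) (X Y : vfield M).

Fact commutator_pt_subproof (x : M) :
  (fun f : Cinf M => X x (vact Y f) - Y x (vact X f)) \in derivation_at x.
Proof.
have /asboolP[XL XM] := tangentP (X x); have /asboolP[YL YM] := tangentP (Y x).
have vactL (Z : vfield M) a f g : vact Z (a *: f + g) = a *: vact Z f + vact Z g.
  apply: val_inj; apply/funext => y /=.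
  by have /asboolP[ZL _] := tangentP (Z y); exact: ZL.
have vactM (Z : vfield M) f g : vact Z (f * g) = vact Z f * g + f * vact Z g.
  apply: val_inj; apply/funext => y /=.
  by have /asboolP[_ ZM] := tangentP (Z y); exact: ZM.
have XD f g : X x (f + g) = X x f + X x g by rewrite -[f]scale1r XL mul1r scale1r.
have YD f g : Y x (f + g) = Y x f + Y x g by rewrite -[f]scale1r YL mul1r scale1r.
apply/asboolP; split=> [a f g|f g].
- by rewrite !vactL XL YL; ring.
- by rewrite !vactM XD YD !XM !YM /=; ring.
Qed.
Definition commutator_pt (x : M) : tangent x := MkTangent (commutator_pt_subproof x).

Fact commutator_subproof : smooth_along (h := idmap M) commutator_pt.
Proof.
by move=> f; exact: cinfP (vact X (vact Y f) - vact Y (vact X f)).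
Qed.

Definition commutator : vfield M := @MkSec R M (tangent_along (idmap M)) _ commutator_subproof.
End Commutator.

Section Contrast.
Variables (R : realType) (G : lie_groupoid R).
Local Notation M := (base G).
Local Notation E := (lie_algebroid G).

(* The bracket characterized by [X, Y]^L = [X^L, Y^L]. *)
Definition bracket (X Y : sec E) : sec E :=
  class_sec _ (restrict_units (commutator (left_ext X) (left_ext Y))).

Definition contrast_function (F : Cinf (arrows G)) : Prop :=
  forall x : M, F (units G x) = 0 /\ forall v : tangent (units G x), v F = 0.

Definition dual_contrast (F : Cinf (arrows G)) : Cinf (arrows G) :=
  pullback (ginv G) F.

(* X^L Y^L F restricted to M. *)
Definition contrast_form (F : Cinf (arrows G)) (X Y : sec E) : Cinf M :=
  pullback (units G) (vact (left_ext X) (vact (left_ext Y) F)).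

(* X^L Y^L Z^R F restricted to M. *)
Definition third_LLR (F : Cinf (arrows G)) (X Y Z : sec E) : Cinf M :=
  pullback (units G)
    (vact (left_ext X) (vact (left_ext Y) (vact (right_ext Z) F))).

(* Every e in E_x extends to a smooth section, so the default 0 is never used. *)
Definition through (x : M) (e : fiber E x) : sec E :=
  xget 0 [set X : sec E | X x = e].

(* g^F as a bilinear form on the fibre E_x; contrast_form being tensorial, the
   choice of the sections through e and e' is immaterial. *)
Definition fiber_form (F : Cinf (arrows G)) (x : M) (e e' : fiber E x) : R :=
  contrast_form F (through e) (through e') x.

Definition form_kernel (F : Cinf (arrows G)) (x : M) : set (fiber E x) :=
  [set e | forall e', fiber_form F e e' = 0].

Definition regular_contrast (F : Cinf (arrows G)) : Prop :=
  contrast_function F /\ exists k, is_subbundle (form_kernel F) k.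

(* The last term is also - X^R Y^R Z^L F restricted to M, since the tangent map of
   inv sends X^L to - X^R. *)
Definition koszul_contrast (F : Cinf (arrows G)) : Prop :=
  regular_contrast F /\
  forall X Y Z : sec E, (forall x, form_kernel F (Z x)) ->
    third_LLR F X Y Z = 0 /\ third_LLR (dual_contrast F) X Y Z = 0.

(* L^F = E / K^F. *)
Definition quot_kernel (F : Cinf (arrows G)) : bundle M := quot_bundle (form_kernel F).

Definition bar (F : Cinf (arrows G)) (X : sec E) : sec (quot_kernel F) :=
  class_sec (form_kernel F) X.

(* g^[F] on the fibre of L^F at x. *)
Definition quot_form (F : Cinf (arrows G)) (x : M)
    (l l' : fiber (quot_kernel F) x) : R :=
  fiber_form F (repr l) (repr l').

Record E_connection (V : bundle M) (nabla : sec E -> sec V -> sec V) : Prop := {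
  connDl : forall X X' s, nabla (X + X') s = nabla X s + nabla X' s;
  connDr : forall X s s', nabla X (s + s') = nabla X s + nabla X s';
  connRl : forall (a : R) X s,
    nabla (cinf_cst M a *: X) s = cinf_cst M a *: nabla X s;
  connRr : forall (a : R) X s,
    nabla X (cinf_cst M a *: s) = cinf_cst M a *: nabla X s;
  connZ : forall (f : Cinf M) X s, nabla (f *: X) s = f *: nabla X s;
  conn_leibniz : forall (f : Cinf M) X s,
    nabla X (f *: s) = f *: nabla X s + vact (anchor X) f *: s }.

(* s plays the role of nabla_X (bar Y): it represents, through g^[F], the functional
   Z |-> X^L Y^L Z^R H restricted to M; used with H = F and H = F^*. *)
Definition represents_LLR (F H : Cinf (arrows G)) (X Y : sec E)
    (s : sec (quot_kernel F)) : Prop :=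
  forall (Z : sec E) (x : M),
    quot_form (s x) (bar F Z x) = third_LLR H X Y Z x.

End Contrast.

(* Main.v *)
(* At a unit, [X^L - X^R] is tangent to the units, namely the image of [alpha X]. Since [dF]
   vanishes along the units, [V W F] there is symmetric in the vector fields [V] and [W] and
   depends only on their classes in [E]. Hence
   - [alpha X (Y^L Z^R F) = X^L Y^L Z^R F - X^R Y^L Z^R F], and [T inv (X^L) = - X^R] turns the
     last term into [X^L Z^L Y^R F^*] once [Y^L] and [Z^R] are exchanged, which gives duality;
   - [X^L Y^L Z^R F - Y^L X^L Z^R F] is the value of [g^F] on [X, Y] and [Z], which gives the
     torsion formula.
   Applied to a section [Y] of [K^F], duality together with the Koszul condition makes
   [X^L Y^L Z^R F] vanish on [K^F] in [Y] too; as [K^F] is a subbundle, the functional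
   [Z |-> X^L Y^L Z^R F] is locally represented by a smooth section, by Cramer's rule.

   The invariant field [X^L] is built from the part [v] of [X] tangent to the [tgt]-fibres by
   letting [v] act on smooth local extensions of [f] o L_g. This is well defined since [v]
   kills the functions that vanish on its fibre, by a fixed point argument (an implicit
   function theorem). Hadamard's lemma identifies algebraic derivations with
   coordinate vectors, which yields smoothness of [X^L] and [[Y^L, Z^R] = 0] at the units. *)

Require Import Defs.
From HB Require Import structures.
From mathcomp Require Import all_boot all_order all_algebra.
From mathcomp Require Import all_classical all_reals all_analysis.
From mathcomp Require Import ring lra.
Set Implicit Arguments.
Unset Strict Implicit.
Unset Printing Implicit Defensive.
Import Order.TTheory GRing.Theory Num.Theory numFieldNormedType.Exports.
Local Open Scope classical_set_scope.
Local Open Scope ring_scope.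

(** * Calculus in coordinate space *)

(** Tangent vectors are derivations of the global smooth functions, and multiplication is smooth
    only through local ambient extensions, so neither the target fibres nor the composable pairs are
    ever treated as manifolds. Local arguments rest on three devices: a cutoff turns a germ into a
    global function, [tangent_chain] computes a derivation from finitely many functions, and
    [mul_coord] writes [f (gmul g h)] as a smooth function of two coordinate blocks. Submersivity
    enters through [tangent_fiber].

    Right-invariant fields are reduced to left-invariant ones: [right_ext X] is minus the
    pushforward of [left_ext X] under inversion.

    Two questions of locality shape the end. A section of L^F is only known to lift to E locally, so
    the connection is defined point by point from local lifts, and nondegeneracy of the form, rather
    than a partition of unity, glues the values into a smooth section. The Koszul condition concerns
    sections lying in the kernel everywhere, and is first extended by cutoffs to sections lying in
    it near a point. *)

Section RowNorm.
Variables (R : realType) (n : nat).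
Implicit Types v : 'rV[R]_n.

Lemma rV_norm_le v (c : R) : 0 <= c -> (forall j, `|v 0 j| <= c) -> `|v| <= c.
Proof.
move=> c0 H; rewrite /Num.Def.normr/= mx_normrE; apply/bigmax_le => // -[i j] _ /=.
by rewrite (ord1 i).
Qed.

Lemma rV_norm_lt v (c : R) : 0 < c -> (forall j, `|v 0 j| < c) -> `|v| < c.
Proof.
move=> c0 H; rewrite /Num.Def.normr/= mx_normrE; apply/bigmax_lt => // -[i j] _ /=.
by rewrite (ord1 i).
Qed.

Lemma rV_coord_le v j : `|v 0 j| <= `|v|.
Proof.
rewrite [leRHS]/Num.Def.normr/= mx_normrE.
exact: (le_bigmax _ (fun ij => `|v ij.1 ij.2|) (0 : 'I_1, j)).
Qed.

Lemma delta_norm_le (i : 'I_n) (s : R) : `|s *: delta_mx 0 i : 'rV[R]_n| <= `|s|.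
Proof.
apply: rV_norm_le => // j; rewrite !mxE eqxx /=; case: eqP => _.
  by rewrite mulr1.
by rewrite mulr0 normr0.
Qed.
End RowNorm.

Lemma is_derive_line (R : realType) (V : normedModType R) (f : V -> R) x v (t : R) :
  derivable f (x + t *: v) v ->
  is_derive t 1 (fun t => f (x + t *: v)) ('D_v f (x + t *: v)).
Proof.
set g := fun t => _; move=> /derivableP [df Df].
have E : (fun h => h^-1 *: ((g \o shift t) (h *: 1) - g t)) =
   (fun h => h^-1 *: ((f \o shift (x + t *: v)) (h *: v) - f (x + t *: v))).
  apply/funext => h /=; rewrite /g /shift /=; congr (_ *: (f _ - _)).
  by rewrite [h *: 1]mulr1 scalerDl addrCA.
by split; [rewrite /derivable E | rewrite /derive E].
Qed.

Lemma line_MVT (R : realType) (V : normedModType R) (f : V -> R) x v (s : R) :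
  (forall t : R, `|t| <= `|s| -> derivable f (x + t *: v) v) ->
  exists2 t : R, `|t| <= `|s| & f (x + s *: v) - f x = s * 'D_v f (x + t *: v).
Proof.
move=> H; pose g (t : R) := f (x + t *: v).
have dg (t : R) : `|t| <= `|s| -> is_derive t 1 g ('D_v f (x + t *: v)).
  by move=> /H; exact: is_derive_line.
have cg (a b : R) : (forall t, t \in `[a, b] -> `|t| <= `|s|) -> {within `[a, b], continuous g}.
  move=> Hab; apply: continuous_in_subspaceT => t; rewrite inE => tab.
  have [/derivable1_diffP/differentiable_continuous] // := dg t (Hab t tab).
have [s0|s0] := leP 0 s.
  have bnd t : t \in `[0, s] -> `|t| <= `|s|.
    by rewrite in_itv /= => /andP[t0 ts]; rewrite !ger0_norm.
  have [||c cs E] := @MVT_segment R g (fun t => 'D_v f (x + t *: v)) 0 s s0.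
  - by move=> t /subset_itv_oo_cc /bnd; exact: dg.
  - exact: cg.
  exists c; first exact: bnd.
  by move: E; rewrite /g scale0r addr0 subr0 mulrC.
have bnd t : t \in `[s, 0] -> `|t| <= `|s|.
  by rewrite in_itv /= => /andP[t0 ts]; rewrite !ler0_norm ?lerN2 // ltW.
have [||c cs E] := @MVT_segment R g (fun t => 'D_v f (x + t *: v)) s 0 (ltW s0).
- by move=> t /subset_itv_oo_cc /bnd; exact: dg.
- exact: cg.
exists c; first exact: bnd.
by rewrite /g scale0r addr0 sub0r in E; rewrite -[LHS]opprB E mulrN opprK mulrC.
Qed.

Lemma differentiable_of_eps (R : realType) (V W : normedModType R) (f : V -> W)
    (L : {linear V -> W}) x : continuous L ->
  (forall e, 0 < e -> \forall h \near 0, `|f (h + x) - f x - L h| <= e * `|h|) ->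
  differentiable f x.
Proof.
move=> cL H.
have E : f \o shift x = cst (f x) + L +o_ 0 id.
  apply/eqaddoP => e e0; apply: filterS (H e e0) => h.
  by rewrite /= !fctE /= opprD addrA.
by apply/diff_locallyP; have -> : 'd f x = L :> (V -> W) by exact: diff_unique.
Qed.

Lemma derive_rV (R : realType) n (f : 'rV[R]_n -> R) x v : differentiable f x ->
  'D_v f x = \sum_i v 0 i * 'D_(delta_mx 0 i) f x.
Proof.
move=> df; rewrite (deriveE _ df) [in LHS](row_sum_delta v) linear_sum /=.
by apply: eq_bigr => j _; rewrite linearZ /= -(deriveE _ df).
Qed.

Section StrictDiff.
Variables (R : realType) (n : nat) (f : 'rV[R]_n -> R) (x : 'rV[R]_n).
Hypothesis df : forall i, \forall y \near x, derivable f y (delta_mx 0 i).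
Hypothesis cdf : forall i, {for x, continuous (fun y => 'D_(delta_mx 0 i) f y)}.

(** The segment from [z] to [y] is replaced by a path moving one coordinate at a time, so that the
    mean value theorem involves partial derivatives only. *)
Lemma C1_strict (e : R) : 0 < e -> exists2 d, 0 < d & forall y z,
  `|y - x| < d -> `|z - x| < d ->
  `|f y - f z - \sum_i (y - z) 0 i * 'D_(delta_mx 0 i) f x| <= e * `|y - z|.
Proof.
(* Each of the [n] coordinate steps costs [e']; dividing by [n.+1] also covers [n = 0]. *)
move=> e0; pose e' := e / n.+1%:R.
have e'0 : 0 < e' by rewrite divr_gt0.
have H : \forall y \near nbhs x, forall i, derivable f y (delta_mx 0 i) /\
    `|'D_(delta_mx 0 i) f x - 'D_(delta_mx 0 i) f y| < e'.
  apply: filter_forall => i.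
  have c1 := (@cvgrPdist_lt _ _ _ (nbhs x) (nbhs_filter x) _ _).1 (cdf (i := i)) e' e'0.
  by apply: filterS2 (df i) c1 => y; split.
have [d /= d0 Hd] := (@nbhs_ballP _ _ x _).1 H.
(* The corners [w j] stay within [d / 3] of [x] and each step is shorter than [2 * (d / 3)], so the
   path stays in the ball of radius [d]. *)
exists (d / 3) => [|y z yx zx]; first by rewrite divr_gt0.
pose w (j : nat) : 'rV[R]_n := \row_i (if (i < j)%N then y 0 i else z 0 i).
have wn : w n = y by apply/rowP => i; rewrite mxE ltn_ord.
have w0 : w 0%N = z by apply/rowP => i; rewrite mxE.
have wS (j : 'I_n) : w j.+1 = w j + (y - z) 0 j *: delta_mx 0 j.
  apply/rowP => i; rewrite !mxE eqxx /= ltnS leq_eqVlt.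
  have [->|ne] := eqVneq i j; first by rewrite eqxx ltnn /= mulr1 addrC subrK.
  by rewrite -(inj_eq val_inj) /= in ne; rewrite (negbTE ne) /= mulr0 addr0.
have wx j : `|w j - x| < d / 3.
  apply: rV_norm_lt => [|i]; first by rewrite divr_gt0.
  rewrite !mxE; case: ifP => _.
    by apply: le_lt_trans yx; rewrite (le_trans _ (rV_coord_le _ i)) // !mxE.
  by apply: le_lt_trans zx; rewrite (le_trans _ (rV_coord_le _ i)) // !mxE.
have yz : `|y - z| < 2 * (d / 3).
  have -> : y - z = (y - x) - (z - x) by rewrite opprB addrA subrK.
  by rewrite (le_lt_trans (ler_normB _ _)) //; lra.
have wb (j : 'I_n) (t : R) : `|t| <= `|(y - z) 0 j| ->
   forall i, derivable f (w j + t *: delta_mx 0 j) (delta_mx 0 i) /\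
    `|'D_(delta_mx 0 i) f x - 'D_(delta_mx 0 i) f (w j + t *: delta_mx 0 j)| < e'.
  move=> tj; apply: Hd; rewrite -ball_normE /ball_ /= distrC addrAC.
  apply: (le_lt_trans (ler_normD _ _)).
  have := le_lt_trans (le_trans tj (rV_coord_le _ j)) yz.
  have := delta_norm_le j t; have := wx j; lra.
have step (j : 'I_n) : `|f (w j.+1) - f (w j) - (y - z) 0 j * 'D_(delta_mx 0 j) f x|
     <= e' * `|y - z|.
  have [t tj] := @line_MVT R _ f (w j) (delta_mx 0 j) ((y - z) 0 j)
    (fun t tj => (wb j t tj j).1).
  rewrite -wS => ->; rewrite -mulrBr normrM mulrC ler_pM //.
    by rewrite distrC ltW // (wb j t tj j).2.
  exact: rV_coord_le.
have -> : f y - f z = \sum_(j < n) (f (w j.+1) - f (w j)).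
  by rewrite -(big_mkord xpredT (fun j => f (w j.+1) - f (w j))) telescope_sumr // wn w0.
rewrite -sumrB; apply: (le_trans (ler_norm_sum _ _ _)).
apply: (le_trans (ler_sum _ (fun j _ => step j))).
rewrite sumr_const card_ord -[X in X <= _]mulr_natl mulrA ler_wpM2r //.
rewrite /e' mulrCA ger_pMr // ler_pdivrMr // mul1r ler_nat //.
Qed.

Lemma C1_differentiable : differentiable f x.
Proof.
pose L (h : 'rV[R]_n) := \sum_i h 0 i * 'D_(delta_mx 0 i) f x.
have Llin : linear (L : 'rV[R]_n -> R).
  move=> a u v; rewrite /L scaler_sumr -big_split /=; apply: eq_bigr => i _.
  by rewrite !mxE mulrDl scalerAl.
pose L' : {linear 'rV[R]_n -> R} := HB.pack L (GRing.isLinear.Build _ _ _ _ L Llin).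
have cL : continuous L'.
  move=> h; apply: differentiable_continuous; rewrite /L' /= /L.
  have -> : (fun h0 : 'rV[R]_n => \sum_i h0 0 i * 'D_(delta_mx 0 i) f x)
       = (\sum_i (fun h0 : 'rV[R]_n => h0 0 i * 'D_(delta_mx 0 i) f x) : 'rV[R]_n -> R).
    by apply/funext => y; rewrite fct_sumE.
  apply: differentiable_sum => i; apply: differentiableM => //.
  exact: differentiable_coord.
apply: (@differentiable_of_eps _ _ _ f L' x cL) => e e0.
have [d d0 H] := C1_strict e0.
apply/nbhs_ballP; exists d => // h; rewrite -ball_normE /= sub0r normrN => hd.
by have := H (h + x) x; rewrite addrK subrr normr0 => /(_ hd d0).
Qed.
End StrictDiff.

(** * Flat functions and bump functions *)

Section Flat.
Variable R : realType.

(** The power of [t^-1] is a parameter because it makes the family stable under differentiation, so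
    that smoothness follows by induction on the order. *)
Definition flat (p : nat) (t : R) : R := if 0 < t then t^-1 ^+ p * expR (- t^-1) else 0.

Lemma flat0 p t : t <= 0 -> flat p t = 0.
Proof. by rewrite /flat ltNge => ->. Qed.

(** A single term of the series of [expR t^-1] beats [t^-1 ^+ p]. The two spare factors of [t] make
    the difference quotient at [0] tend to [0]. *)
Lemma flat_le p t : `|flat p t| <= (p.+2)`!%:R * t ^+ 2.
Proof.
rewrite /flat; case: ifP => t0; last by rewrite normr0 mulr_ge0 // sqr_ge0.
have i0 : 0 < t^-1 by rewrite invr_gt0.
have h0 : 0 <= t^-1 ^+ p * expR (- t^-1) by rewrite mulr_ge0 ?expR_ge0 // exprn_ge0 // ltW.
rewrite ger0_norm // expRN.
rewrite ler_pdivrMr ?expR_gt0 //.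
have := expR_ge1Dxn p.+1 (ltW i0); set f := (_`!%:R : R) => H.
have f0 : 0 < f by rewrite ltr0n fact_gt0.
have H2 : t^-1 ^+ p.+2 / f <= expR t^-1 by apply: le_trans H; rewrite lerDr.
apply: (@le_trans _ _ (f * t ^+ 2 * (t^-1 ^+ p.+2 / f))).
  rewrite -(addn2 p) exprD; set b := _ ^+ p.
  have -> : f * t ^+ 2 * (b * t^-1 ^+ 2 / f) = b by field; rewrite !gt_eqF.
  by [].
by rewrite ler_wpM2l // mulr_ge0 ?sqr_ge0 ?ltW.
Qed.

Lemma is_derive_flat p (t : R) :
  is_derive t 1 (flat p) (flat p.+2 t - p%:R * flat p.+1 t).
Proof.
have [t0|t0|->] := ltgtP t 0.
- rewrite !flat0 ?ltW // mulr0 subr0.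
  apply: (@near_eq_is_derive R R R (cst 0)).
  near=> s; rewrite flat0 // ltW //; near: s; exact: lt_nbhsl.
- apply: (@near_eq_is_derive R R R (fun s => s^-1 ^+ p * expR (- s^-1))).
    near=> s; rewrite /flat ifT //; near: s; exact: lt_nbhsr.
  have tn : t != 0 by rewrite gt_eqF.
  rewrite /flat t0.
  have d1 : is_derive t 1 (fun s : R => s^-1) (- t ^- 2).
    apply: is_derive_eq; [exact: is_deriveV | by rewrite scaler1].
  have d2 : is_derive t 1 (fun s : R => expR (- s^-1)) (expR (- t^-1) * t ^- 2).
    have d3 : is_derive t 1 (fun s : R => - s^-1) (- - t ^- 2) by exact: is_deriveN.
    have := @is_derive1_comp R expR (fun s : R => - s^-1) t _ _ (is_derive_expR _) d3.
    by rewrite opprK.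
  have := is_deriveM (is_deriveX p d1) d2.
  have -> : (fun s : R => s^-1 ^+ p * expR (- s^-1)) =
      (fun s : R => s^-1) ^+ p * (fun s : R => expR (- s^-1)).
    by apply/funext => s; rewrite !fctE; congr (_ * _); elim: (p) => // k /=; rewrite !exprS => ->.
  move=> H; apply: is_derive_eq.
  have -> : ((fun s : R => s^-1) ^+ p) t = t^-1 ^+ p.
    by elim: (p) => // k /=; rewrite !exprS => <-.
  rewrite /GRing.scale /= -exprVn; set E := expR _; case: (p) => [|k] /=.
    by set a := t^-1; ring.
  rewrite !exprS; set b := _ ^+ k; set a := t^-1; ring.
- rewrite !flat0 // mulr0 subr0.
  have c : h^-1 *: ((flat p \o shift 0) (h *: (1 : R)) - flat p 0) @[h --> (0:R)^'] --> (0 : R).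
    apply/cvgrPdist_le => e e0; near=> h.
    have hn : h != 0 by near: h; exact: nbhs_dnbhs_neq.
    rewrite /= addr0 (flat0 p (lexx 0)) subr0 sub0r normrN normrM normfV [h *: 1]mulr1.
    rewrite ler_pdivrMl ?normr_gt0 //.
    apply: (le_trans (flat_le p h)); rewrite -(real_normK (num_real h)) expr2 mulrCA.
    rewrite ler_wpM2l // -ler_pdivlMl ?ltr0n ?fact_gt0 //.
    near: h; apply: dnbhs0_le; rewrite mulr_gt0 // invr_gt0 ltr0n fact_gt0 //.
  split; last by rewrite /derive; apply: cvg_lim.
  by apply/cvg_ex; exists 0.
Unshelve. all: by end_near. Qed.
End Flat.

Lemma derive_coord (R : realType) n (i j : 'I_n) (z : 'rV[R]_n) :
  'D_(delta_mx 0 i) (fun y : 'rV[R]_n => y 0 j) z = (i == j)%:R.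
Proof.
have := @derive_mx R _ 1 n id z (delta_mx 0 i) (@derivable_id R _ _ _).
by rewrite derive_id => /matrixP /(_ 0 j); rewrite [RHS]mxE => <-; rewrite mxE eqxx eq_sym.
Qed.

Section CkMore.
Variables (R : realType) (n : nat).
Implicit Types (U : set 'rV[R]_n) (h : 'rV[R]_n -> R).

Lemma derive_comp_real (V : normedModType R) (h : V -> R) (g : R -> R) x v dg :
  differentiable h x -> is_derive (h x) 1 g dg ->
  'D_v (g \o h) x = dg * 'D_v h x.
Proof.
move=> dh [/[dup] dgx /derivable1_diffP dg1 <-].
rewrite deriveE; last exact: differentiable_comp.
by rewrite diff_comp //= deriv1E // derive1E -deriveE // [LHS]mulrC.
Qed.

Lemma Ck_coord k U (j : 'I_n) : Ck k U (fun x => x 0 j).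
Proof.
case: k => [|k] /=.
  by move=> x _; apply: differentiable_continuous; exact: differentiable_coord.
split=> [x _|i]; first exact: differentiable_coord.
have -> : (fun x : 'rV[R]_n => 'D_(delta_mx 0 i) (fun y : 'rV[R]_n => y 0 j) x)
   = (fun _ => (i == j)%:R); last exact: Ck_cst.
by apply/funext => x; exact: derive_coord.
Qed.

Lemma CkN k U h : open U -> Ck k U h -> Ck k U (fun x => - h x).
Proof.
move=> oU H; apply: (Ck_ext oU _ (CkM oU (Ck_cst k U (-1)) H)) => x _.
by rewrite mulN1r.
Qed.

Lemma CkB k U h h' : open U -> Ck k U h -> Ck k U h' -> Ck k U (fun x => h x - h' x).
Proof. by move=> oU H H'; apply: CkD => //; exact: CkN. Qed.

Lemma Ck_flat k U p h : open U -> Ck k U h -> Ck k U (fun x => flat p (h x)).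
Proof.
move=> oU; elim: k p h => [|k IH] p h.
  move=> ch x Ux; apply: continuous_comp; first exact: ch.
  have [/derivable1_diffP/differentiable_continuous] // := is_derive_flat p (h x).
move=> H; have H' := CkS H; case: H => dh Dh; split.
  move=> x Ux; apply: differentiable_comp; first exact: dh.
  by have [/derivable1_diffP] := is_derive_flat p (h x).
move=> i.
have K : Ck k U (fun x => (flat p.+2 (h x) - p%:R * flat p.+1 (h x)) * 'D_(delta_mx 0 i) h x).
  apply: CkM => //; last exact: Dh.
  apply: CkB => //; first exact: IH.
  by apply: CkM => //; [exact: Ck_cst | exact: IH].
apply: (Ck_ext oU _ K) => x Ux.
by rewrite (derive_comp_real (g := flat p) _ (dh x Ux) (is_derive_flat p (h x))).
Qed.

Lemma CkV k U h : open U -> (forall x, U x -> h x != 0) -> Ck k U h ->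
  Ck k U (fun x => (h x)^-1).
Proof.
move=> oU h0; elim: k h h0 => [|k IH] h h0.
  by move=> ch x Ux; apply: continuousV; [exact: h0 | exact: ch].
move=> H; have H' := CkS H; case: H => dh Dh; split.
  by move=> x Ux; apply: differentiableV; [exact: dh | exact: h0].
move=> i.
have K : Ck k U (fun x => - ((h x)^-1 * (h x)^-1) * 'D_(delta_mx 0 i) h x).
  by apply: CkM => //; [apply: CkN => //; apply: CkM => //; exact: IH | exact: Dh].
apply: (Ck_ext oU _ K) => x Ux.
rewrite deriveV; [|exact: h0|exact/diff_derivable/dh].
by rewrite -exprVn expr2.
Qed.

(* [flat 0] vanishes for [u <= 0], so [flat 0 (flat 0 1 - flat 0 u)] is constant for
   [u <= 0] and zero for [u >= 1]. *)
Lemma bump_rV (x0 : 'rV[R]_n) (r : R) : 0 < r ->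
  exists b : 'rV[R]_n -> R, [/\ smooth_on setT b, \forall x \near x0, b x = 1 &
    forall x, r <= `|x - x0| -> b x = 0].
Proof.
(* [q] is the squared Euclidean distance, since the sup norm is not smooth. At sup distance at least
   [r] one has [q >= r ^+ 2 = 2 * rho], so [(q - rho) / rho] is at least [1] there, and it is
   negative near [x0]. *)
move=> r0; pose q (x : 'rV[R]_n) := \sum_i (x 0 i - x0 0 i) * (x 0 i - x0 0 i).
pose rho := r ^+ 2 / 2; have rho0 : 0 < rho by rewrite divr_gt0 // exprn_gt0.
have sq k : Ck k setT q.
  apply: Ck_sum => [|i]; first exact: openT.
  have C : Ck k setT (fun x => x 0 i - x0 0 i).
    by apply: CkB; [exact: openT | exact: Ck_coord | exact: Ck_cst].
  by apply: CkM => //; exact: openT.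
have flat_gt0 (t : R) : 0 < t -> 0 < flat 0 t by rewrite /flat => ->; rewrite expr0 mul1r expR_gt0.
have kap := flat_gt0 _ (flat_gt0 1 ltr01).
pose b x := flat 0 (flat 0 1 - flat 0 ((q x - rho) * rho^-1)) * (flat 0 (flat 0 (1 : R)))^-1.
exists b; split.
- move=> k; have oT := @openT 'rV[R]_n.
  apply: CkM => //; last exact: Ck_cst.
  apply: Ck_flat => //; apply: CkB => //; first exact: Ck_cst.
  apply: Ck_flat => //; apply: CkM => //; last exact: Ck_cst.
  by apply: CkB => //; exact: Ck_cst.
- have q0 : q x0 = 0 by rewrite /q big1 // => i _; rewrite subrr mul0r.
  have : \forall x \near x0, q x < rho.
    have := Ck_cont (sq 0%N) (x := x0) I.
    by move=> /(_ _ (@lt_nbhsl _ _ _ _)); rewrite q0; apply.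
  apply: filterS => x qx; rewrite /b (@flat0 _ 0 ((q x - rho) * _)).
    by rewrite subr0 divff // gt_eqF.
  by rewrite pmulr_lle0 ?invr_gt0 // subr_le0 ltW.
- move=> x rx; rewrite /b flat0 ?mul0r // subr_le0.
  have : exists j, r <= `|(x - x0) 0 j|.
    apply/existsP; apply: contraTT rx; rewrite negb_exists => /forallP H.
    by rewrite -ltNge; apply: rV_norm_lt => // j; rewrite ltNge.
  case=> j rj.
  have q2 : r ^+ 2 <= q x.
    rewrite /q (bigD1 j) //= -[leLHS]addr0 lerD //.
      rewrite -expr2 -[leRHS]real_normK ?num_real //.
      by move: rj; rewrite !mxE => rj; rewrite !expr2 ler_pM // ltW.
    by apply: sumr_ge0 => i _; rewrite -expr2 sqr_ge0.
  set u := _ * _; have u1 : 1 <= u.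
    by rewrite /u ler_pdivlMr // mul1r /rho; lra.
  have u0 : 0 < u by apply: lt_le_trans u1.
  rewrite /flat ltr01 u0 !expr0 !mul1r ler_expR lerN2 invr1 invf_le1 //.
Qed.

End CkMore.

(** * Integrals over the unit interval and Hadamard's lemma *)

Section UnitIntegral.
Variable R : realType.
Implicit Types f g : R -> R.

Definition int01 f : R := (\int[@lebesgue_measure R]_(t in `[0%R, 1%R]) f t)%R.

Lemma int01_integrable f : continuous f ->
  (@lebesgue_measure R).-integrable `[0%R, 1%R] (EFin \o f).
Proof.
move=> cf; apply: continuous_compact_integrable; first exact: segment_compact.
exact: continuous_subspaceT.
Qed.

Lemma int01D f g : continuous f -> continuous g ->
  int01 (fun t => f t + g t) = int01 f + int01 g.
Proof. by move=> cf cg; apply: RintegralD => //; exact: int01_integrable. Qed.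

Lemma int01Z f (a : R) : continuous f -> int01 (fun t => a * f t) = a * int01 f.
Proof. by move=> cf; apply: RintegralZl => //; exact: int01_integrable. Qed.

Lemma int01B f g : continuous f -> continuous g ->
  int01 (fun t => f t - g t) = int01 f - int01 g.
Proof. by move=> cf cg; apply: RintegralB => //; exact: int01_integrable. Qed.

Lemma int01_sum n (f : 'I_n -> R -> R) : (forall i, continuous (f i)) ->
  int01 (fun t => \sum_i f i t) = \sum_i int01 (f i).
Proof.
move=> cf.
elim: (index_enum _) => [|i s IH].
  rewrite big_nil; under [X in int01 X]eq_fun do rewrite big_nil.
  by rewrite /int01 Rintegral_cst // mul0r.
rewrite big_cons -IH -int01D //; first by congr int01; apply/funext => t; rewrite big_cons.
elim: {IH} s => [|j s IH] t.
  by under [X in continuous_at _ X]eq_fun do rewrite big_nil; exact: cvg_cst.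
under [X in continuous_at _ X]eq_fun do rewrite big_cons.
by apply: cvgD; [exact: cf | exact: IH].
Qed.

Lemma int01_le f (M : R) : continuous f ->
  (forall t, 0 <= t <= 1 -> `|f t| <= M) -> `|int01 f| <= M.
Proof.
move=> cf fM; apply: (le_trans (le_normr_Rintegral _ _)) => //.
  exact: int01_integrable.
have -> : M = int01 (fun=> M).
  rewrite /int01 Rintegral_cst // (_ : fine _ = 1) ?mulr1 //.
  have := lebesgue_measure_itv (`[0%R, 1%R] : interval R).
  by rewrite /= lte_fin ltr01 oppr0 adde0 => ->.
apply: le_Rintegral => //.
- by apply: int01_integrable => t; apply: cvg_norm; exact: cf.
- by apply: int01_integrable => t; exact: cvg_cst.
Qed.

Lemma int01_FTC f F : continuous f -> (forall t : R, is_derive t 1 F (f t)) ->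
  int01 f = F 1 - F 0.
Proof.
move=> cf dF; rewrite /int01 /Rintegral (@continuous_FTC2 _ f F) //.
- exact: continuous_subspaceT.
- have cF t : {for t, continuous F}.
    by have [/derivable1_diffP/differentiable_continuous] := dF t.
  split=> [t _||]; first by have [] := dF t.
    by apply: cvg_at_right_filter; exact: cF.
  by apply: cvg_at_left_filter; exact: cF.
- by move=> t _; rewrite derive1E; have [_ ->] := dF t.
Qed.

End UnitIntegral.

Section Hadamard.
Variables (R : realType) (n : nat) (x0 : 'rV[R]_n).
Implicit Types (phi : 'rV[R]_n -> R) (x : 'rV[R]_n).

Let pt (t : R) x := x0 + t *: (x - x0).

(** The mean of [phi] over the segment from [x0] to [x] with weight [t ^+ p]. Each derivative in [x]
    produces one more factor [t], hence the parameter [p]. *)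
Definition radial_mean (p : nat) phi x : R :=
  int01 (fun t => t ^+ p * phi (x0 + t *: (x - x0))).

Let pt_cont x : continuous (pt^~ x).
Proof.
move=> t; apply: cvgD; first exact: cvg_cst.
by apply: cvgZr_tmp; exact: cvg_id.
Qed.

Let integrand_cont p phi x : continuous phi -> continuous (fun t : R => t ^+ p * phi (pt t x)).
Proof.
move=> cphi t; apply: cvgM; first exact: exprn_continuous.
by apply: continuous_comp; [exact: pt_cont | exact: cphi].
Qed.

(** Compactness of the unit interval makes the estimate uniform in [t], which suffices to pass to
    the limit under the integral, both for the continuity and for the differentiability of
    [radial_mean]. *)
Lemma segment_uniform_continuous phi x (e : R) : continuous phi -> 0 < e ->
  \forall u \near (0 : 'rV[R]_n), forall t, 0 <= t <= 1 ->
    `|phi (x0 + t *: (x - x0) + u) - phi (x0 + t *: (x - x0))| < e.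
Proof.
move=> cphi e0.
have /compact_near_coveringP/(_ _ (nbhs (0 : 'rV[R]_n))
  (fun u t => `|phi (pt t x + u) - phi (pt t x)| < e)) := @segment_compact R 0 1.
move=> /(_ (nbhs_filter _)) H.
have : \forall u \near (0 : 'rV[R]_n), `[0, 1] `<=` (fun t => `|phi (pt t x + u) - phi (pt t x)| < e).
  apply: H => t0 _.
  have c1 := (@cvgrPdist_lt _ _ _ (nbhs (pt t0 x)) (nbhs_filter _) _ _).1 (cphi (pt t0 x)) (e / 2).
  have [|d /= d0 Hd] := (@nbhs_ballP _ _ (pt t0 x) _).1 (c1 _); first by rewrite divr_gt0.
  have c2 := (@cvgrPdist_lt _ _ _ (nbhs t0) (nbhs_filter _) _ _).1 (@pt_cont x t0) (d / 2).
  exists ([set t | `|pt t0 x - pt t x| < d / 2], [set u | `|u| < d / 2]) => /=.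
    split; first by apply: c2; rewrite divr_gt0.
    apply/nbhs_ballP; exists (d / 2) => /=; first by rewrite divr_gt0.
    by move=> u; rewrite -ball_normE /= sub0r normrN.
  move=> [t u] /= [ht hu].
  have h1 : `|phi (pt t0 x) - phi (pt t x + u)| < e / 2.
    apply: Hd; rewrite -ball_normE /= opprD addrA.
    by apply: le_lt_trans (ler_normB _ _) _; lra.
  have h2 : `|phi (pt t0 x) - phi (pt t x)| < e / 2.
    by apply: Hd; rewrite -ball_normE /=; lra.
  rewrite distrC -[_ - _](subrKA (phi (pt t0 x))).
  rewrite distrC in h2.
  by apply: le_lt_trans (ler_normD _ _) _; lra.
by apply: filterS => u Hu t t01; apply: Hu; rewrite /= in_itv.
Qed.

Lemma radial_mean_continuous p phi : continuous phi -> continuous (radial_mean p phi).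
Proof.
move=> cphi x; apply/(@cvgrPdist_le _ _ _ (nbhs x) (nbhs_filter x)) => e e0.
have [d /= d0 Hd] := (@nbhs_ballP _ _ 0 _).1 (segment_uniform_continuous x cphi e0).
apply/nbhs_ballP; exists d => // y; rewrite -ball_normE /= => yx.
rewrite /radial_mean -int01B; try exact: integrand_cont.
apply: int01_le => [t|t /andP[t0 t1]].
  by apply: cvgB; exact: integrand_cont.
rewrite -mulrBr normrM distrC -[leRHS]mul1r ler_pM //.
  by rewrite normrX ger0_norm // exprn_ile1.
have -> : x0 + t *: (y - x0) = x0 + t *: (x - x0) + t *: (y - x).
  by rewrite -addrA -scalerDr; congr (_ + _ *: _); rewrite [RHS]addrC addrA subrK.
apply/ltW/Hd; last by rewrite t0.
rewrite -ball_normE /= sub0r normrN normrZ ger0_norm //.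
by rewrite (le_lt_trans (ler_piMl _ t1)) // distrC.
Qed.

(** Differentiation under the integral sign: for each [t] the mean value theorem replaces the
    increment of [phi] by [t * h] times a derivative taken within [|h|] of the segment. *)
Lemma is_derive_radial_mean p phi (i : 'I_n) x :
  (forall y, derivable phi y (delta_mx 0 i)) ->
  continuous phi ->
  continuous (fun y => 'D_(delta_mx 0 i) phi y) ->
  is_derive x (delta_mx 0 i) (radial_mean p phi)
    (radial_mean p.+1 (fun y => 'D_(delta_mx 0 i) phi y) x).
Proof.
set D := fun y => _; move=> dphi cphi cD; set ei := delta_mx 0 i.
have c : h^-1 *: ((radial_mean p phi \o shift x) (h *: ei) - radial_mean p phi x)
    @[h --> (0 : R)^'] --> radial_mean p.+1 D x.
  apply/cvgrPdist_le => e e0.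
  have [d /= d0 Hd] := (@nbhs_ballP _ _ 0 _).1 (segment_uniform_continuous x cD e0).
  near=> h; have hn : h != 0 by near: h; exact: nbhs_dnbhs_neq.
  have hd : `|h| < d by near: h; exact: dnbhs0_lt.
  (* Multiplying by [|h|] removes the quotient, so that all terms fit under one integral. *)
  rewrite /= -(ler_pM2l (x := `|h|)) ?normr_gt0 // -normrM mulrBr.
  rewrite -[h^-1 *: _]/(h^-1 * _) mulVKf //.
  rewrite /radial_mean -int01Z; last exact: integrand_cont.
  rewrite -[X in _ - X]int01B; try exact: integrand_cont.
  rewrite -int01B; first last.
  - by move=> t; apply: cvgB; exact: integrand_cont.
  - by move=> t; apply: cvgMr; exact: integrand_cont.
  apply: int01_le => [t|t /andP[t0 t1]].
    by apply: cvgB; [apply: cvgMr | apply: cvgB]; exact: integrand_cont.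
  have -> : x0 + t *: (h *: ei + x - x0) = x0 + t *: (x - x0) + (t * h) *: ei.
    by rewrite -addrA scalerDr scalerA addrA [RHS]addrAC.
  have [//|s sth E] := @line_MVT _ _ phi (x0 + t *: (x - x0)) ei (t * h).
  rewrite -mulrBr E -/(D _).
  have -> : forall a b, h * (t ^+ p.+1 * a) - t ^+ p * (t * h * b) = h * (t ^+ p.+1 * (a - b)).
    by move=> a b; rewrite exprS; ring.
  rewrite normrM ler_wpM2l // normrM -[leRHS]mul1r ler_pM //.
    by rewrite normrX ger0_norm // exprn_ile1.
  rewrite distrC; apply/ltW/Hd; last by rewrite t0.
  rewrite -ball_normE /= sub0r normrN (le_lt_trans (delta_norm_le i s)) //.
  apply: (le_lt_trans sth); rewrite normrM ger0_norm //.
  by rewrite (le_lt_trans (ler_piMl _ t1)).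
split; last by rewrite /derive; apply: cvg_lim.
by apply/cvg_ex; exists (radial_mean p.+1 D x).
Unshelve. all: by end_near. Qed.

Lemma Ck_radial_mean k p phi : Ck k setT phi -> Ck k setT (radial_mean p phi).
Proof.
elim: k p phi => [|k IH] p phi.
  by move=> cphi x _; apply: radial_mean_continuous => y; exact: cphi.
move=> sphi; have [dphi Dphi] := sphi.
have cphi : continuous phi by move=> y; exact: (Ck_cont sphi).
have dRM i x := @is_derive_radial_mean p phi i x
  (fun y => diff_derivable (dphi y I)) cphi (fun y => Ck_cont (Dphi i) I).
have E i : (fun x => 'D_(delta_mx 0 i) (radial_mean p phi) x) =
    radial_mean p.+1 (fun y => 'D_(delta_mx 0 i) phi y).
  by apply/funext => x; have [_ ->] := dRM i x.
split=> [x _|i]; last by rewrite E; exact: IH (Dphi i).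
apply: C1_differentiable => i; last by rewrite E; exact: (Ck_cont (IH _ _ (Dphi i))).
by apply: filterE => y; have [] := dRM i y.
Qed.

Lemma radial_mean0 phi : radial_mean 0 phi x0 = phi x0.
Proof.
rewrite /radial_mean (_ : (fun t : R => _) = fun=> phi x0 * 1).
  rewrite int01Z; last by move=> t; exact: cvg_cst.
  rewrite (int01_FTC (F := id)); first by rewrite subr0 mulr1.
    by move=> t; exact: cvg_cst.
by apply/funext => t; rewrite expr0 mul1r subrr scaler0 addr0 mulr1.
Qed.

(** The fundamental theorem of calculus along the segment. The coefficients are again smooth in [x],
    by [Ck_radial_mean]. *)
Lemma Hadamard phi x : Ck 1 setT phi ->
  phi x = phi x0 + \sum_i (x 0 i - x0 0 i) *
    radial_mean 0 (fun y => 'D_(delta_mx 0 i) phi y) x.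
Proof.
move=> [dphi Dphi]; apply/eqP; rewrite addrC -subr_eq; apply/eqP.
pose f (i : 'I_n) (t : R) := t ^+ 0 * 'D_(delta_mx 0 i) phi (x0 + t *: (x - x0)).
have cf i : continuous (f i).
  by apply: (@integrand_cont 0 (fun y => 'D_(delta_mx 0 i) phi y) x) => y; exact: Dphi.
have E : int01 (fun t => \sum_i (x 0 i - x0 0 i) * f i t) =
    \sum_i (x 0 i - x0 0 i) * int01 (f i).
  rewrite int01_sum => [|i t]; last by apply: cvgMr; exact: cf.
  by apply: eq_bigr => i _; rewrite int01Z.
have dF (t : R) : is_derive t 1 (fun t : R => phi (x0 + t *: (x - x0)))
    (\sum_i (x 0 i - x0 0 i) * f i t).
  have H : differentiable phi (x0 + t *: (x - x0)) by exact: dphi.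
  have := is_derive_line (diff_derivable (v := x - x0) H).
  rewrite (derive_rV _ H) /f; under eq_bigr do rewrite !mxE -[X in _ * X]mul1r.
  by [].
have cS : continuous (fun t => \sum_i (x 0 i - x0 0 i) * f i t).
  apply: continuous_big; first exact: add_continuous.
  by move=> i _ s; apply: cvgMr; exact: cf.
by rewrite -[RHS]E (int01_FTC cS dF) scale1r scale0r addr0 (addrC x0 (x - x0)) subrK.
Qed.
End Hadamard.

(** * Functions vanishing on a level set of a submersion *)

Lemma fixed_point_ball (R : realType) m (f : 'rV[R]_m -> 'rV[R]_m) (rho : R) :
  0 <= rho -> (forall z, `|z| <= rho -> `|f z| <= rho) ->
  (forall z z', `|z| <= rho -> `|z'| <= rho -> `|f z - f z'| <= 2^-1 * `|z - z'|) ->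
  exists2 z, `|z| <= rho & f z = z.
Proof.
move=> rho0 fU fc.
pose X : completeNormedModType R := HB.pack_for (completeNormedModType R) 'rV[R]_m
  (NormedModule.on 'rV[R]_m) (Complete.on 'rV[R]_m).
pose U : set X := [set z | `|z| <= rho].
have fUU : set_fun U U (f : X -> X) by move=> z /fU.
pose F : {fun U >-> U} := HB.pack (f : X -> X) (isFun.Build X X U U f fUU).
have [|||z Uz fz] := @banach_fixed_point R X U F.
- exists (2^-1)%:nng; split; first by rewrite /=; lra.
  by move=> [z z'] [/= Uz Uz']; exact: fc.
- have -> : U = (@Num.Def.normr R X) @^-1` [set t | t <= rho] by [].
  apply: (@closed_comp X R^o (@Num.Def.normr R X)); last exact: closed_le.
  by move=> z _; exact: norm_continuous.
- by exists 0; rewrite /U /= normr0.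
by exists z => //; rewrite [RHS]fz.
Qed.

Lemma rV_mulmx_le (R : realType) m n (A : 'M[R]_(m, n)) :
  exists2 C : R, 0 < C & forall z : 'rV_m, `|z *m A| <= C * `|z|.
Proof.
exists (1 + \sum_k \sum_i `|A k i|) => [|z].
  by rewrite ltr_pwDl // sumr_ge0 // => k _; apply: sumr_ge0.
apply: rV_norm_le => [|i]; first by rewrite mulr_ge0 // addr_ge0 // sumr_ge0 // => k _; apply: sumr_ge0.
rewrite !mxE; apply: (le_trans (ler_norm_sum _ _ _)).
rewrite mulrDl mul1r; apply: ler_wpDl => //; rewrite mulr_suml; apply: ler_sum => k _.
rewrite normrM mulrC ler_pM //; last exact: rV_coord_le.
by rewrite (bigD1 i) //= lerDl sumr_ge0.
Qed.

Lemma rV_form_le (R : realType) n (a : 'I_n -> R) :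
  exists2 C : R, 0 < C & forall z : 'rV_n, `|\sum_i z 0 i * a i| <= C * `|z|.
Proof.
exists (1 + \sum_i `|a i|) => [|z]; first by rewrite ltr_pwDl // sumr_ge0.
apply: (le_trans (ler_norm_sum _ _ _)); rewrite mulrDl mul1r.
apply: ler_wpDl => //; rewrite mulr_suml; apply: ler_sum => k _.
by rewrite normrM mulrC ler_pM //; exact: rV_coord_le.
Qed.

Lemma near_norm_ball (R : realType) (V : normedModType R) (P : V -> Prop) x :
  (\forall y \near x, P y) -> exists2 d : R, 0 < d & forall y, `|y - x| < d -> P y.
Proof.
move=> /nbhs_ballP[d /= d0 H]; exists d => // y yx; apply: H.
by rewrite -ball_normE /= distrC.
Qed.

Section LevelSet.
Variables (R : realType) (n m : nat) (tau : 'rV[R]_n -> 'rV[R]_m)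
  (phi : 'rV[R]_n -> R) (p w : 'rV[R]_n) (A : 'M[R]_(m, n)).
Local Notation D i f := ('D_(delta_mx 0 i) f p).
Local Notation tauj j := (fun y => tau y 0 j).
Hypothesis dtau : forall j i, \forall y \near p, derivable (tauj j) y (delta_mx 0 i).
Hypothesis cdtau : forall j i, {for p, continuous (fun y => 'D_(delta_mx 0 i) (tauj j) y)}.
Hypothesis dphi : differentiable phi p.
Hypothesis tau_w : forall j, \sum_i w 0 i * D i (tauj j) = 0.
Hypothesis tau_A : forall k j, \sum_i A k i * D i (tauj j) = (k == j)%:R.
Hypothesis phi0 : \forall y \near p, tau y = tau p -> phi y = 0.

Let strict (e : R) : 0 < e -> exists2 d, 0 < d & forall y z,
  `|y - p| < d -> `|z - p| < d -> forall j,
  `|tau y 0 j - tau z 0 j - \sum_i (y - z) 0 i * D i (tauj j)| <= e * `|y - z|.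
Proof.
move=> e0.
(* The estimate persists when the radius shrinks, so it holds for all small positive [d], and the
   finitely many [j] are treated at once by intersecting neighbourhoods. *)
have : \forall d \near (0 : R)^'+, forall j y z, `|y - p| < d -> `|z - p| < d ->
    `|tau y 0 j - tau z 0 j - \sum_i (y - z) 0 i * D i (tauj j)| <= e * `|y - z|.
  apply: filter_forall => j.
  have [d d0 H] := C1_strict (@dtau j) (@cdtau j) e0.
  near=> d' => y z yp zp; apply: H; [apply: lt_le_trans yp _|apply: lt_le_trans zp _];
    near: d'; exact: nbhs_right_le.
move=> H; have [d [d0 Hd]] : exists d, 0 < d /\ forall j y z, `|y - p| < d -> `|z - p| < d ->
    `|tau y 0 j - tau z 0 j - \sum_i (y - z) 0 i * D i (tauj j)| <= e * `|y - z|.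
  apply: (@filter_ex _ (0 : R)^'+); near=> d; split; last by near: d.
  by near: d; exact: nbhs_right_gt.
by exists d => // y z yp zp j; exact: Hd.
Unshelve. all: by end_near. Qed.

(* The fixed point of [z - (tau (p + s w + z A) - tau p)] corrects the segment
   [p + s w] to a curve in the level set of [tau] with the same velocity [w]. *)
Lemma level_set_curve (eta : R) : 0 < eta ->
  \forall s \near (0 : R), exists z : 'rV_m,
    `|z| <= 2 * (eta * `|s *: w|) /\ tau (p + s *: w + z *m A) = tau p.
Proof.
move=> eta0; have [C C0 HC] := rV_mulmx_le A.
(* [C] bounds [z *m A], so the constant [2^-1 / C] makes [f] below a contraction of ratio [2^-1]. *)
have [|d1 d10 H1] := @strict (2^-1 / C); first by rewrite divr_gt0.
have [d2 d20 H2] := strict eta0.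
(* For [z] of norm at most [rho], the point [P z] is at distance at most [|s *: w| * K] from [p]. *)
pose K := 1 + C * (2 * eta); have K0 : 0 < K.
  by rewrite ltr_pwDl // ltW // mulr_gt0 // mulr_gt0.
have : \forall s \near (0 : R), `|s *: w| * K < d1 /\ `|s *: w| < d2.
  have c : {for (0 : R), continuous (fun s : R => `|s *: w|)}.
    apply: (@continuous_comp _ _ _ (fun s : R => s *: w) (@Num.Def.normr R _)).
      by apply: cvgZr_tmp; exact: cvg_id.
    exact: norm_continuous.
  have c' d : 0 < d -> \forall s \near (0 : R), `|s *: w| < d.
    by move=> d0; apply: (c [set t | t < d]); rewrite scale0r normr0; exact: lt_nbhsl.
  near=> s; split; last by near: s; exact: c'.
  by rewrite -ltr_pdivlMr //; near: s; apply: c'; rewrite divr_gt0.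
apply: filterS => s [s1 s2].
pose P z := p + s *: w + z *m A; pose rho := 2 * (eta * `|s *: w|).
have rho0 : 0 <= rho by rewrite mulr_ge0 // mulr_ge0 // ltW.
have PE z : P z - p = s *: w + z *m A by rewrite /P addrAC [p + _]addrC addrK.
have Pd z : `|z| <= rho -> `|P z - p| < d1.
  move=> zr; rewrite PE; apply: le_lt_trans (ler_normD _ _) (le_lt_trans _ s1).
  rewrite /K mulrDr mulr1 lerD2l; apply: (le_trans (HC z)).
  by apply: le_trans (ler_wpM2l (ltW C0) zr) _; rewrite /rho le_eqVlt; apply/orP; left; apply/eqP; ring.
pose f z := z - (tau (P z) - tau p).
have fc z z' : `|z| <= rho -> `|z'| <= rho -> `|f z - f z'| <= 2^-1 * `|z - z'|.
  move=> zr zr'; apply: rV_norm_le => [|j]; first by rewrite mulr_ge0 // invr_ge0.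
  have PP : P z - P z' = (z - z') *m A.
    by rewrite mulmxBl /P opprD addrACA subrr add0r.
  have := H1 _ _ (Pd z zr) (Pd z' zr') j; rewrite PP.
  have -> : \sum_i ((z - z') *m A) 0 i * D i (tauj j) = (z - z') 0 j.
    under eq_bigr do rewrite mxE mulr_suml.
    rewrite exchange_big /=; under eq_bigr do under eq_bigr do rewrite -mulrA.
    under eq_bigr do rewrite -mulr_sumr tau_A.
    rewrite (bigD1 j) //= eqxx mulr1 big1 ?addr0 // => k /negbTE ->.
    by rewrite mulr0.
  rewrite distrC => H; rewrite (_ : (f z - f z') 0 j =
    (z - z') 0 j - (tau (P z) 0 j - tau (P z') 0 j)); last by rewrite !mxE; ring.
  apply: (le_trans H); apply: (le_trans (ler_wpM2l _ (HC _))).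
    by rewrite divr_ge0 ?invr_ge0 // ltW.
  by rewrite mulrA divfK // gt_eqF.
(* As [w] lies in the kernel of the derivative of [tau], only the error term remains. This half of
   [rho] and the half coming from the contraction keep [f] in the ball. *)
have f0 : `|f 0| <= rho / 2.
  apply: rV_norm_le => [|j]; first by rewrite divr_ge0.
  have := H2 (P 0) p; rewrite PE mul0mx addr0 subrr normr0 => /(_ s2 d20 j).
  have -> : \sum_i (s *: w) 0 i * D i (tauj j) = 0.
    under eq_bigr do rewrite mxE -mulrA.
    by rewrite -mulr_sumr tau_w mulr0.
  rewrite subr0 /f sub0r !mxE normrN => H; apply: (le_trans H).
  by rewrite /rho mulrAC divff // mul1r.
have fU z : `|z| <= rho -> `|f z| <= rho.
  move=> zr; have := fc z 0 zr; rewrite normr0 subr0 => /(_ rho0) H.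
  rewrite -(subrK (f 0) (f z)); apply: (le_trans (ler_normD _ _)); lra.
have [z zr fz] := fixed_point_ball rho0 fU fc.
exists z; split => //; apply/eqP; rewrite -subr_eq0.
by have := congr1 (fun u => z - u) fz; rewrite /f subKr subrr => ->.
Unshelve. all: by end_near. Qed.

(** [phi] vanishes at the points of [level_set_curve], so its first order expansion at [p] bounds
    [s * L] by a multiple of [eta * |s|], with [eta] arbitrarily small. *)
Lemma derive_level_set : \sum_i w 0 i * D i phi = 0.
Proof.
have [C C0 HC] := rV_mulmx_le A.
have [K K0 HK] := rV_form_le (fun i => D i phi).
pose B := `|w| * (1 + 2 * C + K * C * 2).
set L := \sum_i _; apply/eqP; rewrite -normr_le0; apply/ler_addgt0Pr => e e0; rewrite add0r.
(* [eta <= 1] bounds the displacement [h] independently of [eta]. The denominator is [B + 1] because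
   [B] is [0] when [w] is. *)
pose eta := Num.min 1 (e / (B + 1)).
have B0 : 0 <= B.
  by rewrite mulr_ge0 // !addr_ge0 // ?mulr_ge0 // ltW.
have eta0 : 0 < eta by rewrite lt_min ltr01 divr_gt0 // ltr_pwDr.
have eta1 : eta <= 1 by rewrite ge_min lexx.
have etaB : eta * B <= e.
  apply: (@le_trans _ _ (e / (B + 1) * B)).
    by rewrite ler_wpM2r // ge_min lexx orbT.
  by rewrite mulrAC ler_pdivrMr ?ltr_pwDr // ler_wpM2l ?ltW // ltrDl.
have ephi : \forall h \near (0 : 'rV[R]_n),
    `|phi (h + p) - phi p - \sum_i h 0 i * D i phi| <= eta * `|h|.
  have /eqaddoP/(_ eta eta0) := diff_locally dphi.
  apply: filterS => h; rewrite /= !fctE /= -(deriveE _ dphi) (derive_rV _ dphi).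
  by rewrite opprD addrA.
have [d1 d10 H1] := near_norm_ball ephi; have [d2 d20 H2] := near_norm_ball phi0.
have p0 : phi p = 0 by apply: H2 => //; rewrite subrr normr0.
have lim0 : \forall s \near (0 : R), `|s *: w| * (1 + C * 2) < Num.min d1 d2.
  have c : {for (0 : R), continuous (fun s : R => `|s *: w| * (1 + C * 2))}.
    apply: cvgM; last exact: cvg_cst.
    apply: (@continuous_comp _ _ _ (fun s : R => s *: w) (@Num.Def.normr R _)).
      by apply: cvgZr_tmp; exact: cvg_id.
    exact: norm_continuous.
  apply: (c [set t | t < Num.min d1 d2]).
  by rewrite scale0r normr0 mul0r; apply: lt_nbhsl; rewrite lt_min d10.
have [s [s0 [z [zs tz]] sd]] : exists s : R, [/\ s != 0, exists z : 'rV_m,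
    `|z| <= 2 * (eta * `|s *: w|) /\ tau (p + s *: w + z *m A) = tau p &
    `|s *: w| * (1 + C * 2) < Num.min d1 d2].
  apply: (@filter_ex _ (0 : R)^'); near=> s; split.
  - by near: s; exact: nbhs_dnbhs_neq.
  - by near: s; apply: cvg_within; exact: level_set_curve.
  - by near: s; exact: cvg_within.
pose h := s *: w + z *m A.
have zb : `|z *m A| <= C * (2 * (eta * `|s *: w|)).
  by apply: le_trans (HC z) (ler_wpM2l (ltW C0) zs).
have hn : `|h| <= `|s *: w| * (1 + C * 2).
  apply: (le_trans (ler_normD _ _)); rewrite mulrDr mulr1 lerD2l; apply: (le_trans zb).
  rewrite (_ : C * (2 * (eta * `|s *: w|)) = eta * (`|s *: w| * (C * 2))); last by ring.
  by rewrite ler_piMl // mulr_ge0 // mulr_ge0 // ltW.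
have hd : `|h| < Num.min d1 d2 by exact: le_lt_trans sd.
move: hd; rewrite lt_min => /andP[hd1 hd2].
have ph0 : phi (h + p) = 0.
  by apply: H2; [rewrite addrK | rewrite -tz addrC /h addrA].
have := H1 h; rewrite subr0 ph0 p0 subrr sub0r normrN => /(_ hd1) Hh.
have E : \sum_i h 0 i * D i phi = s * L + \sum_i (z *m A) 0 i * D i phi.
  rewrite /L mulr_sumr -big_split /=; apply: eq_bigr => i _.
  by rewrite /h mxE mulrDl [(s *: w) 0 i]mxE mulrA.
have sL : `|s| * `|L| <= eta * `|h| + K * `|z *m A|.
  rewrite -normrM (_ : s * L = \sum_i h 0 i * D i phi - \sum_i (z *m A) 0 i * D i phi).
    by apply: (le_trans (ler_normB _ _)); apply: lerD => //; exact: HK.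
  by rewrite E addrK.
have sg : 0 < `|s| by rewrite normr_gt0.
rewrite -(ler_pM2l sg); apply: (le_trans sL).
apply: (@le_trans _ _ (`|s| * (eta * B))); last by rewrite ler_wpM2l.
apply: (@le_trans _ _ (eta * (`|s *: w| * (1 + C * 2)) + K * (C * (2 * (eta * `|s *: w|))))).
  by apply: lerD; rewrite ler_wpM2l // ltW.
rewrite normrZ /B le_eqVlt; apply/orP; left; apply/eqP; ring.
Unshelve. all: by end_near. Qed.
End LevelSet.

Lemma near_openE (T : topologicalType) (x : T) (P : T -> Prop) :
  (\forall y \near x, P y) -> exists U : set T, [/\ open U, U x & U `<=` P].
Proof. by rewrite /prop_near1 nbhsE => -[U [oU Ux] UP]; exists U. Qed.

Lemma dist_continuous (R : realType) (V : normedModType R) (x : V) :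
  continuous (fun z => `|z - x|).
Proof.
move=> z; have cz : {for z, continuous (fun z : V => z - x)}.
  by apply: continuousB; [exact: cvg_id | exact: cst_continuous].
exact: (cvg_norm cz).
Qed.

(** * Cutoff functions and tangent vectors on manifolds *)

Section Cutoff.
Variables (R : realType) (M : manifold R).
Implicit Types (O : set M) (f : M -> R).

Definition smooth_in O f := forall c, atlas c ->
  smooth_on (chart_map c @` (chart_dom c `&` O)) (f \o chart_inv c).

(** A closed set [C] inside [O] is what extension by zero needs: [O] and the complement of [C] form
    an open cover. *)
Definition cutoff O (chi : M -> R) :=
  chi \in @smooth_fun R M /\ exists C, [/\ closed C, C `<=` O & forall y, ~ C y -> chi y = 0].

Lemma smooth_fun_at f :
  (forall y, exists2 O, open O /\ O y & smooth_in O f) -> f \in @smooth_fun R M.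
Proof.
move=> H; apply/asboolP => c ac k; apply: Ck_local => _ [y cy <-].
have [A [oA Ay] sA] := H y.
by exists (chart_map c @` (chart_dom c `&` A)); [exists y | exact: sA].
Qed.

Lemma smooth_in_ext O f g : open O -> (forall y, O y -> f y = g y) ->
  smooth_in O f -> smooth_in O g.
Proof.
move=> oO fg sf c ac k; apply: Ck_ext (sf c ac k); first exact: open_chart_image.
by move=> _ [y [cy Oy] <-] /=; rewrite chart_mapK // fg.
Qed.

Lemma smooth_in0 O : smooth_in O (fun=> 0).
Proof. by move=> c ac k; exact: Ck_cst. Qed.

Lemma smooth_inM O f g : open O -> smooth_in O f -> smooth_in O g ->
  smooth_in O (fun y => f y * g y).
Proof.
by move=> oO sf sg c ac k; apply: CkM; [exact: open_chart_image|exact: sf|exact: sg].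
Qed.

Lemma smooth_fun_in O f : f \in @smooth_fun R M -> smooth_in O f.
Proof.
move=> /asboolP sf c ac k; apply: CkW (sf c ac k) => _ [y [cy _] <-].
by exists y.
Qed.

Lemma cutoffM O chi f : open O -> cutoff O chi -> smooth_in O f ->
  (fun y => chi y * f y) \in @smooth_fun R M.
Proof.
move=> oO [schi [C [cC CO chi0]]] sf; apply: smooth_fun_at => y.
have [Cy|nCy] := pselect (C y).
  exists O; first by split=> //; exact: CO.
  by apply: smooth_inM => //; exact: smooth_fun_in.
exists (~` C); first by split => //; exact: closed_openC.
apply: (@smooth_in_ext _ (fun=> 0)); first exact: closed_openC.
  by move=> z /chi0 ->; rewrite mul0r.
exact: smooth_in0.
Qed.

(** A bump function in a chart extends by zero to a smooth function because the image of the closed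
    ball carrying it is compact, hence closed since [M] is Hausdorff. *)
Lemma cutoff_exists O p : open O -> O p ->
  exists2 chi, cutoff O chi & \forall y \near p, chi y = 1.
Proof.
move=> oO Op; have [c ac cp] := atlas_cover p; set x := chart_map c p.
have oV : open (chart_map c @` (chart_dom c `&` O)) by exact: open_chart_image.
have [r r0 Hr] : exists2 r : R, 0 < r & forall y, `|y - x| < r ->
    (chart_map c @` (chart_dom c `&` O)) y.
  by apply: near_norm_ball; apply: open_nbhs_nbhs; split => //; exists p.
have [|b [sb b1 b0]] := @bump_rV R _ x (r / 2); first by rewrite divr_gt0.
pose B := [set z | `|z - x| <= r / 2].
have BV : B `<=` chart_map c @` (chart_dom c `&` O).
  by move=> z Bz; apply: Hr; apply: le_lt_trans Bz _; lra.
pose C := chart_inv c @` B.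
have cB : compact B.
  apply: bounded_closed_compact.
    exists (`|x| + r / 2); split; first by rewrite num_real.
    move=> e re z Bz; rewrite -(subrK x z).
    by apply: le_trans (ler_normD _ _) _; rewrite addrC (le_trans _ (ltW re)) // lerD2l.
  have -> : B = (fun z => `|z - x|) @^-1` [set t | t <= r / 2] by [].
  apply: closed_comp; last exact: closed_le.
  by move=> z _; exact: dist_continuous.
have cC : closed C.
  apply: compact_closed; first exact: manifold_hausdorff.
  apply: continuous_compact => //; apply: continuous_in_subspaceT => z.
  rewrite inE => /BV Vz; apply: chart_inv_continuous.
  by case: Vz => y [cy _] <-; exists y.
pose chi y := if `[< chart_dom c y >] then b (chart_map c y) else 0.
have chiC y : ~ C y -> chi y = 0.
  move=> nCy; rewrite /chi; case: asboolP => // cy; apply: b0.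
  rewrite leNgt; apply/negP => /ltW By; apply: nCy.
  by exists (chart_map c y) => //; rewrite chart_mapK.
exists chi.
  split; last first.
    exists C; split => // _ [z /BV [y [cy Oy] <-] <-].
    by rewrite chart_mapK.
  apply: smooth_fun_at => y; have [cy|ncy] := pselect (chart_dom c y).
    exists (chart_dom c); first by split => //; exact: chart_dom_open.
    move=> d ad k; apply: (@Ck_ext _ _ _ _ (b \o (chart_map c \o chart_inv d))).
    - by apply: open_chart_image; exact: chart_dom_open.
    - by move=> _ [z [dz cz] <-] /=; rewrite chart_mapK // /chi; case: asboolP.
    apply: (@Ck_comp _ _ _ _ setT) => //.
      by apply: open_chart_image; exact: chart_dom_open.
    by move=> j; exact: (atlas_compatible ad ac).
  exists (~` C).
    split; first exact: closed_openC.
    by case=> z /BV [y' [cy' _] <-]; rewrite chart_mapK // => yy; apply: ncy; rewrite -yy.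
  apply: (@smooth_in_ext _ (fun=> 0)); first exact: closed_openC.
    by move=> z /chiC.
  exact: smooth_in0.
have : \forall y \near p, b (chart_map c y) = 1.
  exact: (chart_map_continuous cp) _ b1.
have : \forall y \near p, chart_dom c y.
  by apply: open_nbhs_nbhs; split => //; exact: chart_dom_open.
by apply: filterS2 => y cy by1; rewrite /chi asboolT.
Qed.

(** Tangent vectors act on global functions only; this lets them act on functions smooth near a
    point. *)
Lemma smooth_in_extend O f p : open O -> O p -> smooth_in O f ->
  exists g : Cinf M, \forall y \near p, g y = f y.
Proof.
move=> oO Op sf; have [chi cchi chi1] := cutoff_exists oO Op.
exists (MkCinf (cutoffM oO cchi sf)).
by apply: filterS chi1 => y /= ->; rewrite mul1r.
Qed.

Lemma cinf_continuous (f : Cinf M) : continuous f.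
Proof.
move=> p; have [c ac cp] := atlas_cover p.
have /asboolP/(_ c ac 0%N) sf := cinfP f.
have : {for p, continuous ((f \o chart_inv c) \o chart_map c)}.
  by apply: continuous_comp; [exact: chart_map_continuous | apply: sf; exists p].
apply: near_eq_continuous.
apply: (@near_open _ (chart_dom c)) => //; first exact: chart_dom_open.
by move=> y cy /=; rewrite chart_mapK.
Qed.

End Cutoff.

Lemma rV_continuous (R : realType) (T : topologicalType) n (h : T -> 'rV[R]_n) t :
  (forall j, {for t, continuous (fun s => h s 0 j)}) -> {for t, continuous h}.
Proof.
move=> ch; apply/(@cvgrPdist_lt _ _ _ (nbhs t) (nbhs_filter t)) => e e0.
have H : \forall s \near t, forall j, `|h t 0 j - h s 0 j| < e.
  apply: filter_forall => j.
  exact: (@cvgrPdist_lt _ _ _ (nbhs t) (nbhs_filter t) _ _).1 (ch j) e e0.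
by apply: filterS H => s Hs; apply: rV_norm_lt => // j; rewrite !mxE.
Qed.

Section EuclideanExtension.
Variables (R : realType) (n : nat).
Implicit Types (W : set 'rV[R]_n) (z : 'rV[R]_n).

(** Hadamard's lemma is stated for functions smooth on the whole space, while chart expressions are
    smooth on an open set only. *)
Lemma smooth_extension W (Theta : 'rV[R]_n -> R) z0 : open W -> W z0 -> smooth_on W Theta ->
  exists2 phi, smooth_on setT phi & \forall z \near z0, phi z = Theta z.
Proof.
move=> oW Wp sT.
have [r r0 Hr] : exists2 r : R, 0 < r & forall z, `|z - z0| < r -> W z.
  by apply: near_norm_ball; exact: open_nbhs_nbhs.
have [|b [sb b1 b0]] := @bump_rV R _ z0 (r / 2); first by rewrite divr_gt0.
pose phi z := b z * Theta z.
have sphi : smooth_on setT phi.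
  move=> k; apply: Ck_local => z _.
  have [Wz|nWz] := pselect (W z).
    by exists W => //; apply: CkM => //; exact: CkW (sb k).
  pose V := [set z : 'rV[R]_n | r / 2 < `|z - z0|].
  have oV : open V.
    apply: (@open_comp _ _ (fun z : 'rV[R]_n => `|z - z0|) [set t | r / 2 < t]).
      by move=> x _; exact: dist_continuous.
    exact: open_gt.
  exists V; first by rewrite /V /= ltNge; apply/negP => H; apply: nWz; apply: Hr; lra.
  apply: (@Ck_ext _ _ _ _ (fun=> 0)) => //; last exact: Ck_cst.
  by move=> x /ltW /b0 bx; rewrite /phi bx mul0r.
exists phi => //.
by apply: filterS b1 => z; rewrite /phi => ->; rewrite mul1r.
Qed.

(* Differentiating Hadamard's formula twice yields a symmetric expression. *)
Lemma Schwarz W (Theta : 'rV[R]_n -> R) z0 i j : open W -> W z0 -> smooth_on W Theta ->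
  'D_(delta_mx 0 i) (fun z => 'D_(delta_mx 0 j) Theta z) z0 =
  'D_(delta_mx 0 j) (fun z => 'D_(delta_mx 0 i) Theta z) z0.
Proof.
move=> oW Wz0 sT; have [phi sphi phiT] := smooth_extension oW Wz0 sT.
have [U [oU Uz0 Uphi]] := near_openE phiT.
have E a b : 'D_(delta_mx 0 a) (fun z => 'D_(delta_mx 0 b) Theta z) z0 =
    'D_(delta_mx 0 a) (fun z => 'D_(delta_mx 0 b) phi z) z0.
  apply: near_eq_derive; apply: (near_open oU Uz0) => z Uz.
  by apply: near_eq_derive; apply: (near_open oU Uz) => z' /Uphi.
pose G k := radial_mean z0 0 (fun z => 'D_(delta_mx 0 k) phi z).
have sG k l : Ck l setT (G k) by apply: Ck_radial_mean; exact: (sphi l.+1).2.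
have dG k z a : derivable (G k) z (delta_mx 0 a) by apply: diff_derivable; exact: (sG k 1%N).1.
have ddG k z a b : derivable (fun z => 'D_(delta_mx 0 a) (G k) z) z (delta_mx 0 b).
  by apply: diff_derivable; exact: ((sG k 2%N).2 a).1.
have dc k z a : derivable (fun z : 'rV[R]_n => z 0 k - z0 0 k) z (delta_mx 0 a).
  apply: derivableB; last exact: derivable_cst.
  by apply: diff_derivable; exact: differentiable_coord.
have Dc k z a : 'D_(delta_mx 0 a) (fun z : 'rV[R]_n => z 0 k - z0 0 k) z = (a == k)%:R.
  rewrite deriveB; last exact: derivable_cst.
    by rewrite derive_cst subr0 derive_coord.
  by apply: diff_derivable; exact: differentiable_coord.
have D1 a z : 'D_(delta_mx 0 a) phi z =
    G a z + \sum_k (z 0 k - z0 0 k) * 'D_(delta_mx 0 a) (G k) z.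
  have -> : phi = cst (phi z0) + (\sum_k (fun z => (z 0 k - z0 0 k) * G k z) : 'rV[R]_n -> R).
    by apply/funext => z'; rewrite [LHS](Hadamard z0 z' (sphi 1%N)) !fctE fct_sumE.
  have dk k : derivable (fun z => (z 0 k - z0 0 k) * G k z) z (delta_mx 0 a).
    by apply: derivableM.
  rewrite deriveD; [|exact: derivable_cst|exact: derivable_sum].
  rewrite derive_cst add0r derive_sum //.
  under eq_bigr => k _ do rewrite (@deriveM _ _ (fun z => z 0 k - z0 0 k) (G k)) // Dc.
  rewrite big_split /= addrC; congr (_ + _).
  rewrite (bigD1 a) //= eqxx big1 ?addr0 => [|k /negbTE ak]; first by rewrite [LHS]mulr1.
  by rewrite eq_sym ak [LHS]mulr0.
have D2 a b : 'D_(delta_mx 0 b) (fun z => 'D_(delta_mx 0 a) phi z) z0 =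
    'D_(delta_mx 0 b) (G a) z0 + 'D_(delta_mx 0 a) (G b) z0.
  have -> : (fun z => 'D_(delta_mx 0 a) phi z) = G a +
     (\sum_k (fun z => (z 0 k - z0 0 k) * 'D_(delta_mx 0 a) (G k) z) : 'rV[R]_n -> R).
    by apply/funext => z'; rewrite D1 !fctE fct_sumE.
  have dk k : derivable (fun z => (z 0 k - z0 0 k) * 'D_(delta_mx 0 a) (G k) z) z0 (delta_mx 0 b).
    by apply: derivableM.
  rewrite deriveD //; last exact: derivable_sum.
  rewrite derive_sum //; congr (_ + _).
  under eq_bigr => k _ do rewrite (@deriveM _ _ (fun z => z 0 k - z0 0 k)) // Dc.
  rewrite (bigD1 b) //= eqxx big1 ?addr0 => [|k /negbTE bk].
    by rewrite subrr scale0r add0r [LHS]mulr1.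
  by rewrite eq_sym bk subrr scale0r add0r [LHS]mulr0.
have e1 := E i j; have e2 := E j i; rewrite (D2 j i) addrC in e1; rewrite (D2 i j) in e2.
by apply: etrans e1 _; apply: esym.
Qed.
End EuclideanExtension.

(** * Derivations in coordinates *)

Section TangentTheory.
Variables (R : realType) (M : manifold R).
Implicit Types (f g : Cinf M) (p : M).

Lemma cinf_ext f g : (forall x, f x = g x) -> f = g.
Proof. by move=> fg; apply: val_inj; apply/funext. Qed.

Lemma cinf_sumE (I : Type) (r : seq I) (F : I -> Cinf M) x :
  (\sum_(i <- r) F i) x = \sum_(i <- r) F i x.
Proof. by elim: r => [|i r IH]; rewrite ?big_nil // !big_cons -IH. Qed.

Lemma tangent_ext p (v w : tangent p) : (forall f, v f = w f) -> v = w.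
Proof. by move=> vw; apply: val_inj; apply/funext. Qed.

Lemma tangentL p (v : tangent p) a f g : v (a *: f + g) = a * v f + v g.
Proof. by have /asboolP[H _] := tangentP v; exact: H. Qed.

Lemma tangentM p (v : tangent p) f g : v (f * g) = v f * g p + f p * v g.
Proof. by have /asboolP[_ H] := tangentP v; exact: H. Qed.

Lemma tangentD p (v : tangent p) f g : v (f + g) = v f + v g.
Proof. by rewrite -[f]scale1r tangentL mul1r scale1r. Qed.

Lemma tangent0 p (v : tangent p) : v 0 = 0.
Proof. by apply: (addrI (v 0)); rewrite -tangentD !addr0. Qed.

Lemma tangentZ p (v : tangent p) a f : v (a *: f) = a * v f.
Proof. by rewrite -[a *: f]addr0 tangentL tangent0 addr0. Qed.

Lemma tangentN p (v : tangent p) f : v (- f) = - v f.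
Proof. by rewrite -scaleN1r tangentZ mulN1r. Qed.

Lemma tangentB p (v : tangent p) f g : v (f - g) = v f - v g.
Proof. by rewrite tangentD tangentN. Qed.

Lemma tangent_cst p (v : tangent p) a : v (cinf_cst M a) = 0.
Proof.
have -> : cinf_cst M a = a *: cinf_cst M 1.
  by apply: cinf_ext => x; rewrite -[RHS]/(a * 1) mulr1.
rewrite tangentZ; have := tangentM v (cinf_cst M 1) (cinf_cst M 1).
have -> : cinf_cst M 1 * cinf_cst M 1 = cinf_cst M 1.
  by apply: cinf_ext => x; rewrite -[LHS]/(1 * 1) mulr1.
rewrite mulr1 mul1r => /eqP.
by rewrite -subr_eq subrr eq_sym => /eqP ->; rewrite mulr0.
Qed.

Lemma tangent_sum p (v : tangent p) (I : Type) (r : seq I) (F : I -> Cinf M) :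
  v (\sum_(i <- r) F i) = \sum_(i <- r) v (F i).
Proof.
by elim: r => [|i r IH]; rewrite ?big_nil ?tangent0 // !big_cons tangentD IH.
Qed.

Lemma tangent_sumE p (I : Type) (r : seq I) (F : I -> tangent p) f :
  (\sum_(i <- r) F i) f = \sum_(i <- r) F i f.
Proof. by elim: r => [|i r IH]; rewrite ?big_nil // !big_cons -IH. Qed.

(** For a cutoff [chi] equal to [1] near [p] and carried by the set where [f = g], the product
    [chi * (f - g)] is zero, and the Leibniz rule at [p] gives [v (f - g) = 0]. *)
Lemma tangent_local p (v : tangent p) f g :
  (\forall y \near p, f y = g y) -> v f = v g.
Proof.
move=> /near_openE[U [oU Up fg]].
have [chi [schi [C [cC CU chi0]]] chi1] := cutoff_exists oU Up.
have E : MkCinf schi * (f - g) = 0.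
  apply: cinf_ext => y; rewrite -[LHS]/(chi y * (f y - g y)) -[RHS]/(0 : R).
  have [/CU/fg ->|/chi0 ->] := pselect (C y); last by rewrite mul0r.
  by rewrite subrr mulr0.
have := tangentM v (MkCinf schi) (f - g); rewrite E tangent0.
rewrite -[(f - g) p]/(f p - g p) (fg p Up) subrr mulr0 add0r /=.
by rewrite (nbhs_singleton chi1) mul1r tangentB => /esym/eqP; rewrite subr_eq0 => /eqP.
Qed.

Section SmoothComposition.
Variables (N : nat) (y : 'I_N -> Cinf M) (p : M).
Local Notation ry := (fun q => \row_i y i q).

Lemma row_continuous : continuous (ry : M -> 'rV[R]_N).
Proof.
move=> q; apply: rV_continuous => j.
by under [X in {for q, continuous X}]eq_fun do rewrite mxE; exact: cinf_continuous.
Qed.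

Lemma smooth_comp_exists W Theta : open W -> W (ry p) -> smooth_on W Theta ->
  exists f : Cinf M, \forall q \near p, f q = Theta (ry q).
Proof.
move=> oW Wp sT; pose O := ry @^-1` W.
have oO : open O by apply: open_preimage_map => //; exact: row_continuous.
apply: (@smooth_in_extend _ _ O (Theta \o ry)) => //.
move=> c ac k; have oc : open (chart_map c @` (chart_dom c `&` O)) by exact: open_chart_image.
apply: (@Ck_comp _ _ _ _ W _ (fun x => \row_i y i (chart_inv c x))) => //.
  by move=> _ [z [cz Oz] <-]; rewrite chart_mapK.
move=> j; have /asboolP/(_ c ac k) sy := cinfP (y j).
apply: (@Ck_ext _ _ _ _ (y j \o chart_inv c)) => //.
  by move=> x _; rewrite mxE.
by apply: CkW sy => _ [z [cz _] <-]; exists z.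
Qed.

(** By Hadamard's lemma [f] is, near [p], a constant plus a sum of products [(y i - y i p) * g i].
    The Leibniz rule leaves [v (y i) * g i p], and [g i p] is a partial derivative of [Theta]. The
    [y i] may be redundant or constant, which is used for functions of two arrows. *)
Lemma tangent_chain (v : tangent p) W Theta f : open W -> W (ry p) ->
  smooth_on W Theta -> (\forall q \near p, f q = Theta (ry q)) ->
  v f = \sum_i v (y i) * 'D_(delta_mx 0 i) Theta (ry p).
Proof.
move=> oW Wp sT fT; set z0 := ry p.
have [phi sphi phiT] := smooth_extension oW Wp sT.
pose G i := radial_mean z0 0 (fun z => 'D_(delta_mx 0 i) phi z).
have sG i k : Ck k setT (G i).
  by apply: Ck_radial_mean; exact: (sphi k.+1).2.
have gH i : exists g : Cinf M, \forall q \near p, g q = G i (ry q).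
  exact: smooth_comp_exists openT I (sG i).
have [g Hg] := boolp.choice gH.
pose F := cinf_cst M (phi z0) + \sum_i (y i - cinf_cst M (z0 0 i)) * g i.
have fF : \forall q \near p, f q = F q.
  have Hg' : \forall q \near p, forall i, g i q = G i (ry q) by exact: filter_forall.
  have phiT' : \forall q \near p, phi (ry q) = Theta (ry q) by exact: (@row_continuous p _ phiT).
  near=> q; rewrite (near fT q) // -(near phiT' q) // (Hadamard z0 _ (sphi 1%N)).
  rewrite /F -[RHS]/(phi z0 + (\sum_i _ : Cinf M) q) cinf_sumE; congr (_ + _).
  apply: eq_bigr => i _; rewrite -[RHS]/((y i q - z0 0 i) * g i q) mxE.
  by congr (_ * _); rewrite (near Hg' q).
rewrite (tangent_local v fF) tangentD tangent_cst add0r tangent_sum.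
apply: eq_bigr => i _; rewrite tangentM tangentB tangent_cst subr0.
rewrite -[X in _ + X * _]/(y i p - z0 0 i) mxE subrr mul0r addr0; congr (_ * _).
rewrite (nbhs_singleton (Hg i)) /G radial_mean0.
exact: near_eq_derive.
Unshelve. all: by end_near. Qed.
End SmoothComposition.

End TangentTheory.

Section Coordinates.
Variables (R : realType) (M : manifold R).
Local Notation n := (mfd_dim M).
Variables (c : chart R M n) (p : M).
Hypotheses (ac : atlas c) (cp : chart_dom c p).

Lemma coord_fun_exists : exists x : 'I_n -> Cinf M,
  \forall y \near p, \row_i x i y = chart_map c y.
Proof.
have H j : exists g : Cinf M, \forall y \near p, g y = chart_map c y 0 j.
  apply: (@smooth_in_extend _ _ (chart_dom c)) => //; first exact: chart_dom_open.
  by move=> d ad; exact: (atlas_compatible ad ac).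
have [x Hx] := boolp.choice H; exists x.
have Hx' : \forall y \near p, forall j, x j y = chart_map c y 0 j by exact: filter_forall.
by apply: filterS Hx' => y xy; apply/rowP => j; rewrite mxE xy.
Qed.

Let cinf_coord_diff (f : Cinf M) y : chart_dom c y ->
  differentiable (f \o chart_inv c) (chart_map c y).
Proof.
by move=> cy; have /asboolP/(_ c ac 1%N)[df _] := cinfP f; apply: df; exists y.
Qed.

Lemma coord_vfield_exists i : exists X : vfield M, \forall y \near p,
  forall f, X y f = 'D_(delta_mx 0 i) (f \o chart_inv c) (chart_map c y).
Proof.
have odc := chart_dom_open c.
have [chi cchi chi1] := cutoff_exists odc cp.
pose D y (f : Cinf M) := chi y * 'D_(delta_mx 0 i) (f \o chart_inv c) (chart_map c y).
have derD y : D y \in derivation_at y.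
  have [_ [C [_ CO chi0]]] := cchi.
  have [/CO cy|/chi0 nC] := pselect (C y); last first.
    by apply/asboolP; split=> *; rewrite /D nC !mul0r ?mulr0 ?mul0r ?addr0.
  have dd (f : Cinf M) := diff_derivable (v := delta_mx 0 i) (cinf_coord_diff f cy).
  apply/asboolP; split => [a f g|f g]; rewrite /D.
    have -> : (a *: f + g) \o chart_inv c =
       a *: (f \o chart_inv c) + (g \o chart_inv c) by [].
    rewrite deriveD ?deriveZ //; last exact: derivableZ.
    by rewrite -[a *: _]/(a * _); ring.
  have -> : (f * g) \o chart_inv c =
       (f \o chart_inv c) * (g \o chart_inv c) by [].
  by rewrite deriveM // /= chart_mapK // -![_ *: _]/(_ * _); ring.
have smD : smooth_along (h := idmap M) (fun y => MkTangent (derD y)).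
  move=> f; apply: (cutoffM (chart_dom_open c) cchi) => d ad k.
  have /asboolP/(_ c ac k.+1)[_ /(_ i) Df] := cinfP f.
  apply: (@Ck_ext _ _ _ _ ((fun z => 'D_(delta_mx 0 i) (f \o chart_inv c) z)
      \o (chart_map c \o chart_inv d))) => //; first exact: open_chart_image.
  apply: (Ck_comp _ _ _ Df); first exact: open_chart_image.
    by move=> _ [z [dz cz] <-] /=; rewrite chart_mapK //; exists z.
  by move=> j; exact: (atlas_compatible ad ac).
exists (@MkSec _ _ (tangent_along (idmap M)) _ smD).
by apply: filterS chi1 => y /= chiy f; rewrite /D chiy mul1r.
Qed.

(** Every algebraic derivation is a combination of the coordinate ones, by [tangent_chain] applied
    to the chart expression of a function. *)
Lemma coord_frame_exists : exists (x : 'I_n -> Cinf M) (X : 'I_n -> vfield M),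
  (\forall y \near p, \row_i x i y = chart_map c y) /\
  \forall y \near p, (forall i j, X i y (x j) = (i == j)%:R) /\
    forall v : tangent y, v = \sum_j v (x j) *: (X j y : tangent y).
Proof.
have [x xE] := coord_fun_exists; have [X XE] := boolp.choice coord_vfield_exists.
exists x, X; split => //.
have [A [oA Ap Ax]] := near_openE xE.
have XE' : \forall y \near p, forall i f, X i y f = 'D_(delta_mx 0 i) (f \o chart_inv c) (chart_map c y).
  exact: filter_forall.
have cA : \forall y \near p, (A `&` chart_dom c) y.
  by apply: open_nbhs_nbhs; split; [apply: openI => //; exact: chart_dom_open|].
apply: filterS2 XE' cA => y Xy [Ay cy]; split => [i j|v].
  rewrite Xy; transitivity ('D_(delta_mx 0 i) (fun z : 'rV[R]_n => z 0 j) (chart_map c y)).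
    apply: near_eq_derive.
    apply: (@near_open _ (chart_map c @` (chart_dom c `&` A))).
    - exact: open_chart_image.
    - by exists y.
    - by move=> _ [z [cz /Ax xz] <-] /=; rewrite chart_mapK // -xz mxE.
  exact: derive_coord.
apply: tangent_ext => f; rewrite tangent_sumE.
have /asboolP/(_ c ac) sf := cinfP f.
have xcy : \row_i x i y = chart_map c y by exact: Ax.
rewrite (@tangent_chain _ _ _ x y v (chart_cod c) (f \o chart_inv c) f) //.
- by apply: eq_bigr => j _; rewrite -[RHS]/(v (x j) * X j y f) Xy xcy.
- exact: chart_cod_open.
- by rewrite xcy; exists y.
- apply: (@near_open _ (A `&` chart_dom c)) => //.
    by apply: openI => //; exact: chart_dom_open.
  by move=> z [/Ax xz cz] /=; rewrite xz chart_mapK.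
Qed.

End Coordinates.

(** In charts this is [derive_level_set]. It lets a vertical vector act on a function known only on
    a fibre. *)
Lemma tangent_fiber (R : realType) (N M : manifold R) (h : smap N M) (p : N)
    (v : tangent p) (f : Cinf N) :
  (forall w : tangent (h p), exists u : tangent p, push h u = w) ->
  push h v = 0 -> (\forall q \near p, h q = h p -> f q = 0) -> v f = 0.
Proof.
move=> sub pv f0.
have [c ac cp] := atlas_cover p; have [d ad dp] := atlas_cover (h p).
have [x [X [xE /nbhs_singleton [Xx Xv]]]] := coord_frame_exists ac cp.
have [y [Y [yE /nbhs_singleton [Yy Yv]]]] := coord_frame_exists ad dp.
have [ch _] := smapP h.
have [A [oA Ap Ax]] := near_openE xE.
have /ch yE' := yE.
have [B [oB Bp By]] := near_openE yE'.
have [F [oF Fp Ff]] := near_openE f0.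
have dN : \forall q \near p, chart_dom d (h q).
  by apply: (ch p); apply: open_nbhs_nbhs; split => //; exact: chart_dom_open.
have [E [oE Ep Ed]] := near_openE dN.
pose O := A `&` B `&` F `&` E.
have oO : open O by do 3 apply: openI => //.
pose z0 := chart_map c p; pose V := chart_map c @` (chart_dom c `&` O).
have oV : open V by exact: open_chart_image.
have Vz0 : V z0 by exists p.
pose tau (z : 'rV[R]_(mfd_dim N)) : 'rV[R]_(mfd_dim M) := \row_j y j (h (chart_inv c z)).
have stau j : smooth_on (chart_cod c) (fun z => tau z 0 j).
  move=> k; have /asboolP/(_ c ac k) := cinfP (pullback h (y j)).
  by apply: Ck_ext; [exact: chart_cod_open | move=> z _; rewrite mxE].
have xp : \row_i x i p = z0 by exact: Ax.
have chain (u : tangent p) (g : Cinf N) :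
    u g = \sum_i u (x i) * 'D_(delta_mx 0 i) (g \o chart_inv c) z0.
  have /asboolP/(_ c ac) sg := cinfP g.
  rewrite (@tangent_chain _ _ _ x p u (chart_cod c) (g \o chart_inv c) g) ?xp //.
  - exact: chart_cod_open.
  - by exists p.
  - apply: (@near_open _ (A `&` chart_dom c)) => //.
      by apply: openI => //; exact: chart_dom_open.
    by move=> z [/Ax xz cz] /=; rewrite xz chart_mapK.
have tauE j : (fun z => tau z 0 j) = pullback h (y j) \o chart_inv c.
  by apply/funext => z; rewrite mxE.
(* Preimages [u k] of the frame at [h p] provide the right inverse of the derivative of [h] that the
   level set argument requires. *)
have [u Hu] := boolp.choice (fun k => sub (Y k (h p))).
have cod0 : \forall z \near z0, chart_cod c z.
  by apply: open_nbhs_nbhs; split; [exact: chart_cod_open | exists p].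
rewrite chain; transitivity (\sum_i (\row_i v (x i)) 0 i * 'D_(delta_mx 0 i) (f \o chart_inv c) z0).
  by apply: eq_bigr => i _; rewrite mxE.
apply: (@derive_level_set _ _ _ tau _ _ _ (\matrix_(k, i) u k (x i))).
- move=> j i; apply: filterS cod0 => z cz; apply: diff_derivable.
  exact: (stau j 1%N).1.
- by move=> j i; apply: ((stau j 1%N).2 i); exists p.
- by have /asboolP/(_ c ac 1%N)[df _] := cinfP f; apply: df; exists p.
- move=> j; under eq_bigr do rewrite mxE tauE; rewrite -chain.
  by rewrite -[LHS]/(push h v (y j)) pv.
- move=> k j; under eq_bigr do rewrite mxE tauE; rewrite -chain.
  by rewrite -[LHS]/(push h (u k) (y j)) Hu Yy.
- apply: (near_open oV Vz0) => _ [q [cq [[[Aq Bq] Fq] Eq]] <-] tq /=.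
  rewrite chart_mapK //; apply: Ff => //.
  have : chart_map d (h q) = chart_map d (h p).
    rewrite -(By _ Bq) -(By _ Bp).
    by move: tq; rewrite /tau /z0 !chart_mapK.
  by move=> /(congr1 (chart_inv d)); rewrite !chart_mapK //; exact: Ed.
Qed.

(** * Invariant vector fields *)

Section TwoBlocks.
Variables (R : realType) (M : manifold R) (n m : nat).
Variables (x : 'I_n -> Cinf M) (y : 'I_m -> Cinf M).
Implicit Types (W : set 'rV[R]_(n + m)) (Psi : 'rV[R]_(n + m) -> R).

Local Notation rxy := (fun q => row_mx (\row_i x i q) (\row_j y j q)).

Let xy (i : 'I_(n + m)) : Cinf M :=
  match fintype.split i with inl j => x j | inr j => y j end.

Let rxyE q : \row_i xy i q = rxy q.
Proof.
apply/rowP => i; rewrite !mxE /xy; case: (fintype.splitP i) => j ij.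
  by rewrite mxE; congr (x _ q); apply: val_inj.
by rewrite mxE; congr (y _ q); apply: val_inj.
Qed.

Lemma smooth_comp2_exists W Psi p : open W -> W (rxy p) -> smooth_on W Psi ->
  exists f : Cinf M, \forall q \near p, f q = Psi (rxy q).
Proof.
move=> oW Wp sP; rewrite -rxyE in Wp.
have [f Hf] := smooth_comp_exists oW Wp sP; exists f.
by apply: filterS Hf => q; rewrite rxyE.
Qed.

Lemma tangent_chain2 W Psi p (v : tangent p) (f : Cinf M) : open W -> W (rxy p) ->
  smooth_on W Psi -> (\forall q \near p, f q = Psi (rxy q)) ->
  v f = \sum_i v (x i) * 'D_(delta_mx 0 (lshift m i)) Psi (rxy p)
      + \sum_j v (y j) * 'D_(delta_mx 0 (rshift n j)) Psi (rxy p).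
Proof.
move=> oW Wp sP fP; rewrite -rxyE in Wp.
rewrite (@tangent_chain _ _ _ xy p v W Psi f) //; last first.
  by apply: filterS fP => q ->; rewrite rxyE.
rewrite big_split_ord /= rxyE; congr (_ + _); apply: eq_bigr => j _; congr (_ * _).
  by rewrite /xy (unsplitK (inl j)).
by rewrite /xy (unsplitK (inr j)).
Qed.
End TwoBlocks.

(** * Multiplication in coordinates *)

Section Multiplication.
Variables (R : realType) (G : lie_groupoid R).
Local Notation GG := (arrows G).
Local Notation n := (mfd_dim GG).

Lemma row_mx_near (W : set 'rV[R]_(n + n)) (a b : 'rV[R]_n) :
  open W -> W (row_mx a b) ->
  exists2 d : R, 0 < d & forall a' b', `|a' - a| < d -> `|b' - b| < d -> W (row_mx a' b').
Proof.
move=> oW Wab; have [d d0 Hd] : exists2 d : R, 0 < d & forall z, `|z - row_mx a b| < d -> W z.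
  by apply: near_norm_ball; exact: open_nbhs_nbhs.
exists d => // a' b' aa' bb'; apply: Hd; apply: rV_norm_lt => // j.
rewrite -(splitK j) /=; case: (fintype.split j) => k /=.
  rewrite !mxE (unsplitK (inl k)); apply: le_lt_trans aa'.
  by rewrite (le_trans _ (rV_coord_le _ k)) // !mxE.
rewrite !mxE (unsplitK (inr k)); apply: le_lt_trans bb'.
by rewrite (le_trans _ (rV_coord_le _ k)) // !mxE.
Qed.

(** [Psi] lives on an open set of the ambient product, beyond the composable pairs, so it has
    separate partial derivatives in the two factors. The coordinates and neighbourhoods are chosen
    before [f]. *)
Lemma mul_coord (g0 h0 : GG) : src G g0 = tgt G h0 ->
  exists (x y : 'I_n -> Cinf GG) (A B : set GG) (W : set 'rV[R]_(n + n)),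
    [/\ open A /\ A g0, open B /\ B h0, open W,
        forall g h, A g -> B h -> W (row_mx (\row_i x i g) (\row_i y i h)) &
  forall f : Cinf GG, exists2 Psi : 'rV[R]_(n + n) -> R, smooth_on W Psi &
    forall g h, A g -> B h -> src G g = tgt G h ->
      f (gmul g h) = Psi (row_mx (\row_i x i g) (\row_i y i h))].
Proof.
move=> gh0.
have [a aa ag] := atlas_cover g0; have [b ab bh] := atlas_cover h0.
have [c ac cgh] := atlas_cover (gmul g0 h0).
have [W [m [oW Wgh sm mE]]] := mul_smooth gh0 aa ab ac ag bh cgh.
have [x xE] := coord_fun_exists aa ag; have [y yE] := coord_fun_exists ab bh.
(* On [W'] the extended product stays in the image of the chart [c], where [f \o chart_inv c] is
   smooth. *)
pose W' := [set z | W z /\ chart_cod c (m z)].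
have oW' : open W'.
  rewrite openE => z [Wz cz]; have cm : {for z, continuous m}.
    by apply: rV_continuous => j; exact: (sm j 0%N).
  have h1 : nbhs z W by exact: open_nbhs_nbhs.
  have h2 : nbhs z (m @^-1` chart_cod c).
    by apply: (cm (chart_cod c)); apply: open_nbhs_nbhs; split; first exact: chart_cod_open.
  exact: (filterI h1 h2).
have W'gh : W' (row_mx (chart_map a g0) (chart_map b h0)).
  split => //; have [cc <-] := mE g0 h0 gh0 ag bh Wgh.
  by exists (gmul g0 h0).
have [d d0 Hd] := row_mx_near oW' W'gh.
have nbd (e : chart R GG n) k0 (z : 'I_n -> Cinf GG) : chart_dom e k0 ->
    (\forall k \near k0, \row_i z i k = chart_map e k) ->
    \forall k \near k0, [/\ \row_i z i k = chart_map e k, chart_dom e k &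
      `|chart_map e k - chart_map e k0| < d].
  move=> ek zE; have H1 : \forall k \near k0, chart_dom e k.
    by apply: open_nbhs_nbhs; split => //; exact: chart_dom_open.
  have H2 : \forall k \near k0, `|chart_map e k - chart_map e k0| < d.
    have H3 : nbhs (chart_map e k0) [set z | `|z - chart_map e k0| < d].
      by apply/nbhs_ballP; exists d => // z'; rewrite -ball_normE /= distrC.
    exact: chart_map_continuous H3.
  near=> k; split; first exact: (near zE k).
    exact: (near H1 k).
  exact: (near H2 k).
have [A [oA Ag HA]] := near_openE (nbd a g0 x ag xE).
have [B [oB Bh HB]] := near_openE (nbd b h0 y bh yE).
exists x, y, A, B, W'; split => // [g h /HA[-> dg gd] /HB[-> dh hd]|f].
  exact: Hd.
exists ((f \o chart_inv c) \o m).
  move=> k; have /asboolP/(_ c ac k) sf := cinfP f.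
  apply: (Ck_comp oW' _ _ sf); first by move=> z [].
  by move=> j; apply: CkW (sm j k) => z [].
move=> g h /HA[-> dg gd] /HB[-> dh hd] ghE.
have [Wz _] := Hd _ _ gd hd.
by have [cc mgh] := mE g h ghE dg dh Wz; rewrite /= -mgh chart_mapK.
Unshelve. all: by end_near. Qed.
End Multiplication.

Section PullbackTheory.
Variables (R : realType) (M N : manifold R) (h : smap M N).

Lemma pullbackD (f g : Cinf N) : pullback h (f + g) = pullback h f + pullback h g.
Proof. exact: val_inj. Qed.
Lemma pullbackM (f g : Cinf N) : pullback h (f * g) = pullback h f * pullback h g.
Proof. exact: val_inj. Qed.
Lemma pullbackZ a (f : Cinf N) : pullback h (a *: f) = a *: pullback h f.
Proof. exact: val_inj. Qed.
End PullbackTheory.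

Lemma proj_quot_repr (K : pzRingType) (V : lmodType K) (P : set V) (q : quotmod P) :
  proj_quot P (repr q) = q.
Proof. by rewrite /proj_quot reprK. Qed.

Lemma proj_quot0 (K : pzRingType) (V : lmodType K) (P : set V) : proj_quot P 0 = 0.
Proof. by have := proj_quotZ P 0 0; rewrite !scale0r. Qed.

Section VerticalPart.
Variables (R : realType) (G : lie_groupoid R).
Local Notation M := (base G).
Local Notation GG := (arrows G).
Local Notation E := (lie_algebroid G).
Local Notation TM x := (range (push (units G) (x := x))).

Lemma unit_class_eq (x : M) (v w : tangent (units G x)) :
  proj_quot (TM x) v = proj_quot (TM x) w <-> exists u : tangent x, v - w = push (units G) u.
Proof.
split.
  move=> /eqP; rewrite proj_quot_eq => /asboolP H.
  have [||u _ <-] := H (TM x) _ _ (@subset_refl _ _); last by exists u.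
    by exists 0 => //; apply: tangent_ext.
  move=> a _ _ [u _ <-] [u' _ <-]; exists (a *: u + u') => //.
  by apply: tangent_ext.
case=> u vw; apply/eqP; rewrite proj_quot_eq vw; apply/asboolP => W _ _; apply.
by exists u.
Qed.

Fact vertical_part_subproof (x : M) (v : tangent (units G x)) :
  (fun f => v f - v (pullback (tgt G) (pullback (units G) f)))
    \in derivation_at (units G x).
Proof.
apply/asboolP; split=> [a f g|f g].
  by rewrite !pullbackD !pullbackZ !tangentL; ring.
by rewrite !pullbackM !tangentM /= tgt_unit; ring.
Qed.

(* The projection of [v] onto the kernel of [T tgt] along the units. *)
Definition vertical_part (x : M) (v : tangent (units G x)) : tangent (units G x) :=
  MkTangent (vertical_part_subproof v).

Lemma vertical_part_tgt (x : M) (v : tangent (units G x)) (phi : Cinf M) :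
  vertical_part v (pullback (tgt G) phi) = 0.
Proof.
rewrite /= (_ : pullback (units G) _ = phi) ?subrr //.
by apply: cinf_ext => y; rewrite /= tgt_unit.
Qed.

Lemma vertical_part_class (x : M) (v w : tangent (units G x)) :
  proj_quot (TM x) v = proj_quot (TM x) w -> vertical_part v = vertical_part w.
Proof.
move=> /unit_class_eq[u vw]; have -> : v = w + push (units G) u by rewrite -vw addrC subrK.
apply: tangent_ext => f; pose f' := pullback (tgt G) (pullback (units G) f).
transitivity (w f + u (pullback (units G) f) - (w f' + u (pullback (units G) f'))) => //.
rewrite -[RHS]/(w f - w f').
rewrite (_ : pullback (units G) f' = pullback (units G) f); first by ring.
by apply: cinf_ext => y /=; rewrite tgt_unit.
Qed.

Lemma proj_vertical_part (x : M) (v : tangent (units G x)) :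
  proj_quot (TM x) (vertical_part v) = proj_quot (TM x) v.
Proof.
apply/esym/unit_class_eq.
have D : (fun phi : Cinf M => v (pullback (tgt G) phi)) \in derivation_at x.
  apply/asboolP; split=> [a f g|f g]; first by rewrite pullbackD pullbackZ tangentL.
  by rewrite pullbackM tangentM /= tgt_unit.
exists (MkTangent D); apply: tangent_ext => f.
by rewrite -[LHS]/(v f - (v f - v _)) /= opprB addrC subrK.
Qed.

(** [T tgt] kills the vertical part, so [tangent_fiber] applies to [f - g]. *)
Lemma vertical_part_fiber (x : M) (v : tangent (units G x)) (f g : Cinf GG) :
  (\forall k \near units G x, tgt G k = x -> f k = g k) ->
  vertical_part v f = vertical_part v g.
Proof.
move=> fg; apply/eqP; rewrite -subr_eq0 -tangentB; apply/eqP.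
apply: (@tangent_fiber _ _ _ (tgt G)).
- exact: tgt_submersion.
- by apply: tangent_ext => phi; rewrite -[LHS]/(vertical_part v _) vertical_part_tgt.
- apply: filterS fg => k fgk; rewrite tgt_unit => /fgk fk.
  by rewrite -[LHS]/(f k - g k) fk subrr.
Qed.

(** By [vertical_part_class] the choice made by [repr] is immaterial, so a smooth local lift of [X]
    can replace it; hence [vrep_smooth]. *)
Definition vrep (X : sec E) (x : M) : tangent (units G x) := vertical_part (repr (X x)).

Lemma vrep_smooth (X : sec E) (f : Cinf GG) : (fun x => vrep X x f) \in @smooth_fun R M.
Proof.
apply: smooth_fun_local => x; have [V HV] := secP X x.
exists (act_along V f - act_along V (pullback (tgt G) (pullback (units G) f))).
  exact: cinfP.
apply: filterS HV => y Hy; rewrite /vrep (@vertical_part_class _ _ (V y)) //.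
by rewrite proj_quot_repr.
Qed.

End VerticalPart.

(** * Construction of left-invariant extensions *)

Section LeftExtension.
Variables (R : realType) (G : lie_groupoid R).
Local Notation M := (base G).
Local Notation GG := (arrows G).
Local Notation E := (lie_algebroid G).

Definition extends_left (g h : GG) (f f' : Cinf GG) :=
  \forall k \near h, tgt G k = src G g -> f' k = f (gmul g k).

Lemma extends_left_exists (g h : GG) (f : Cinf GG) :
  src G g = tgt G h -> exists f', extends_left g h f f'.
Proof.
move=> gh; have [x [y [A [B [W [[oA Ag] [oB Bh] oW HW HPsi]]]]]] := mul_coord gh.
have [Psi sPsi PsiE] := HPsi f.
(* Freezing the first block at the coordinates of [g] leaves a smooth function of [k]. *)
have [|f' Hf'] := @smooth_comp2_exists _ _ _ _ (fun i => cinf_cst GG (x i g)) y W Psi h oW _ sPsi.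
  exact: HW.
exists f'; apply: filterS2 Hf' (open_nbhs_nbhs (conj oB Bh)) => k -> Bk tk.
by rewrite PsiE.
Qed.

(** Continuity of left translation along a target fibre, tested on a cutoff carried by [U]: where a
    smooth extension of its translate is positive, the product lies in [U]. *)
Lemma mul_near (g h : GG) (U : set GG) : src G g = tgt G h -> open U -> U (gmul g h) ->
  \forall k \near h, tgt G k = src G g -> U (gmul g k).
Proof.
move=> gh oU Ugh; have [chi [schi [C [cC CU chi0]]] chi1] := cutoff_exists oU Ugh.
have [f' Hf'] := extends_left_exists (MkCinf schi) gh.
have f'1 : 0 < f' h by rewrite (nbhs_singleton Hf') //= (nbhs_singleton chi1).
have : \forall k \near h, 0 < f' k by exact: (@cinf_continuous _ _ f' h) _ (lt_nbhsr f'1).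
apply: filterS2 Hf' => k /= Ek fk tk; apply: CU; apply: contrapT => /chi0 chik.
by move: fk; rewrite Ek // chik ltxx.
Qed.

Variable X : sec E.

Lemma src_tgt_unit (g : GG) : src G g = tgt G (units G (src G g)).
Proof. by rewrite tgt_unit. Qed.

(** The derivative of [f] along X^L at [g]. The extension of [f] o L_g is picked arbitrarily, and
    [left_liftE] frees the value from this choice. *)
Definition left_lift (g : GG) (f : Cinf GG) : R :=
  vrep X (src G g) (projT1 (cid (extends_left_exists f (src_tgt_unit g)))).

Lemma left_liftE (g : GG) (f f' : Cinf GG) :
  extends_left g (units G (src G g)) f f' -> left_lift g f = vrep X (src G g) f'.
Proof.
rewrite /left_lift; case: cid => f'' /= H'' H'; apply: vertical_part_fiber.
by apply: filterS2 H'' H' => k + + tk => -> // ->.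
Qed.

Lemma left_lift_derivation (g : GG) : left_lift g \in derivation_at g.
Proof.
have ex f := extends_left_exists f (src_tgt_unit g).
apply/asboolP; split=> [a f1 f2|f1 f2];
  have [f1' H1] := ex f1; have [f2' H2] := ex f2;
  rewrite (left_liftE H1) (left_liftE H2).
  rewrite -tangentL; apply: left_liftE.
  apply: filterS2 H1 H2 => k K1 K2 tk.
  by rewrite -[LHS]/(a * f1' k + f2' k) K1 // K2.
have v (f f' : Cinf GG) : extends_left g (units G (src G g)) f f' -> f' (units G (src G g)) = f g.
  by move=> /nbhs_singleton ->; rewrite ?mul_unitr // tgt_unit.
rewrite -(v _ _ H1) -(v _ _ H2) -tangentM; apply: left_liftE.
apply: filterS2 H1 H2 => k K1 K2 tk.
by rewrite -[LHS]/(f1' k * f2' k) K1 // K2.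
Qed.

(** Near [g0] the chain rule gives a sum over [j] of [vrep X (src G g) (y j)] times a second-block
    derivative of [Psi] at the pair of [g] and its source unit; both factors are smooth in [g]. *)
Lemma left_lift_smooth (f : Cinf GG) : (fun g => left_lift g f) \in @smooth_fun R GG.
Proof.
apply: smooth_fun_local => g0.
have [x [y [A [B [W [[oA Ag] [oB Bh] oW HW HPsi]]]]]] := mul_coord (src_tgt_unit g0).
have [Psi sPsi PsiE] := HPsi f.
pose us : GG -> GG := fun g => units G (src G g).
have nB : \forall g \near g0, B (us g).
  have [cs _] := smapP (src G); have [cu _] := smapP (units G).
  have cus : {for g0, continuous us} by apply: continuous_comp; [exact: cs | exact: cu].
  exact: cus (open_nbhs_nbhs (conj oB Bh)).
have nA : \forall g \near g0, A g by exact: open_nbhs_nbhs.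
pose yu j := pullback (src G) (pullback (units G) (y j)).
have H j : exists D : Cinf GG, \forall g \near g0, D g =
    'D_(delta_mx 0 (rshift (mfd_dim GG) j)) Psi (row_mx (\row_i x i g) (\row_i yu i g)).
  apply: (@smooth_comp2_exists _ _ _ _ x yu W
    (fun z => 'D_(delta_mx 0 (rshift (mfd_dim GG) j)) Psi z) g0 oW).
    exact: HW.
  by move=> k; exact: (sPsi k.+1).2.
have [D HD] := boolp.choice H.
pose V j := pullback (src G) (MkCinf (vrep_smooth X (y j))).
exists (\sum_j V j * D j : Cinf GG); first exact: cinfP.
have HD' : \forall g \near g0, forall j, D j g = 'D_(delta_mx 0 (rshift (mfd_dim GG) j)) Psi
   (row_mx (\row_i x i g) (\row_i yu i g)) by exact: filter_forall.
near=> g; have Ag' : A g by exact: (near nA g).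
have Bg' : B (us g) by exact: (near nB g).
have [|f' Hf'] := @smooth_comp2_exists _ _ _ _ (fun i => cinf_cst GG (x i g)) y W Psi (us g) oW _ sPsi.
  exact: HW.
rewrite (@left_liftE g f f'); last first.
  apply: filterS2 Hf' (open_nbhs_nbhs (conj oB Bg')) => k -> Bk tk.
  by rewrite PsiE.
rewrite (tangent_chain2 (vrep X (src G g)) oW _ sPsi Hf'); last exact: HW.
rewrite big1 ?add0r => [|i _]; last by rewrite tangent_cst mul0r.
rewrite cinf_sumE; apply: eq_bigr => j _.
rewrite -[RHS]/(vrep X (src G g) (y j) * D j g); congr (_ * _).
by rewrite (near HD' g).
Unshelve. all: by end_near. Qed.

Fact left_vfield_subproof :
  smooth_along (h := idmap GG) (fun g => MkTangent (left_lift_derivation g)).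
Proof. exact: left_lift_smooth. Qed.

Definition left_vfield : vfield GG :=
  @MkSec R GG (tangent_along (idmap GG)) _ left_vfield_subproof.

Lemma left_vfield_invariant : left_invariant left_vfield.
Proof.
split=> [g|g h f f' gh ext].
  apply: tangent_ext => phi; rewrite -[LHS]/(left_lift g (pullback (tgt G) phi)).
  rewrite (@left_liftE _ _ (cinf_cst GG (phi (tgt G g)))) ?tangent_cst //.
  by apply: filterE => k tk /=; rewrite tgt_mul.
rewrite -[LHS]/(left_lift h f') -[RHS]/(left_lift (gmul g h) f).
(* [f''] extends [f'] o L_h and [f3] extends [f] o L_gh; near the unit, on its target fibre,
   associativity makes them agree. *)
have [f'' H''] := extends_left_exists f' (src_tgt_unit h).
rewrite (left_liftE H'') /left_lift; case: cid => f3 /= H3.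
move: f3 H3; rewrite /extends_left src_mul // => f3 H3.
apply: vertical_part_fiber.
(* [f'] matches [f] o L_g only near [h], so the products [gmul h k] must be kept in [U]. *)
have [U [oU Uh UE]] := near_openE ext.
have hu := src_tgt_unit h.
have Uhu : U (gmul h (units G (src G h))) by rewrite mul_unitr.
have HU := mul_near hu oU Uhu.
near=> k => tk; have k2 : src G h = tgt G k by [].
have tgk : src G g = tgt G (gmul h k) by rewrite tgt_mul.
rewrite (near H'' k) // (near H3 k) //.
rewrite UE; first by rewrite Defs.mulA.
  exact: (near HU k).
by rewrite tgk.
Unshelve. all: by end_near. Qed.

Lemma left_vfield_represents : represents left_vfield X.
Proof.
apply: sec_ext => x; rewrite -[RHS](proj_quot_repr (X x)) /=.
rewrite -[RHS]proj_vertical_part; congr (proj_quot _ _).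
apply: tangent_ext => f; rewrite -[LHS]/(left_lift (units G x) f).
rewrite (@left_liftE _ f f); first by rewrite src_unit.
by apply: filterE => k; rewrite src_unit => <-; rewrite mul_unitl.
Qed.

End LeftExtension.

(** * Inversion and right-invariant fields *)

Section GroupoidTheory.
Variables (R : realType) (G : lie_groupoid R).
Local Notation M := (base G).
Local Notation GG := (arrows G).
Local Notation E := (lie_algebroid G).
Local Notation TM x := (range (push (units G) (x := x))).
Implicit Types (g h k : GG) (x : M).

Lemma ginvK g : ginv G (ginv G g) = g.
Proof.
rewrite -[LHS]mul_unitr src_inv tgt_inv -mul_invl Defs.mulA ?mul_invl ?src_inv ?tgt_inv //.
by rewrite mul_unitl.
Qed.

Lemma ginv_uniq g k : src G k = tgt G g -> gmul k g = units G (src G g) -> k = ginv G g.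
Proof.
move=> kg kgE; rewrite -[LHS]mul_unitr kg -mul_invr Defs.mulA ?tgt_inv // kgE.
by rewrite -tgt_inv mul_unitl.
Qed.

Lemma ginvM g h : src G g = tgt G h ->
  ginv G (gmul g h) = gmul (ginv G h) (ginv G g).
Proof.
move=> gh; have hg : src G (ginv G h) = tgt G (ginv G g) by rewrite src_inv tgt_inv.
apply/esym/ginv_uniq; first by rewrite src_mul // tgt_mul // src_inv.
rewrite -Defs.mulA //; last by rewrite src_inv tgt_mul.
rewrite [gmul (ginv G g) _]Defs.mulA ?src_inv // mul_invl gh mul_unitl mul_invl.
by rewrite src_mul.
Qed.

Lemma ginv_unit x : ginv G (units G x) = units G x.
Proof.
apply/esym/ginv_uniq; first by rewrite src_unit tgt_unit.
by have := mul_unitr (units G x); rewrite !src_unit.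
Qed.

Lemma pullback_ginvK (f : Cinf GG) : pullback (ginv G) (pullback (ginv G) f) = f.
Proof. by apply: cinf_ext => g /=; rewrite ginvK. Qed.

Lemma vfield_ext (X Y : vfield GG) : (forall g f, X g f = Y g f) -> X = Y.
Proof. by move=> XY; apply: sec_ext => g; apply: tangent_ext => f; exact: XY. Qed.

Lemma left_invariant_unique (X Y : vfield GG) : left_invariant X -> left_invariant Y ->
  (forall x f, X (units G x) f = Y (units G x) f) -> X = Y.
Proof.
move=> [_ Xl] [_ Yl] XY; apply: vfield_ext => g f.
have [f' Hf'] := extends_left_exists f (src_tgt_unit g).
have := Yl _ _ _ _ (src_tgt_unit g) Hf'; rewrite mul_unitr => <-.
by have := Xl _ _ _ _ (src_tgt_unit g) Hf'; rewrite mul_unitr => <-.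
Qed.

Lemma represents_diff (X Y : vfield GG) (Z Z' : sec E) x :
  represents X Z -> represents Y Z' -> Z x = Z' x ->
  exists u : tangent x, forall f, X (units G x) f - Y (units G x) f = u (pullback (units G) f).
Proof.
move=> XZ YZ; rewrite -(congr1 (fun s : sec E => s x) XZ).
rewrite -(congr1 (fun s : sec E => s x) YZ) /= => /unit_class_eq[u uE]; exists u => f.
by have := congr1 (fun w : tangent (units G x) => w f) uE.
Qed.

Fact inv_push_subproof (X : vfield GG) g :
  (fun f => X (ginv G g) (pullback (ginv G) f)) \in derivation_at g.
Proof.
apply/asboolP; split=> [a f f'|f f'].
  by rewrite pullbackD pullbackZ tangentL.
by rewrite pullbackM tangentM /= !ginvK.
Qed.

Fact inv_push_smooth (X : vfield GG) :
  smooth_along (h := idmap GG) (fun g => MkTangent (inv_push_subproof X g)).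
Proof.
move=> f; exact: (cinfP (pullback (ginv G) (vact X (pullback (ginv G) f)))).
Qed.

(** The pushforward under the involution [ginv]. It exchanges left and right invariance, so the
    right-invariant theory follows from the left-invariant one. *)
Definition inv_push (X : vfield GG) : vfield GG :=
  @MkSec R GG (tangent_along (idmap GG)) _ (inv_push_smooth X).

Lemma inv_pushK X : inv_push (inv_push X) = X.
Proof. by apply: vfield_ext => g f /=; rewrite ginvK pullback_ginvK. Qed.

Lemma ginv_near h (P : GG -> Prop) : (\forall k \near h, P k) ->
  \forall k \near ginv G h, P (ginv G k).
Proof.
move=> HP; have [ci _] := smapP (ginv G).
by apply: (ci (ginv G h)); rewrite ginvK.
Qed.

Lemma inv_push_left X : left_invariant X -> right_invariant (inv_push X).
Proof.
move=> [Xt Xl]; split=> [g|g h f f' hg Hf'].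
  apply: tangent_ext => phi.
  rewrite -[RHS](congr1 (fun w : tangent _ => w phi) (Xt (ginv G g))) /=.
  by congr (tangent_fun _ _); apply: cinf_ext => k /=; rewrite src_inv.
rewrite /= ginvM //; apply: Xl; first by rewrite src_inv tgt_inv.
apply: filterS (ginv_near Hf') => k Hk; rewrite src_inv => tk /=.
by rewrite Hk ?src_inv // ginvM ?ginvK // src_inv.
Qed.

Lemma inv_push_right X : right_invariant X -> left_invariant (inv_push X).
Proof.
move=> [Xt Xl]; split=> [g|g h f f' gh Hf'].
  apply: tangent_ext => phi.
  rewrite -[RHS](congr1 (fun w : tangent _ => w phi) (Xt (ginv G g))) /=.
  by congr (tangent_fun _ _); apply: cinf_ext => k /=; rewrite tgt_inv.
rewrite /= ginvM //; apply: Xl; first by rewrite src_inv tgt_inv.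
apply: filterS (ginv_near Hf') => k Hk; rewrite tgt_inv => tk /=.
by rewrite Hk ?tgt_inv // ginvM ?ginvK // tgt_inv.
Qed.

Lemma right_invariant_unique (X Y : vfield GG) : right_invariant X -> right_invariant Y ->
  (forall x f, X (units G x) f = Y (units G x) f) -> X = Y.
Proof.
move=> rX rY XY; rewrite -(inv_pushK X) -(inv_pushK Y); congr inv_push.
apply: left_invariant_unique; [exact: inv_push_right|exact: inv_push_right|].
by move=> x f /=; rewrite ginv_unit XY.
Qed.

(* With [mul] written as [Psi] in coordinates, the four derivatives of
   [g (inv g)], [g 1], [1 (inv g)] and [1 1] along [v] share their partial terms. *)
Lemma tangent_ginv x (v : tangent (units G x)) (f : Cinf GG) : push (tgt G) v = 0 ->
  v f + v (pullback (ginv G) f) = v (pullback (src G) (pullback (units G) f)).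
Proof.
move=> v0; set p := units G x; have pp : src G p = tgt G p by rewrite src_unit tgt_unit.
have usp : units G (src G p) = p by rewrite src_unit.
have ip : ginv G p = p by exact: ginv_unit.
have [X [Y [A [B [W [[oA Ap] [oB Bp] oW HW HPsi]]]]]] := mul_coord pp.
have [Psi sPsi PsiE] := HPsi f.
pose Da i := 'D_(delta_mx 0 (lshift _ i)) Psi (row_mx (\row_i X i p) (\row_i Y i p)).
pose Db i := 'D_(delta_mx 0 (rshift _ i)) Psi (row_mx (\row_i X i p) (\row_i Y i p)).
have K (a b : GG -> GG) (xs ys : 'I_(mfd_dim GG) -> Cinf GG) (F : Cinf GG) :
    (forall i q, xs i q = X i (a q)) -> (forall i q, ys i q = Y i (b q)) ->
    a p = p -> b p = p -> {for p, continuous a} -> {for p, continuous b} ->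
    (forall q, src G (a q) = tgt G (b q) /\ F q = f (gmul (a q) (b q))) ->
    v F = \sum_i v (xs i) * Da i + \sum_i v (ys i) * Db i.
  move=> xsE ysE ap bp ca cb FE.
  have rxy q : row_mx (\row_i xs i q) (\row_i ys i q)
      = row_mx (\row_i X i (a q)) (\row_i Y i (b q)).
    by congr row_mx; apply/rowP => i; rewrite !mxE ?xsE ?ysE.
  have nA : \forall q \near p, A (a q) by apply: ca; rewrite ap; exact: open_nbhs_nbhs.
  have nB : \forall q \near p, B (b q) by apply: cb; rewrite bp; exact: open_nbhs_nbhs.
  have := @tangent_chain2 _ _ _ _ xs ys W Psi p v F oW.
  rewrite /= rxy ap bp; apply => //; first exact: HW.
  apply: filterS2 nA nB => q Aq Bq; have [ab ->] := FE q.
  by rewrite rxy PsiE.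
have [ci _] := smapP (ginv G); have [cs _] := smapP (src G); have [cu _] := smapP (units G).
have cus : {for p, continuous (fun q => units G (src G q))}.
  by apply: continuous_comp; [exact: cs | exact: cu].
have cid : {for p, continuous (@id GG)} by exact: cvg_id.
pose su (z : Cinf GG) := pullback (src G) (pullback (units G) z).
have e1 := K id (ginv G) X (fun j => pullback (ginv G) (Y j))
  (pullback (tgt G) (pullback (units G) f)).
have e2 := K id (fun q => units G (src G q)) X (fun j => su (Y j)) f.
have e3 := K (fun q => units G (src G q)) (ginv G) (fun j => su (X j))
  (fun j => pullback (ginv G) (Y j)) (pullback (ginv G) f).
have e4 := K (fun q => units G (src G q)) (fun q => units G (src G q))
  (fun j => su (X j)) (fun j => su (Y j)) (su f).
have {}e2 := e2 (fun _ _ => erefl) (fun _ _ => erefl) erefl usp cid cus.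
have {}e3 := e3 (fun _ _ => erefl) (fun _ _ => erefl) usp ip cus (ci p).
have {}e4 := e4 (fun _ _ => erefl) (fun _ _ => erefl) usp usp cus cus.
have {}e1 := e1 (fun _ _ => erefl) (fun _ _ => erefl) erefl ip cid (ci p).
rewrite e2; last by move=> q; rewrite tgt_unit mul_unitr.
rewrite e3; last by move=> q; rewrite src_unit tgt_inv; split=> //=; rewrite -tgt_inv mul_unitl.
rewrite -[pullback (src G) _]/(su f) e4; last first.
  move=> q; rewrite src_unit tgt_unit; split=> //=.
  by have := mul_unitr (units G (src G q)); rewrite src_unit => ->.
(* The four formulas combine as [e2 + e3 = e1 + e4], and the left side of [e1] is zero because [v]
   is vertical. *)
have : v (pullback (tgt G) (pullback (units G) f)) = 0.
  by rewrite -[LHS]/(push (tgt G) v (pullback (units G) f)) v0.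
rewrite e1 => [e|q]; last by rewrite tgt_inv; split => //=; rewrite mul_invr.
by lra.
Qed.

End GroupoidTheory.

Section VectorFieldAction.
Variables (R : realType) (M : manifold R).
Implicit Types (X Y : vfield M) (f g : Cinf M).

Lemma vactD X f g : vact X (f + g) = vact X f + vact X g.
Proof. by apply: cinf_ext => x; rewrite -[LHS]/(X x (f + g)) tangentD. Qed.
Lemma vactN X f : vact X (- f) = - vact X f.
Proof. by apply: cinf_ext => x; rewrite -[LHS]/(X x (- f)) tangentN. Qed.
Lemma vact0 X : vact X 0 = 0.
Proof. by apply: cinf_ext => x; rewrite -[LHS]/(X x 0) tangent0. Qed.
Lemma vactM X f g : vact X (f * g) = vact X f * g + f * vact X g.
Proof. by apply: cinf_ext => x; rewrite -[LHS]/(X x (f * g)) tangentM. Qed.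
Lemma vact_addl X Y f : vact (X + Y) f = vact X f + vact Y f.
Proof. exact: cinf_ext. Qed.
Lemma vact_scalel (phi : Cinf M) X f : vact (phi *: X) f = phi * vact X f.
Proof. exact: cinf_ext. Qed.
Lemma vact_oppl X f : vact (- X) f = - vact X f.
Proof.
have -> : - X = (-1) *: X by rewrite scaleN1r.
by rewrite vact_scalel mulN1r.
Qed.
Lemma vfieldNE X x f : (- X : vfield M) x f = - X x f.
Proof. by rewrite -[LHS]/(vact (- X) f x) vact_oppl. Qed.
End VectorFieldAction.

Section Extensions.
Variables (R : realType) (G : lie_groupoid R).
Local Notation M := (base G).
Local Notation GG := (arrows G).
Local Notation E := (lie_algebroid G).
Local Notation TM x := (range (push (units G) (x := x))).
Implicit Types (X Y Z : sec E) (V W : vfield GG).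

Lemma pullback_src_unit (phi : Cinf M) : pullback (units G) (pullback (src G) phi) = phi.
Proof. by apply: cinf_ext => x /=; rewrite src_unit. Qed.
Lemma pullback_tgt_unit (phi : Cinf M) : pullback (units G) (pullback (tgt G) phi) = phi.
Proof. by apply: cinf_ext => x /=; rewrite tgt_unit. Qed.

Lemma left_invariant_tgt V (phi : Cinf M) g : left_invariant V -> V g (pullback (tgt G) phi) = 0.
Proof. by move=> [Vt _]; have := congr1 (fun w : tangent _ => w phi) (Vt g). Qed.
Lemma right_invariant_src V (phi : Cinf M) g : right_invariant V -> V g (pullback (src G) phi) = 0.
Proof. by move=> [Vt _]; have := congr1 (fun w : tangent _ => w phi) (Vt g). Qed.

(** At a unit the two fields differ by the image of some [u] tangent to the base. Both kill
    functions pulled back by [tgt], which forces [u = 0]; invariance then propagates the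
    equality. *)
Lemma left_ext_unique X V W : left_invariant V -> left_invariant W ->
  represents V X -> represents W X -> V = W.
Proof.
move=> lV lW rV rW; apply: left_invariant_unique => // x f.
have [u Hu] := represents_diff rV rW (erefl (X x)); apply/eqP; rewrite -subr_eq0 Hu.
have := Hu (pullback (tgt G) (pullback (units G) f)).
by rewrite !left_invariant_tgt // subrr pullback_tgt_unit => <-.
Qed.

Lemma right_ext_unique X V W : right_invariant V -> right_invariant W ->
  represents V X -> represents W X -> V = W.
Proof.
move=> lV lW rV rW; apply: right_invariant_unique => // x f.
have [u Hu] := represents_diff rV rW (erefl (X x)); apply/eqP; rewrite -subr_eq0 Hu.
have := Hu (pullback (src G) (pullback (units G) f)).
by rewrite !right_invariant_src // subrr pullback_src_unit => <-.
Qed.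

Lemma left_extP X : left_invariant (left_ext X) /\ represents (left_ext X) X.
Proof.
apply: (@xgetPex _ 0 [set V | left_invariant V /\ represents V X]).
by exists (left_vfield X); split; [exact: left_vfield_invariant|exact: left_vfield_represents].
Qed.

Lemma left_invariantN V : left_invariant V -> left_invariant (- V).
Proof.
move=> [Vt Vl]; have E g f : (- V : vfield GG) g f = - V g f.
  by rewrite -[LHS]/(vact (- V) f g) vact_oppl.
split=> [g|g h f f' gh ext]; last by rewrite !E (Vl _ _ _ _ gh ext).
by apply: tangent_ext => phi; rewrite -[LHS]/((- V : vfield GG) g _) E left_invariant_tgt ?oppr0.
Qed.

Lemma inv_pushN V : inv_push (- V) = - inv_push V.
Proof.
apply: vfield_ext => g f; rewrite -[RHS]/(vact (- inv_push V) f g) vact_oppl.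
by rewrite -[LHS]/(vact (- V) (pullback (ginv G) f) (ginv G g)) vact_oppl.
Qed.

(** By [tangent_ginv], the sum of a vertical vector and its image under inversion is tangent to the
    units. *)
Lemma right_field_represents X : represents (- inv_push (left_ext X)) X.
Proof.
have [lX rX] := left_extP X.
apply: sec_ext => x; rewrite -[RHS](congr1 (fun s : sec E => s x) rX) /=.
apply/unit_class_eq.
have D : (fun phi : Cinf M => - left_ext X (units G x) (pullback (src G) phi)) \in derivation_at x.
  apply/asboolP; split=> [a f g|f g]; first by rewrite pullbackD pullbackZ tangentL; ring.
  by rewrite pullbackM tangentM /= src_unit; ring.
exists (MkTangent D); apply: tangent_ext => f.
transitivity (- left_ext X (units G x) (pullback (ginv G) f) - left_ext X (units G x) f).
  transitivity ((- inv_push (left_ext X) : vfield GG) (units G x) f - left_ext X (units G x) f) => //.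
  by rewrite vfieldNE /= ginv_unit.
rewrite -[RHS]/(- left_ext X (units G x) (pullback (src G) (pullback (units G) f))).
rewrite -tangent_ginv; first by rewrite opprD addrC.
exact: lX.1.
Qed.

Lemma right_invariant_inv_left X : right_invariant (- inv_push (left_ext X)).
Proof. by rewrite -inv_pushN; apply/inv_push_left/left_invariantN; case: (left_extP X). Qed.

Lemma right_extP X : right_invariant (right_ext X) /\ represents (right_ext X) X.
Proof.
apply: (@xgetPex _ 0 [set V | right_invariant V /\ represents V X]).
exists (- inv_push (left_ext X)); split; last exact: right_field_represents.
exact: right_invariant_inv_left.
Qed.

Lemma right_extE X : right_ext X = - inv_push (left_ext X).
Proof.
have [rX repX] := right_extP X; apply: right_ext_unique repX _ => //.
  exact: right_invariant_inv_left.
exact: right_field_represents.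
Qed.

Lemma vact_left_ginv X (f : Cinf GG) :
  vact (left_ext X) (pullback (ginv G) f) = - pullback (ginv G) (vact (right_ext X) f).
Proof.
apply: cinf_ext => g; rewrite right_extE vact_oppl.
rewrite -[RHS]/(- - left_ext X (ginv G (ginv G g)) (pullback (ginv G) f)).
by rewrite ginvK opprK.
Qed.

Lemma vact_right_ginv X (f : Cinf GG) :
  vact (right_ext X) (pullback (ginv G) f) = - pullback (ginv G) (vact (left_ext X) f).
Proof.
rewrite -[in RHS](pullback_ginvK f) vact_left_ginv.
apply: cinf_ext => g; rewrite -[RHS]/(- - vact (right_ext X) _ (ginv G (ginv G g))).
by rewrite ginvK opprK.
Qed.

Lemma left_extD X Y : left_ext (X + Y) = left_ext X + left_ext Y.
Proof.
have [lX rX] := left_extP X; have [lY rY] := left_extP Y.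
have [lXY rXY] := left_extP (X + Y).
apply: left_ext_unique rXY _ => //.
  split=> [g|g h f f' gh ext].
    apply: tangent_ext => phi.
    rewrite -[LHS]/(left_ext X g _ + left_ext Y g _) !left_invariant_tgt //.
    by rewrite addr0.
  rewrite -[LHS]/(left_ext X h f' + left_ext Y h f') (lX.2 _ _ _ _ gh ext).
  by rewrite (lY.2 _ _ _ _ gh ext).
apply: sec_ext => x; rewrite -[RHS]/((X x) + (Y x)).
rewrite -(congr1 (fun s : sec E => s x) rX) -(congr1 (fun s : sec E => s x) rY) /=.
by rewrite -proj_quotD.
Qed.

(** The coefficient is pulled back by [src], which left translations preserve. *)
Lemma left_extZ (phi : Cinf M) X : left_ext (phi *: X) = pullback (src G) phi *: left_ext X.
Proof.
have [lX rX] := left_extP X; have [lXY rXY] := left_extP (phi *: X).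
apply: left_ext_unique rXY _ => //.
  split=> [g|g h f f' gh ext].
    apply: tangent_ext => psi.
    by rewrite -[LHS]/(phi (src G g) * left_ext X g _) left_invariant_tgt // mulr0.
  rewrite -[LHS]/(phi (src G h) * left_ext X h f') (lX.2 _ _ _ _ gh ext).
  by rewrite -[RHS]/(phi (src G (gmul g h)) * _) src_mul.
apply: sec_ext => x; rewrite -[RHS]/(phi x *: X x).
rewrite -(congr1 (fun s : sec E => s x) rX) /= -proj_quotZ; congr (proj_quot _ _).
by apply: tangent_ext => f; rewrite -[LHS]/(phi (src G (units G x)) * _) src_unit.
Qed.

Lemma right_extD X Y : right_ext (X + Y) = right_ext X + right_ext Y.
Proof.
apply: vfield_ext => g f; rewrite !right_extE left_extD.
rewrite -[LHS]/(vact (- inv_push _) f g) vact_oppl.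
rewrite -[RHS]/(vact (- inv_push _) f g + vact (- inv_push _) f g) !vact_oppl.
by rewrite -[LHS]/(- (inv_push (left_ext X) g f + inv_push (left_ext Y) g f)) opprD.
Qed.

Lemma right_extZ (phi : Cinf M) X : right_ext (phi *: X) = pullback (tgt G) phi *: right_ext X.
Proof.
apply: vfield_ext => g f; rewrite !right_extE left_extZ.
rewrite -[LHS]/(vact (- inv_push _) f g) vact_oppl.
rewrite -[RHS]/(phi (tgt G g) * vact (- inv_push _) f g) vact_oppl.
rewrite -[LHS]/(- (phi (src G (ginv G g)) * inv_push (left_ext X) g f)) src_inv.
by rewrite -[RHS]/(phi (tgt G g) * - inv_push (left_ext X) g f) mulrN.
Qed.

Lemma left_fiber_eq V x (f f' : Cinf GG) : left_invariant V ->
  (\forall k \near units G x, tgt G k = x -> f' k = f k) -> V (units G x) f' = V (units G x) f.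
Proof.
move=> [_ Vl] ff'.
have := @Vl (units G x) (units G x) f f'; rewrite src_unit tgt_unit => /(_ erefl).
have e := mul_unitl (units G x); rewrite tgt_unit in e; rewrite e; apply.
by apply: filterS ff' => k ff' tk; rewrite ff' // -tk mul_unitl.
Qed.

Lemma right_fiber_eq V x (f f' : Cinf GG) : right_invariant V ->
  (\forall k \near units G x, src G k = x -> f' k = f k) -> V (units G x) f' = V (units G x) f.
Proof.
move=> [_ Vl] ff'.
have := @Vl (units G x) (units G x) f f'; rewrite src_unit tgt_unit => /(_ erefl).
have e := mul_unitl (units G x); rewrite tgt_unit in e; rewrite e; apply.
by apply: filterS ff' => k ff' tk; rewrite ff' // -tk mul_unitr.
Qed.

(* Both sides are the mixed second derivative of [f (k h)] in [k] and [h]. *)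
Lemma left_right_commute V W x (f : Cinf GG) : left_invariant V -> right_invariant W ->
  V (units G x) (vact W f) = W (units G x) (vact V f).
Proof.
move=> lV rW; set p := units G x.
have pp : src G p = tgt G p by rewrite src_unit tgt_unit.
have [X [Y [A [B [U [[oA Ap] [oB Bp] oU HU HPsi]]]]]] := mul_coord pp.
have [Psi sPsi PsiE] := HPsi f.
pose Da i := fun z => 'D_(delta_mx 0 (lshift _ i)) Psi z.
pose Db i := fun z => 'D_(delta_mx 0 (rshift _ i)) Psi z.
have sDa i : smooth_on U (Da i) by move=> k; exact: (sPsi k.+1).2.
have sDb i : smooth_on U (Db i) by move=> k; exact: (sPsi k.+1).2.
pose cX i := cinf_cst GG (X i p); pose cY i := cinf_cst GG (Y i p).
have Up : U (row_mx (\row_i X i p) (\row_i Y i p)) by exact: HU.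
have HA i : exists D : Cinf GG, \forall h \near p, D h = Da i (row_mx (\row_i cX i h) (\row_i Y i h)).
  exact: (@smooth_comp2_exists _ _ _ _ cX Y U (Da i) p oU Up (sDa i)).
have HB i : exists D : Cinf GG, \forall h \near p, D h = Db i (row_mx (\row_i X i h) (\row_i cY i h)).
  exact: (@smooth_comp2_exists _ _ _ _ X cY U (Db i) p oU Up (sDb i)).
have [dA dAE] := boolp.choice HA; have [dB dBE] := boolp.choice HB.
have nA : \forall h \near p, A h by exact: open_nbhs_nbhs.
have nB : \forall h \near p, B h by exact: open_nbhs_nbhs.
(* [V] differentiates along the fibre [tgt = x], so a formula for [W f] on that fibre suffices;
   there [h] is the right translate of the unit [p] by [h]. *)
have WE : \forall h \near p, tgt G h = x ->
    vact W f h = (\sum_i cinf_cst GG (W p (X i)) * dA i : Cinf GG) h.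
  have dAE' : \forall h \near p, forall i, dA i h = Da i (row_mx (\row_i cX i h) (\row_i Y i h)).
    exact: filter_forall.
  near=> h => th; have Bh : B h by exact: (near nB h).
  have [f' Hf'] := @smooth_comp2_exists _ _ _ _ X (fun i => cinf_cst GG (Y i h)) U Psi p oU
    (HU _ _ Ap Bh) sPsi.
  have := rW.2 h p f f'; rewrite {1}/p src_unit th => /(_ erefl) Wl.
  have {}Wl : W p f' = W h f.
    rewrite Wl; first by rewrite /p -th mul_unitl.
    by apply: filterS2 nA Hf' => k Ak -> sk; rewrite PsiE // sk th.
  rewrite -[LHS]/(W h f) -Wl (@tangent_chain2 _ _ _ _ X (fun i => cinf_cst GG (Y i h)) U Psi p (W p) f' oU (HU _ _ Ap Bh) sPsi Hf').
  rewrite [X in _ + X]big1 ?addr0 => [|j _]; last by rewrite tangent_cst mul0r.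
  rewrite cinf_sumE; apply: eq_bigr => i _.
  by rewrite -[RHS]/(W p (X i) * dA i h) (near dAE' h).
have VE : \forall h \near p, src G h = x ->
    vact V f h = (\sum_i cinf_cst GG (V p (Y i)) * dB i : Cinf GG) h.
  have dBE' : \forall h \near p, forall i, dB i h = Db i (row_mx (\row_i X i h) (\row_i cY i h)).
    exact: filter_forall.
  near=> h => sh; have Ah : A h by exact: (near nA h).
  have [f' Hf'] := @smooth_comp2_exists _ _ _ _ (fun i => cinf_cst GG (X i h)) Y U Psi p oU
    (HU _ _ Ah Bp) sPsi.
  have := lV.2 h p f f'; rewrite {1}/p tgt_unit sh => /(_ erefl) Vl.
  have {}Vl : V p f' = V h f.
    rewrite Vl; first by rewrite /p -sh mul_unitr.
    by apply: filterS2 nB Hf' => k Bk -> tk; rewrite PsiE // tk sh.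
  rewrite -[LHS]/(V h f) -Vl (@tangent_chain2 _ _ _ _ (fun i => cinf_cst GG (X i h)) Y U Psi p (V p) f' oU (HU _ _ Ah Bp) sPsi Hf').
  rewrite [X in X + _]big1 ?add0r => [|j _]; last by rewrite tangent_cst mul0r.
  rewrite cinf_sumE; apply: eq_bigr => i _.
  by rewrite -[RHS]/(V p (Y i) * dB i h) (near dBE' h).
rewrite (left_fiber_eq lV WE) (right_fiber_eq rW VE) !tangent_sum.
have eX : \row_i cX i p = \row_i X i p by apply/rowP => k; rewrite !mxE.
have eY : \row_i cY i p = \row_i Y i p by apply/rowP => k; rewrite !mxE.
have VdA i : V p (dA i) = \sum_j V p (Y j) * 'D_(delta_mx 0 (rshift _ j)) (Da i)
    (row_mx (\row_i X i p) (\row_i Y i p)).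
  rewrite -eX (@tangent_chain2 _ _ _ _ cX Y U (Da i) p (V p) (dA i) oU Up (sDa i) (dAE i)).
  rewrite [X in X + _]big1 => [|j _]; last by rewrite tangent_cst mul0r.
  exact: add0r.
have WdB j : W p (dB j) = \sum_i W p (X i) * 'D_(delta_mx 0 (lshift _ i)) (Db j)
    (row_mx (\row_i X i p) (\row_i Y i p)).
  rewrite -eY (@tangent_chain2 _ _ _ _ X cY U (Db j) p (W p) (dB j) oU Up (sDb j) (dBE j)).
  rewrite [X in _ + X]big1 => [|i _]; last by rewrite tangent_cst mul0r.
  exact: addr0.
have K (a b : 'I_(mfd_dim GG) -> R) c d : (forall i j, c i j = d i j) ->
    \sum_i a i * (\sum_j b j * c i j) = \sum_j b j * (\sum_i a i * d i j).
  move=> cd; under eq_bigr => i _ do rewrite mulr_sumr.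
  rewrite exchange_big; apply: eq_bigr => j _; rewrite mulr_sumr.
  by apply: eq_bigr => i _; rewrite cd mulrCA.
under eq_bigr => i _ do rewrite tangentM tangent_cst mul0r add0r VdA.
under [RHS]eq_bigr => j _ do rewrite tangentM tangent_cst mul0r add0r WdB.
apply: (K (fun i => W p (X i)) (fun j => V p (Y j))) => i j.
exact: (Schwarz (rshift _ j) (lshift _ i) oU Up sPsi).
Unshelve. all: by end_near. Qed.

End Extensions.

(** * The second and third derivatives of a contrast function *)

Section ExtensionsAtUnits.
Variables (R : realType) (G : lie_groupoid R).
Local Notation M := (base G).
Local Notation GG := (arrows G).
Local Notation E := (lie_algebroid G).
Local Notation TM x := (range (push (units G) (x := x))).
Implicit Types (X Y Z : sec E) (V W : vfield GG) (x : M).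

(** A left-invariant field kills pullbacks by [tgt], so only the source part of the anchor
    survives. *)
Lemma anchorE X (phi : Cinf M) x :
  vact (anchor X) phi x = left_ext X (units G x) (pullback (src G) phi).
Proof.
have [lX rX] := left_extP X.
rewrite -[LHS]/(repr (X x) (pullback (src G) phi) - repr (X x) (pullback (tgt G) phi)).
have : proj_quot (TM x) (left_ext X (units G x)) = proj_quot (TM x) (repr (X x)).
  by rewrite proj_quot_repr -[RHS](congr1 (fun s : sec E => s x) rX).
move=> /unit_class_eq[u uE].
have D f : left_ext X (units G x) f - repr (X x) f = u (pullback (units G) f).
  by have := congr1 (fun w : tangent (units G x) => w f) uE.
have := D (pullback (src G) phi); have := D (pullback (tgt G) phi).
rewrite pullback_src_unit pullback_tgt_unit (left_invariant_tgt _ _ lX) => e1 e2; lra.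
Qed.

Lemma left_right_units X (f : Cinf GG) x :
  left_ext X (units G x) f - right_ext X (units G x) f =
  vact (anchor X) (pullback (units G) f) x.
Proof.
have [lX rX] := left_extP X; have [lX' rX'] := right_extP X.
have [u Hu] := represents_diff rX rX' (erefl (X x)).
rewrite anchorE Hu; have := Hu (pullback (src G) (pullback (units G) f)).
by rewrite pullback_src_unit (right_invariant_src _ _ lX') subr0 => ->.
Qed.

Lemma left_invariant_fiber0 V (f : Cinf GG) (g : GG) : left_invariant V ->
  (forall k, tgt G k = tgt G g -> f k = 0) -> V g f = 0.
Proof.
move=> lV f0; apply: (@tangent_fiber _ _ _ (tgt G)).
- exact: tgt_submersion.
- exact: lV.1.
- exact: filterE.
Qed.

Lemma left_ext_zero X (g : GG) (f : Cinf GG) : X (src G g) = 0 -> left_ext X g f = 0.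
Proof.
move=> X0; have [lX rX] := left_extP X; set x := src G g in X0 *.
have [f' Hf'] := extends_left_exists f (src_tgt_unit g).
have := lX.2 _ _ _ _ (src_tgt_unit g) Hf'; rewrite mul_unitr => <-.
have r0 : represents (0 : vfield GG) (0 : sec E).
  by apply: sec_ext => y; exact: proj_quot0.
have [u Hu] := represents_diff rX r0 X0.
have H0 f0 : left_ext X (units G x) f0 = u (pullback (units G) f0) by rewrite -Hu subr0.
rewrite H0; have := H0 (pullback (tgt G) (pullback (units G) f')).
by rewrite left_invariant_tgt // pullback_tgt_unit => <-.
Qed.

Lemma right_ext_zero X (g : GG) (f : Cinf GG) : X (tgt G g) = 0 -> right_ext X g f = 0.
Proof.
move=> X0; rewrite right_extE vfieldNE /= left_ext_zero ?oppr0 //.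
by rewrite src_inv.
Qed.

End ExtensionsAtUnits.

Section ContrastHessian.
Variables (R : realType) (G : lie_groupoid R) (F : Cinf (arrows G)).
Hypothesis cF : contrast_function F.
Local Notation M := (base G).
Local Notation GG := (arrows G).
Local Notation E := (lie_algebroid G).
Implicit Types (X Y Z : sec E) (V W : vfield GG) (x : M).

(** The commutator is a tangent vector at the unit, where [dF] vanishes. *)
Lemma hessian_sym V W x : V (units G x) (vact W F) = W (units G x) (vact V F).
Proof.
have := (cF x).2 (commutator_pt V W (units G x)).
by move=> /eqP; rewrite subr_eq0 => /eqP.
Qed.

(* [dF = 0] along the units, so [V W F] there only involves the classes of [V] and [W]
   modulo vectors tangent to the units. *)
Lemma hessian_eq V V' W W' X X' Y Y' x :
  represents V X -> represents V' X' -> represents W Y -> represents W' Y' ->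
  X x = X' x -> Y x = Y' x ->
  V (units G x) (vact W F) = V' (units G x) (vact W' F).
Proof.
have L (U U' T : vfield GG) (A B : sec E) : represents U A -> represents U' B ->
    A x = B x -> U (units G x) (vact T F) = U' (units G x) (vact T F).
  move=> rU rU' AB; have [u Hu] := represents_diff rU rU' AB.
  apply/eqP; rewrite -subr_eq0 Hu.
  rewrite (_ : pullback _ _ = 0) ?tangent0 //.
  by apply: cinf_ext => y; exact: ((cF y).2 (T (units G y))).
move=> rV rV' rW rW' XX' YY'.
by rewrite (L _ _ _ _ _ rV rV' XX') hessian_sym (L _ _ _ _ _ rW rW' YY') hessian_sym.
Qed.

Lemma contrast_form_class V W X Y x : represents V X -> represents W Y ->
  contrast_form F X Y x = V (units G x) (vact W F).
Proof.
move=> rV rW; have [_ rX] := left_extP X; have [_ rY] := left_extP Y.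
exact: (hessian_eq rX rV rY rW).
Qed.

Lemma contrast_form_pt X X' Y Y' x : X x = X' x -> Y x = Y' x ->
  contrast_form F X Y x = contrast_form F X' Y' x.
Proof.
by apply: hessian_eq; [case: (left_extP X)|case: (left_extP X')|case: (left_extP Y)|
  case: (left_extP Y')].
Qed.

Lemma contrast_form_sym X Y : contrast_form F X Y = contrast_form F Y X.
Proof. by apply: cinf_ext => x; exact: hessian_sym. Qed.

Lemma contrast_formDl X X' Y :
  contrast_form F (X + X') Y = contrast_form F X Y + contrast_form F X' Y.
Proof. by apply: cinf_ext => x; rewrite /contrast_form left_extD. Qed.

Lemma contrast_formZl (phi : Cinf M) X Y :
  contrast_form F (phi *: X) Y = phi * contrast_form F X Y.
Proof.
apply: cinf_ext => x; rewrite /contrast_form left_extZ.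
by rewrite -[LHS]/(phi (src G (units G x)) * _) src_unit.
Qed.

(** Inversion carries left fields to minus right fields; the two signs cancel, and any
    representatives compute the form. *)
Lemma contrast_form_dual X Y : contrast_form (dual_contrast F) X Y = contrast_form F X Y.
Proof.
apply: cinf_ext => x; have [_ rX] := right_extP X; have [_ rY] := right_extP Y.
rewrite (contrast_form_class x rX rY).
rewrite -[LHS]/(vact (left_ext X) (vact (left_ext Y) (pullback (ginv G) F)) (units G x)).
rewrite vact_left_ginv vactN vact_left_ginv opprK.
by rewrite -[LHS]/(vact _ _ (ginv G (units G x))) ginv_unit.
Qed.

Lemma dual_contrastK : dual_contrast (dual_contrast F) = F.
Proof. exact: pullback_ginvK. Qed.

Lemma dual_contrast_function : contrast_function (dual_contrast F).
Proof.
move=> x; split; first by rewrite /= ginv_unit; exact: (cF x).1.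
move=> v; have D : (fun f => v (pullback (ginv G) f)) \in derivation_at (units G x).
  apply/asboolP; split=> [a f g|f g]; first by rewrite pullbackD pullbackZ tangentL.
  by rewrite pullbackM tangentM /= ginv_unit.
exact: ((cF x).2 (MkTangent D)).
Qed.

Lemma third_DX X X' Y Z : third_LLR F (X + X') Y Z = third_LLR F X Y Z + third_LLR F X' Y Z.
Proof. by apply: cinf_ext => x; rewrite /third_LLR left_extD. Qed.

Lemma third_DY X Y Y' Z : third_LLR F X (Y + Y') Z = third_LLR F X Y Z + third_LLR F X Y' Z.
Proof. by rewrite /third_LLR left_extD vact_addl vactD pullbackD. Qed.

Lemma third_DZ X Y Z Z' : third_LLR F X Y (Z + Z') = third_LLR F X Y Z + third_LLR F X Y Z'.
Proof. by rewrite /third_LLR right_extD vact_addl !vactD pullbackD. Qed.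

Lemma third_ZX (phi : Cinf M) X Y Z : third_LLR F (phi *: X) Y Z = phi * third_LLR F X Y Z.
Proof.
by rewrite /third_LLR left_extZ vact_scalel pullbackM pullback_src_unit.
Qed.

(** The coefficient of Y^L is a pullback by [src], which X^L differentiates through the anchor. In
    [third_ZZ] it is a pullback by [tgt], which left fields kill. *)
Lemma third_ZY (phi : Cinf M) X Y Z : third_LLR F X (phi *: Y) Z =
  phi * third_LLR F X Y Z + vact (anchor X) phi * contrast_form F Y Z.
Proof.
rewrite /third_LLR left_extZ vact_scalel vactM pullbackD !pullbackM pullback_src_unit addrC.
congr (_ + _ * _); apply: cinf_ext => x; first by rewrite anchorE.
have [_ rY] := left_extP Y; have [_ rZ] := right_extP Z.
by rewrite (contrast_form_class x rY rZ).
Qed.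

Lemma third_ZZ (phi : Cinf M) X Y Z : third_LLR F X Y (phi *: Z) = phi * third_LLR F X Y Z.
Proof.
have L T f : vact (left_ext T) (pullback (tgt G) phi * f) =
    pullback (tgt G) phi * vact (left_ext T) f.
  rewrite vactM [X in X * _ + _](_ : _ = 0) ?mul0r ?add0r //.
  apply: cinf_ext => g; rewrite -[LHS]/(left_ext T g _) left_invariant_tgt //.
  by case: (left_extP T).
by rewrite /third_LLR right_extZ vact_scalel !L pullbackM pullback_tgt_unit.
Qed.

(** If [Z] vanishes at [x] then Z^R vanishes on the whole fibre [tgt = x], and X^L, Y^L
    differentiate along that fibre. *)
Lemma third_pt X Y Z Z' x : Z x = Z' x -> third_LLR F X Y Z x = third_LLR F X Y Z' x.
Proof.
move=> ZZ'; have [lX _] := left_extP X; have [lY _] := left_extP Y.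
pose W := Z + (-1) *: Z'.
suff H : third_LLR F X Y W x = 0.
  move: H; rewrite /W third_DZ third_ZZ => H; apply/eqP; rewrite -subr_eq0 -mulN1r; apply/eqP.
  exact: H.
have Wx : W x = 0.
  have -> : W = Z - Z' by rewrite /W scaleN1r.
  by rewrite -[LHS]/(Z x + (-1) *: Z' x) ZZ' scaleN1r subrr.
rewrite -[LHS]/(left_ext X (units G x) (vact _ _)).
apply: left_invariant_fiber0 => // k; rewrite tgt_unit => tk.
rewrite -[LHS]/(left_ext Y k (vact _ _)); apply: left_invariant_fiber0 => // k' tk'.
rewrite -[LHS]/(right_ext W k' F); apply: right_ext_zero.
by rewrite tk' tk.
Qed.

Lemma third_dual X Y Z x :
  vact (anchor X) (contrast_form F Y Z) x =
  third_LLR F X Y Z x + third_LLR (dual_contrast F) X Z Y x.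
Proof.
have [lY rY] := left_extP Y; have [lZ rZ] := right_extP Z.
have -> : contrast_form F Y Z = pullback (units G) (vact (left_ext Y) (vact (right_ext Z) F)).
  by apply: cinf_ext => y; rewrite (contrast_form_class y rY rZ).
rewrite -left_right_units; congr (_ + _).
rewrite /third_LLR vact_right_ginv vactN vact_left_ginv opprK vact_left_ginv.
rewrite -[RHS]/(- right_ext X (ginv G (units G x)) _) ginv_unit; congr (- _).
apply/eqP; rewrite -subr_eq0 -tangentB; apply/eqP.
transitivity (right_ext X (units G x) (vact (commutator (left_ext Y) (right_ext Z)) F)).
  by congr (tangent_fun _ _); apply: cinf_ext.
(* Left and right fields are known to commute at units only. Symmetry moves the commutator outside,
   where it is evaluated at a unit. *)
rewrite hessian_sym.
rewrite -[LHS]/(left_ext Y (units G x) (vact (right_ext Z) _) - right_ext Z (units G x) (vact (left_ext Y) _)).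
by rewrite left_right_commute // subrr.
Qed.

Lemma third_torsion X Y Z x :
  third_LLR F X Y Z x - third_LLR F Y X Z x = contrast_form F (bracket X Y) Z x.
Proof.
have [_ rZ] := right_extP Z.
have rB : represents (commutator (left_ext X) (left_ext Y)) (bracket X Y) by [].
by rewrite (contrast_form_class x rB rZ).
Qed.

End ContrastHessian.

(** * Sections of the quotient bundle *)

(** Rows [f] spanning the row space are chosen; by symmetry the columns [f] span the column space,
    so the block they cut out has full rank. *)
Lemma sym_principal_unit (K : fieldType) n (A : 'M[K]_n) : A^T = A ->
  exists r (f : 'I_r -> 'I_n), mxsub f f A \in unitmx /\ (A <= rowsub f A)%MS.
Proof.
move=> symA; pose f := maxrankfun A.
have AI : (A <= rowsub f A)%MS by rewrite eq_maxrowsub.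
exists (\rank A), f; split => //; have /submxP[D AD] := AI.
have E : (rowsub f A)^T = D *m mxsub f f A.
  apply/matrixP => i j; rewrite !mxE.
  have -> : A (f j) i = A i (f j) by have /matrixP/(_ i (f j)) := symA; rewrite mxE.
  have /matrixP/(_ i (f j)) -> := AD.
  by rewrite !mxE; apply: eq_bigr => l _; rewrite !mxE.
rewrite -row_free_unit /row_free eqn_leq rank_leq_row /=.
by rewrite -{1}(eqP (maxrowsub_free A)) -mxrank_tr E mxrankM_maxr.
Qed.

Section PointwiseMatrices.
Variables (R : realType) (M : manifold R).
Implicit Types (y p : M) (q : Cinf M).

(** Evaluation is made a ring morphism so that determinants over the ring of smooth functions can be
    compared with pointwise ones. *)
Definition cinf_eval y (q : Cinf M) : R := q y.

Fact cinf_eval_nmod y : nmod_morphism (cinf_eval y). Proof. by []. Qed.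
Fact cinf_eval_monoid y : monoid_morphism (cinf_eval y). Proof. by []. Qed.
HB.instance Definition _ y := GRing.isNmodMorphism.Build (Cinf M) R (cinf_eval y) (cinf_eval_nmod y).
HB.instance Definition _ y := GRing.isMonoidMorphism.Build (Cinf M) R (cinf_eval y) (cinf_eval_monoid y).

Lemma cinf_neq0_near q p : q p != 0 -> \forall y \near p, q y != 0.
Proof.
move=> q0; have oW : open [set z : R | z != 0] by exact: open_neq.
exact: (@cinf_continuous _ _ q p) _ (open_nbhs_nbhs (conj oW q0)).
Qed.

Lemma cinf_inv_near q p : q p != 0 -> exists w : Cinf M, \forall y \near p, w y * q y = 1.
Proof.
move=> q0; pose W := [set z : 'rV[R]_1 | z 0 0 != 0].
have oW : open W.
  apply: (@open_comp _ _ (fun z : 'rV[R]_1 => z 0 0) [set t | t != 0]); last exact: open_neq.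
  by move=> z _; exact: coord_continuous.
have [||w Hw] := @smooth_comp_exists _ _ 1 (fun=> q) p W (fun z => (z 0 0)^-1) oW.
- by rewrite /W /= mxE.
- by move=> k; apply: CkV => //; exact: Ck_coord.
exists w; apply: filterS2 Hw (cinf_neq0_near q0) => y -> qy.
by rewrite mxE mulVf.
Qed.

Lemma det_near n (q : 'M[Cinf M]_n) p : map_mx (cinf_eval p) q \in unitmx ->
  (\det q) p != 0 /\ \forall y \near p, map_mx (cinf_eval y) q \in unitmx.
Proof.
have E y : (map_mx (cinf_eval y) q \in unitmx) = ((\det q) y != 0).
  by rewrite unitmxE unitfE det_map_mx.
by rewrite E => dq; split => //; apply: filterS (cinf_neq0_near dq) => y; rewrite E.
Qed.

(** Spanning is an open condition: a maximal minor invertible at [p] stays invertible nearby. *)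
Lemma span_near (I : finType) n (q : I -> 'I_n -> Cinf M) p :
  (forall w : 'I_n -> R, exists z : I -> R, forall j, w j = \sum_t z t * q t j p) ->
  \forall y \near p, forall w : 'I_n -> R,
    exists z : I -> R, forall j, w j = \sum_t z t * q t j y.
Proof.
move=> H; pose Q : 'M[Cinf M]_(#|I|, n) := \matrix_(i, j) q (enum_val i) j.
have reidx (z : 'I_#|I| -> R) j y :
   \sum_i z i * q (enum_val i) j y = \sum_t z (enum_rank t) * q t j y.
  by rewrite (reindex enum_rank) /=; [apply: eq_bigr => t _; rewrite enum_rankK|
    exact/onW_bij/enum_rank_bij].
have full : row_full (map_mx (cinf_eval p) Q).
  apply/row_fullP; have [z zE] := boolp.choice (fun i => H (fun j => (i == j)%:R)).
  exists (\matrix_(i, l) z i (enum_val l)); apply/matrixP => i j.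
  rewrite !mxE zE [RHS](reindex (fun l : 'I_#|I| => enum_val l)) /=.
    by apply: eq_bigr => l _; rewrite !mxE.
  exact/onW_bij/enum_val_bij.
pose h := fullrankfun full.
have : map_mx (cinf_eval p) (rowsub h Q) \in unitmx.
  by rewrite map_mxsub; exact: fullrowsub_unit.
move=> /det_near[_]; apply: filterS => y uy w.
have [z zE] : exists z, z *m map_mx (cinf_eval y) (rowsub h Q) = \row_j w j.
  by exists ((\row_j w j) *m invmx (map_mx (cinf_eval y) (rowsub h Q))); rewrite mulmxKV.
exists (fun t => \sum_i z 0 i *+ (enum_val (h i) == t)) => j.
have /matrixP/(_ 0 j) := zE; rewrite mxE [RHS]mxE => <-.
under [RHS]eq_bigr do rewrite mulr_suml.
rewrite exchange_big /=; apply: eq_bigr => i _; rewrite !mxE.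
rewrite (bigD1 (enum_val (h i))) //= eqxx mulr1n big1 ?addr0 // => t /negbTE tn.
by rewrite eq_sym tn mulr0n mul0r.
Qed.
End PointwiseMatrices.

Section SectionsOfE.
Variables (R : realType) (G : lie_groupoid R).
Local Notation M := (base G).
Local Notation GG := (arrows G).
Local Notation E := (lie_algebroid G).
Local Notation TM x := (range (push (units G) (x := x))).

Lemma sec_sumE (N : manifold R) (V : bundle N) (I : Type) (r : seq I) (s : I -> sec V) y :
  (\sum_(i <- r) s i) y = \sum_(i <- r) s i y.
Proof. by elim: r => [|i r IH]; rewrite ?big_nil // !big_cons -IH. Qed.

Lemma proj_quot_sum (K : pzRingType) (V : lmodType K) (P : set V) (I : Type) (r : seq I) (v : I -> V) :
  proj_quot P (\sum_(i <- r) v i) = \sum_(i <- r) proj_quot P (v i).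
Proof.
by elim: r => [|i r IH]; rewrite ?big_nil ?proj_quot0 // !big_cons proj_quotD IH.
Qed.

Definition unit_section (V : vfield GG) : sec E := class_sec _ (restrict_units V).

Lemma unit_sectionE V x : unit_section V x = proj_quot (TM x) (V (units G x)).
Proof. by []. Qed.

Definition const_comb (I : finType) (V : bundle M) (a : I -> R) (s : I -> sec V) : sec V :=
  \sum_i cinf_cst M (a i) *: s i.

Lemma const_combE (I : finType) (V : bundle M) (a : I -> R) (s : I -> sec V) y :
  const_comb a s y = \sum_i a i *: s i y.
Proof. by rewrite /const_comb sec_sumE. Qed.

Lemma unit_frame (p : M) : exists (x : 'I_(mfd_dim GG) -> Cinf GG) (V : 'I_(mfd_dim GG) -> vfield GG),
  \forall y \near p, (forall i j, V i (units G y) (x j) = (i == j)%:R) /\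
    forall v : tangent (units G y), v = \sum_j v (x j) *: (V j (units G y) : tangent (units G y)).
Proof.
have [c ac cp] := atlas_cover (units G p).
have [x [V [_ H]]] := coord_frame_exists ac cp; exists x, V.
have [cu _] := smapP (units G).
exact: (cu p) _ H.
Qed.

(** The coordinate fields around a unit are global thanks to cutoffs, and their classes span the
    fibre. *)
Lemma section_through (x : M) (e : fiber E x) : exists X : sec E, X x = e.
Proof.
have [xs [V H]] := unit_frame x; have [_ HV] := nbhs_singleton H.
exists (const_comb (fun j => repr e (xs j)) (fun j => unit_section (V j))).
rewrite const_combE -[RHS]proj_quot_repr [X in _ = proj_quot _ X]HV proj_quot_sum.
by apply: eq_bigr => j _; rewrite unit_sectionE proj_quotZ.
Qed.

Lemma throughE (x : M) (e : fiber E x) : through e x = e.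
Proof. by apply: (@xgetPex _ 0 [set X : sec E | X x = e]); exact: section_through. Qed.

Variable F : Cinf GG.
Hypothesis cF : contrast_function F.
Implicit Types X Y Z : sec E.

Lemma fiber_formE X Y x : fiber_form F (X x) (Y x) = contrast_form F X Y x.
Proof. by apply: contrast_form_pt => //; exact: throughE. Qed.

Lemma form_kernelP X x : form_kernel F (X x) <-> forall Y, contrast_form F X Y x = 0.
Proof.
split=> [KX Y|H e]; first by rewrite -fiber_formE KX.
by rewrite -(throughE e) fiber_formE.
Qed.

Lemma contrast_formDr X Y Y' :
  contrast_form F X (Y + Y') = contrast_form F X Y + contrast_form F X Y'.
Proof. by rewrite !(contrast_form_sym cF X) contrast_formDl. Qed.

Lemma contrast_form_combl (I : finType) a (s : I -> sec E) Y y :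
  contrast_form F (const_comb a s) Y y = \sum_i a i * contrast_form F (s i) Y y.
Proof.
rewrite /const_comb; elim: (index_enum _) => [|i r IH]; last first.
  rewrite !big_cons contrast_formDl contrast_formZl -IH //.
by rewrite !big_nil -(scale0r (0 : sec E)) contrast_formZl mul0r.
Qed.

Lemma contrast_form_combr (I : finType) a (s : I -> sec E) X y :
  contrast_form F X (const_comb a s) y = \sum_i a i * contrast_form F X (s i) y.
Proof.
rewrite contrast_form_sym // contrast_form_combl.
by apply: eq_bigr => i _; rewrite contrast_form_sym.
Qed.

Lemma form_kernel_submod (x : M) (a : R) (u w : fiber E x) :
  form_kernel F u -> form_kernel F w -> form_kernel F (a *: u + w).
Proof.
rewrite -(throughE u) -(throughE w); set U := through u; set W := through w.
move=> /form_kernelP KU /form_kernelP KW.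
have -> : a *: U x + W x = (cinf_cst M a *: U + W) x by [].
apply/form_kernelP => Y; rewrite contrast_formDl contrast_formZl.
by rewrite -[LHS]/(a * contrast_form F U Y x + contrast_form F W Y x) KU KW mulr0 addr0.
Qed.

Lemma form_kernel0 (x : M) : form_kernel F (0 : fiber E x).
Proof.
rewrite -[0]/((0 : sec E) x); apply/form_kernelP => Y.
by rewrite -(scale0r (0 : sec E)) contrast_formZl mul0r.
Qed.

Lemma bar_eqP (x : M) (u w : fiber E x) :
  proj_quot (@form_kernel _ _ F x) u = proj_quot (@form_kernel _ _ F x) w <-> form_kernel F (u - w).
Proof.
split=> [/eqP|K].
  rewrite proj_quot_eq => /asboolP; apply => //; first exact: form_kernel0.
  exact: form_kernel_submod.
by apply/eqP; rewrite proj_quot_eq; apply/asboolP => W _ _; apply.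
Qed.

Lemma fiber_form_kernel (x : M) (e e' k k' : fiber E x) : form_kernel F k -> form_kernel F k' ->
  fiber_form F (e + k) (e' + k') = fiber_form F e e'.
Proof.
rewrite -(throughE e) -(throughE e') -(throughE k) -(throughE k').
set A := through e; set A' := through e'; set B := through k; set B' := through k'.
move=> /form_kernelP KB /form_kernelP KB'.
rewrite -[A x + B x]/((A + B) x) -[A' x + B' x]/((A' + B') x) !fiber_formE.
rewrite contrast_formDl -[LHS]/(_ x + contrast_form F B _ x) KB addr0.
rewrite contrast_formDr -[LHS]/(_ x + contrast_form F A B' x).
by rewrite [contrast_form F A B']contrast_form_sym // KB' addr0.
Qed.

Lemma quot_formE (x : M) (e e' : fiber E x) :
  quot_form (proj_quot (@form_kernel _ _ F x) e : fiber (quot_kernel F) x)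
            (proj_quot (@form_kernel _ _ F x) e') = fiber_form F e e'.
Proof.
rewrite /quot_form; set l := proj_quot _ e; set l' := proj_quot _ e'.
have K u : form_kernel F (repr (proj_quot (@form_kernel _ _ F x) u) - u).
  by apply/bar_eqP; rewrite proj_quot_repr.
rewrite -(fiber_form_kernel e e' (K e) (K e')).
by rewrite ![_ + (repr _ - _)]addrC !subrK.
Qed.

End SectionsOfE.

Section LocalRiesz.
Variables (R : realType) (G : lie_groupoid R) (F : Cinf (arrows G)).
Local Notation M := (base G).
Local Notation GG := (arrows G).
Local Notation E := (lie_algebroid G).
Local Notation TM x := (range (push (units G) (x := x))).
Hypothesis cF : contrast_function F.
Implicit Types X Y Z : sec E.

(* Spanning at [p] persists nearby: the lifts of [e] and [s], together with the images of
   the coordinate fields of [M], span the tangent spaces of [G] at the units near [p]. *)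
Lemma adapted_frame (k : nat) (p : M) : is_subbundle (@form_kernel R G F) k ->
  exists (e : 'I_k -> sec E) (r : nat) (s : 'I_r -> sec E),
    [/\ \forall y \near p, forall a, form_kernel F (e a y),
        (\matrix_(i, j) contrast_form F (s i) (s j) p) \in unitmx &
        \forall y \near p, forall Z, exists (z : 'I_k -> R) (c : 'I_r -> R),
          Z y = (const_comb z e + const_comb c s) y].
Proof.
move=> /(_ p)[e eK]; have [x [V VE]] := unit_frame p.
pose n := mfd_dim GG; pose S j := unit_section (V j).
pose A := \matrix_(i, j) contrast_form F (S i) (S j) p.
have symA : A^T = A by apply/matrixP => i j; rewrite !mxE contrast_form_sym.
(* An invertible principal minor selects the sections [s i], which together with the kernel span the
   fibre at [p]. *)
have [r [f [fA /submxP[D AD]]]] := sym_principal_unit symA.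
have eKer : \forall y \near p, forall a, form_kernel F (e a y).
  apply: filterS eK => y [Ke _] a; apply/Ke; exists (fun b => (a == b)%:R).
  rewrite (bigD1 a) //= eqxx scale1r big1 ?addr0 // => b /negbTE ba.
  by rewrite eq_sym ba scale0r.
have [Xp Vp] := nbhs_singleton VE; have [Kep _] := nbhs_singleton eK.
have SE Z : exists a : 'I_n -> R, Z p = const_comb a S p.
  exists (fun j => repr (Z p) (x j)).
  rewrite const_combE -[LHS]proj_quot_repr [X in proj_quot _ X = _]Vp proj_quot_sum.
  by apply: eq_bigr => j _; rewrite proj_quotZ.
pose s i := S (f i).
have span_p Z : exists (z : 'I_k -> R) (c : 'I_r -> R), Z p = const_comb z e p + const_comb c s p.
  have [a Za] := SE Z.
  have [c cAm] : exists c, (\row_j a j) *m A = c *m rowsub f A.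
    by exists ((\row_j a j) *m D); rewrite {1}AD mulmxA.
  have cA j : \sum_i a i * A i j = \sum_i c 0 i * A (f i) j.
    have /matrixP/(_ 0 j) := cAm.
    rewrite !mxE => H; transitivity (\sum_j0 (\row_j a j) 0 j0 * A j0 j).
      by apply: eq_bigr => i _; rewrite [(\row_j a j) 0 i]mxE.
    by rewrite H; apply: eq_bigr => i _; rewrite [rowsub _ _ _ _]mxE.
  (* The coefficients [c] give the combination of the [s i] the same pairing with every [S j] as
     [Z], so the difference [W] lies in the kernel at [p]. *)
  pose W := Z + const_comb (fun i => - c 0 i) s.
  have WK : form_kernel F (W p).
    apply/form_kernelP => // Y; have [b Yb] := SE Y.
    rewrite (contrast_form_pt cF (erefl (W p)) Yb) contrast_form_combr //.
    rewrite big1 // => j _.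
    rewrite contrast_formDl // -[X in _ * X]/(contrast_form F Z (S j) p + contrast_form F (const_comb _ s) (S j) p).
    rewrite contrast_form_combl // (contrast_form_pt cF Za (erefl (S j p))) contrast_form_combl //.
    rewrite [X in X + _](_ : _ = \sum_i a i * A i j); last first.
      by apply: eq_bigr => i _; rewrite mxE.
    rewrite cA -big_split /= big1 ?mulr0 // => i _.
    by rewrite mulNr mxE subrr.
  have [z zE] := (Kep (W p)).1 WK; exists z, (fun i => c 0 i).
  rewrite const_combE -zE -[W p]/(Z p + const_comb (fun i => - c 0 i) s p).
  rewrite !const_combE -addrA -big_split /= big1 ?addr0 // => i _.
  by rewrite scaleNr addNr.
exists e, r, s; split => //.
  have -> // : \matrix_(i, j) contrast_form F (s i) (s j) p = mxsub f f A.
  by apply/matrixP => i j; rewrite !mxE.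
have [d ad dp] := atlas_cover p.
have [y0 [Y [_ YE]]] := coord_frame_exists ad dp.
have [_ Yp] := nbhs_singleton YE.
have [el elE] := boolp.choice (fun a => secP (e a) p).
(* Spanning modulo vectors tangent to the units becomes spanning of the tangent space of [GG] once
   the images of the frame [Y] are added. The components [q] are smooth functions, to which
   [span_near] applies. *)
pose I := ('I_k + 'I_r + 'I_(mfd_dim M))%type.
pose lift (t : I) y : tangent (units G y) := match t with
  | inl (inl a) => el a y
  | inl (inr i) => V (f i) (units G y)
  | inr l => push (units G) (Y l y) end.
pose q (t : I) j : Cinf M := match t with
  | inl (inl a) => act_along (el a) (x j)
  | inl (inr i) => pullback (units G) (vact (V (f i)) (x j))
  | inr l => vact (Y l) (pullback (units G) (x j)) end.
have qE t j y : q t j y = lift t y (x j) by case: t => [[a|i]|l].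
have el' : \forall y \near p, forall a, e a y = proj_quot (TM y) (el a y).
  exact: filter_forall.
have lift_class (z : I -> R) y : (forall a, e a y = proj_quot (TM y) (el a y)) ->
    proj_quot (TM y) (\sum_t z t *: lift t y) =
    (const_comb (fun a => z (inl (inl a))) e + const_comb (fun i => z (inl (inr i))) s) y.
  move=> ey; rewrite -[RHS]/(_ y + const_comb _ s y) !const_combE.
  rewrite big_sumType /= big_sumType /= !proj_quotD !proj_quot_sum.
  rewrite [X in _ + _ + X]big1 ?addr0 => [|l _]; last first.
    rewrite proj_quotZ (_ : proj_quot _ _ = 0) ?scaler0 // -(proj_quot0 (TM y)).
    by apply/unit_class_eq; exists (Y l y); rewrite subr0.
  by congr (_ + _); apply: eq_bigr => i _; rewrite proj_quotZ ?ey.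
have span_near_p : \forall y \near p, forall w : 'I_n -> R,
    exists z : I -> R, forall j, w j = \sum_t z t * q t j y.
  apply: span_near => w.
  pose v : tangent (units G p) := \sum_j w j *: (V j (units G p) : tangent (units G p)).
  have vw j : v (x j) = w j.
    rewrite /v tangent_sumE (bigD1 j) //= big1 ?addr0 => [|i /negbTE ij].
      by rewrite -[LHS]/(w j * V j (units G p) (x j)) Xp eqxx mulr1.
    by rewrite -[LHS]/(w i * V i (units G p) (x j)) Xp ij mulr0.
  have [z [c zc]] := span_p (const_comb w S).
  pose z' (t : I) := match t with inl (inl a) => z a | inl (inr i) => c i | inr l => 0 end.
  have : proj_quot (TM p) v = proj_quot (TM p) (\sum_t z' t *: lift t p).
    rewrite lift_class; last exact: (nbhs_singleton el').
    rewrite -[RHS]zc const_combE /v proj_quot_sum.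
    by apply: eq_bigr => j _; rewrite proj_quotZ.
  move=> /unit_class_eq[u uE].
  exists (fun t => if t is inr l then u (y0 l) else z' t) => j.
  rewrite -vw -(subrK (\sum_t z' t *: lift t p) v) uE.
  rewrite -[LHS]/(u (pullback (units G) (x j)) + (\sum_t z' t *: lift t p : tangent _) (x j)).
  rewrite tangent_sumE big_sumType /= [in RHS]big_sumType /=.
  rewrite [X in _ + (_ + X)]big1 => [|l _]; last exact: mul0r.
  rewrite addr0 [LHS]addrC; congr (_ + _).
    by apply: eq_bigr => -[a|i] _.
  rewrite [in LHS](Yp u) tangent_sumE; apply: eq_bigr => l _.
  by [].
apply: filterS3 el' VE span_near_p => y ey [Xy Vy] Hy Z.
have [z zE] := Hy (fun j => repr (Z y) (x j)).
exists (fun a => z (inl (inl a))), (fun i => z (inl (inr i))).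
rewrite -lift_class // -[LHS]proj_quot_repr; congr (proj_quot _ _).
rewrite [LHS]Vy [RHS]Vy; apply: eq_bigr => j _; congr (_ *: _).
rewrite zE tangent_sumE; apply: eq_bigr => t _.
by rewrite qE.
Qed.

Lemma local_riesz (theta : sec E -> Cinf M) (k : nat) (p : M) :
  is_subbundle (@form_kernel R G F) k ->
  (forall Z Z', theta (Z + Z') = theta Z + theta Z') ->
  (forall phi Z, theta (phi *: Z) = phi * theta Z) ->
  (forall Z Z' y, Z y = Z' y -> theta Z y = theta Z' y) ->
  (forall Z y, (\forall y' \near y, form_kernel F (Z y')) -> theta Z y = 0) ->
  exists s : sec E, \forall y \near p, forall Z, contrast_form F s Z y = theta Z y.
Proof.
move=> subK thD thZ thpt thK; have [e [r [s [eK uB span]]]] := adapted_frame p subK.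
have th_comb (I : finType) a (t : I -> sec E) y :
    theta (const_comb a t) y = \sum_i a i * theta (t i) y.
  rewrite /const_comb; elim: (index_enum _) => [|i l IH].
    by rewrite !big_nil -(scale0r (0 : sec E)) thZ mul0r.
  by rewrite !big_cons thD thZ -IH.
pose B : 'M[Cinf M]_r := \matrix_(i, j) contrast_form F (s i) (s j).
have [|dB _] := @det_near _ _ _ B p.
  have -> // : map_mx (cinf_eval p) B = \matrix_(i, j) contrast_form F (s i) (s j) p.
  by apply/matrixP => i j; rewrite !mxE.
have [w wE] := cinf_inv_near dB.
(* Cramer's rule, with [w] standing for the inverse of the determinant near [p]. *)
pose C : 'rV[Cinf M]_r := w *: ((\row_j theta (s j)) *m \adj B).
exists (\sum_i C 0 i *: s i).
have CE y Z : contrast_form F (\sum_i C 0 i *: s i) Z y = \sum_i C 0 i y * contrast_form F (s i) Z y.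
  elim: (index_enum _) => [|i l IH].
    by rewrite !big_nil -(scale0r (0 : sec E)) contrast_formZl mul0r.
  by rewrite !big_cons contrast_formDl // contrast_formZl -IH.
have CB j y : \sum_i C 0 i y * contrast_form F (s i) (s j) y = w y * (\det B) y * theta (s j) y.
  have /matrixP/(_ 0 j) : C *m B = (w * \det B) *: \row_j theta (s j).
    by rewrite /C -scalemxAl -mulmxA mul_adj_mx mul_mx_scalar scalerA.
  rewrite !mxE => /(congr1 (fun q : Cinf M => q y)).
  rewrite cinf_sumE => H; apply: etrans (etrans H _); last by [].
  by apply: eq_bigr => i _; rewrite [B _ _]mxE.
(* [thK] asks for membership in the kernel on a neighbourhood of [y], not only at [y]. *)
have eK' : \forall y \near p, \forall y' \near y, forall a, form_kernel F (e a y').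
  have [N [oO Op HO]] := near_openE eK.
  by apply: (near_open oO Op) => y Oy; apply: (near_open oO Oy) => y' /HO.
apply: filterS3 wE eK' span => y wy ey spany Z.
have [z [c Zy]] := spany Z.
rewrite (contrast_form_pt cF (erefl _) Zy) (thpt _ _ _ Zy) contrast_formDr // thD.
rewrite -[LHS]/(contrast_form F _ _ y + contrast_form F _ _ y).
rewrite -[RHS]/(theta _ y + theta _ y) !contrast_form_combr // !th_comb.
congr (_ + _); apply: eq_bigr => i _; congr (_ * _).
  rewrite thK; last by apply: filterS ey => y' /(_ i).
  rewrite contrast_form_sym //.
  exact: (@form_kernelP _ _ _ cF (e i) y).1 (nbhs_singleton ey i) _.
by rewrite CE CB wy mul1r.
Qed.

End LocalRiesz.

Section QuotientForm.
Variables (R : realType) (G : lie_groupoid R) (F : Cinf (arrows G)).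
Hypothesis cF : contrast_function F.
Local Notation M := (base G).
Local Notation E := (lie_algebroid G).
Local Notation L := (quot_kernel F).
Implicit Types (X Y Z : sec E) (x : M).

Lemma quot_form_bar Y Z x : quot_form (bar F Y x) (bar F Z x) = contrast_form F Y Z x.
Proof. by rewrite quot_formE // fiber_formE. Qed.

Lemma fiber_quot_bar x (l : fiber L x) : exists Y, l = bar F Y x.
Proof.
exists (through (repr l)); rewrite -[LHS]proj_quot_repr.
by rewrite /= throughE.
Qed.

Lemma quot_formDl x (l l' l'' : fiber L x) :
  quot_form (l + l') l'' = quot_form l l'' + quot_form l' l''.
Proof.
have [Y ->] := fiber_quot_bar l; have [Y' ->] := fiber_quot_bar l'.
have [Z ->] := fiber_quot_bar l''.
have -> : bar F Y x + bar F Y' x = bar F (Y + Y') x by rewrite /= -proj_quotD.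
by rewrite !quot_form_bar contrast_formDl.
Qed.

Lemma quot_formZl x a (l l'' : fiber L x) : quot_form (a *: l) l'' = a * quot_form l l''.
Proof.
have [Y ->] := fiber_quot_bar l; have [Z ->] := fiber_quot_bar l''.
have -> : a *: bar F Y x = bar F (cinf_cst M a *: Y) x by rewrite /= -proj_quotZ.
by rewrite !quot_form_bar contrast_formZl.
Qed.

Lemma quot_form_sym x (l l' : fiber L x) : quot_form l l' = quot_form l' l.
Proof.
have [Y ->] := fiber_quot_bar l; have [Z ->] := fiber_quot_bar l'.
by rewrite !quot_form_bar contrast_form_sym.
Qed.

Lemma quot_form_nondegenerate x (l l' : fiber L x) :
  (forall Z, quot_form l (bar F Z x) = quot_form l' (bar F Z x)) -> l = l'.
Proof.
have [Y ->] := fiber_quot_bar l; have [Y' ->] := fiber_quot_bar l' => YY'.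
apply/bar_eqP => //; have -> : Y x - Y' x = (Y + (-1) *: Y') x.
  by rewrite -[RHS]/(Y x + (-1) *: Y' x) scaleN1r.
apply/form_kernelP => // Z; rewrite contrast_formDl // contrast_formZl.
rewrite -[LHS]/(contrast_form F Y Z x + (-1) * contrast_form F Y' Z x).
by rewrite -!quot_form_bar YY' mulN1r subrr.
Qed.

End QuotientForm.

(* [H] stands for either [F] or its dual. *)
Section KoszulConnection.
Variables (R : realType) (G : lie_groupoid R) (F H : Cinf (arrows G)) (k : nat).
Local Notation M := (base G).
Local Notation E := (lie_algebroid G).
Local Notation L := (quot_kernel F).
Implicit Types (X Y Z : sec E) (x : M).
Hypothesis cF : contrast_function F.
Hypothesis subK : is_subbundle (@form_kernel R G F) k.
Hypothesis cH : contrast_function H.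
Hypothesis gH : forall Y Z, contrast_form H Y Z = contrast_form F Y Z.
Hypothesis koszul : forall X Y Z, (forall x, form_kernel F (Z x)) ->
  third_LLR H X Y Z = 0 /\ third_LLR (dual_contrast H) X Y Z = 0.

(** This makes the Koszul condition local: multiplied by [phi], a section in the kernel near [x]
    lies in it everywhere. *)
Lemma kernel_cutoff Z x : (\forall y \near x, form_kernel F (Z y)) ->
  exists2 phi : Cinf M, phi x = 1 & forall y, form_kernel F ((phi *: Z) y).
Proof.
move=> /near_openE[U [oU Ux UK]].
have [chi [schi [C [cC CU chi0]]] chi1] := cutoff_exists oU Ux.
exists (MkCinf schi); first exact: (nbhs_singleton chi1).
move=> y; rewrite -[(_ *: Z) y]/(chi y *: Z y).
have [/CU/UK KZ|/chi0 ->] := pselect (C y).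
  by rewrite -[_ *: _]addr0; apply: form_kernel_submod => //; exact: form_kernel0.
by rewrite scale0r; exact: form_kernel0.
Qed.

Lemma third_kernelZ X Y Z x : (\forall y \near x, form_kernel F (Z y)) ->
  third_LLR H X Y Z x = 0.
Proof.
move=> /kernel_cutoff[phi phix K].
have [K1 _] := koszul X Y K; rewrite third_ZZ in K1.
have := congr1 (fun q : Cinf M => q x) K1.
by rewrite -[LHS]/(phi x * third_LLR H X Y Z x) phix mul1r.
Qed.

Lemma third_kernelY X Y Z x : (\forall y \near x, form_kernel F (Y y)) ->
  third_LLR H X Y Z x = 0.
Proof.
move=> KY; have [phi phix K] := kernel_cutoff KY.
have := third_dual cH X (phi *: Y) Z x.
have -> : contrast_form H (phi *: Y) Z = 0.
  by apply: cinf_ext => y; rewrite gH; exact: (form_kernelP cF _ _).1 (K y) Z.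
rewrite (koszul X Z K).2 addr0 vact0 third_ZY // => /esym.
rewrite -[LHS]/(phi x * third_LLR H X Y Z x + vact (anchor X) phi x * contrast_form H Y Z x).
by rewrite gH ((form_kernelP cF _ _).1 (nbhs_singleton KY) Z) mulr0 addr0 phix mul1r.
Qed.

(** Agreement near [x] suffices, as it must for local lifts of a section of the quotient. *)
Lemma third_bar X Y Y' Z x : (\forall y \near x, bar F Y y = bar F Y' y) ->
  third_LLR H X Y Z x = third_LLR H X Y' Z x.
Proof.
move=> YY'; have : third_LLR H X (Y + cinf_cst M (-1) *: Y') Z x = 0.
  apply: third_kernelY; apply: filterS YY' => y /bar_eqP -/(_ cF).
  by rewrite -[(Y + _) y]/(Y y + (-1) *: Y' y) scaleN1r.
rewrite third_DY third_ZY //.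
rewrite (_ : vact _ (cinf_cst M (-1)) = 0) ?mul0r ?addr0; last first.
  by apply: cinf_ext => y; exact: tangent_cst.
rewrite -[LHS]/(third_LLR H X Y Z x + (-1) * third_LLR H X Y' Z x) mulN1r.
by move/eqP; rewrite subr_eq0 => /eqP.
Qed.

Lemma connection_exists X (sigma : sec L) : exists tau : sec L, forall y Y,
  (\forall z \near y, sigma z = bar F Y z) ->
  forall Z, quot_form (tau y) (bar F Z y) = third_LLR H X Y Z y.
Proof.
have liftP (p : M) : exists Y, \forall z \near p, sigma z = bar F Y z.
  exact: (secP sigma p).
have [Y YP] := boolp.choice liftP.
have solP p : exists s : sec E, \forall y \near p, forall Z,
    contrast_form F s Z y = third_LLR H X (Y p) Z y.
  apply: (local_riesz cF p subK).
  - by move=> Z Z'; exact: third_DZ.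
  - by move=> phi Z; exact: third_ZZ.
  - by move=> Z Z' y; exact: third_pt.
  - by move=> Z y; exact: third_kernelZ.
have [s sP] := boolp.choice solP.
pose tau (p : M) : fiber L p := bar F (s p) p.
have tauE y Y' : (\forall z \near y, sigma z = bar F Y' z) ->
    forall Z, quot_form (tau y) (bar F Z y) = third_LLR H X Y' Z y.
  move=> Y'P Z; rewrite quot_form_bar // (nbhs_singleton (sP y)).
  by apply: third_bar; apply: filterS2 (YP y) Y'P => z <- <-.
have smtau : smooth_section tau.
  move=> p; exists (s p).
  (* [tau] uses a different local solution at each point; near [p] the solution [s p] solves the
     same equations, so nondegeneracy identifies the two. *)
  have YP' : \forall y \near p, \forall z \near y, sigma z = bar F (Y p) z.
    have [N [oN Np HN]] := near_openE (YP p).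
    by apply: (near_open oN Np) => y Ny; exact: (near_open oN Ny).
  apply: filterS2 YP' (sP p) => y Yy sy.
  apply: (quot_form_nondegenerate cF) => Z; rewrite (tauE _ _ Yy).
  by rewrite -[proj_quot _ _]/(bar F (s p) y) quot_form_bar // sy.
by exists (MkSec smtau).
Qed.

Lemma koszul_connection_exists : exists nabla : sec E -> sec L -> sec L,
  [/\ forall X Y, unique (represents_LLR H X Y) (nabla X (bar F Y)),
      E_connection nabla &
      forall X Y, nabla X (bar F Y) - nabla Y (bar F X) = bar F (bracket X Y)].
Proof.
have [nab nabP] := boolp.choice (fun p : sec E * sec L => connection_exists p.1 p.2).
pose nabla X s := nab (X, s).
have {}nabP X (s : sec L) y Y : (\forall z \near y, s z = bar F Y z) ->
    forall Z, quot_form (nabla X s y) (bar F Z y) = third_LLR H X Y Z y.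
  exact: (nabP (X, s)).
have lift (s : sec L) (y : M) : exists Y, \forall z \near y, s z = bar F Y z.
  exact: (secP s y).
have barD Y Y' (z : M) : bar F (Y + Y') z = bar F Y z + bar F Y' z.
  by rewrite /= -proj_quotD.
have barZ (phi : Cinf M) Y (z : M) : bar F (phi *: Y) z = phi z *: bar F Y z.
  by rewrite /= -proj_quotZ.
have leib (phi : Cinf M) X (s : sec L) :
    nabla X (phi *: s) = phi *: nabla X s + vact (anchor X) phi *: s.
  apply: sec_ext => y; apply: (quot_form_nondegenerate cF) => Z; have [Y YP] := lift s y.
  rewrite (nabP _ _ _ (phi *: Y)); last first.
    by apply: filterS YP => z sz; rewrite barZ -sz.
  rewrite third_ZY // gH.
  rewrite -[(_ + _ : sec L) y]/(phi y *: nabla X s y + vact (anchor X) phi y *: s y).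
  rewrite quot_formDl // !quot_formZl // (nabP _ _ _ Y) //.
  by rewrite (nbhs_singleton YP) quot_form_bar.
have linX (phi : Cinf M) X (s : sec L) : nabla (phi *: X) s = phi *: nabla X s.
  apply: sec_ext => y; apply: (quot_form_nondegenerate cF) => Z; have [Y YP] := lift s y.
  rewrite (nabP _ _ _ Y) // third_ZX // -[(_ *: _ : sec L) y]/(phi y *: nabla X s y).
  by rewrite quot_formZl // (nabP _ _ _ Y).
exists nabla; split.
- move=> X Y; split=> [Z y|s' s'P].
    by apply: nabP; exact: filterE.
  apply: sec_ext => y; apply: (quot_form_nondegenerate cF) => Z.
  by rewrite s'P (nabP _ _ _ Y) //; exact: filterE.
- split => //.
  + move=> X X' s; apply: sec_ext => y; apply: (quot_form_nondegenerate cF) => Z.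
    have [Y YP] := lift s y; rewrite (nabP _ _ _ Y) // third_DX //.
    by rewrite [RHS]quot_formDl // !(nabP _ _ _ Y).
  + move=> X s s'; apply: sec_ext => y; apply: (quot_form_nondegenerate cF) => Z.
    have [Y YP] := lift s y; have [Y' YP'] := lift s' y.
    rewrite (nabP _ _ _ (Y + Y')); last first.
      by apply: filterS2 YP YP' => z sz s'z; rewrite barD -sz -s'z.
    by rewrite third_DY // [RHS]quot_formDl // (nabP _ _ _ Y) // (nabP _ _ _ Y').
  + move=> a X s; rewrite leib (_ : vact _ _ = 0) ?scale0r ?addr0 //.
    by apply: cinf_ext => y; exact: tangent_cst.
- move=> X Y; apply: sec_ext => y; apply: (quot_form_nondegenerate cF) => Z.
  have -> : nabla X (bar F Y) - nabla Y (bar F X) =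
      nabla X (bar F Y) + cinf_cst M (-1) *: nabla Y (bar F X).
    by congr (_ + _); exact: sec_ext.
  rewrite [LHS]quot_formDl // [X in _ + X]quot_formZl // quot_form_bar // -gH.
  rewrite -third_torsion // mulN1r (nabP _ _ _ Y); last exact: filterE.
  by rewrite (nabP _ _ _ X) //; exact: filterE.
Qed.

End KoszulConnection.

Theorem theorem4p4 (R : realType) (G : lie_groupoid R) (F : Cinf (arrows G)) :
  koszul_contrast F ->
  exists nabla nabla_star :
      sec (lie_algebroid G) -> sec (quot_kernel F) -> sec (quot_kernel F),
    (forall X Y, unique (represents_LLR F X Y) (nabla X (bar F Y))) /\
    (forall X Y, unique (represents_LLR (dual_contrast F) X Y)
                        (nabla_star X (bar F Y))) /\
    E_connection nabla /\
    E_connection nabla_star /\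
    (forall X Y Z, exists2 gYZ : Cinf (base G),
       (forall x, gYZ x = quot_form (bar F Y x) (bar F Z x)) &
       (forall x, vact (anchor X) gYZ x =
          quot_form (nabla X (bar F Y) x) (bar F Z x) +
          quot_form (bar F Y x) (nabla_star X (bar F Z) x))) /\
    (forall X Y, nabla X (bar F Y) - nabla Y (bar F X) = bar F (bracket X Y)) /\
    (forall X Y, nabla_star X (bar F Y) - nabla_star Y (bar F X) =
                 bar F (bracket X Y)).
Proof.
move=> [[cF [k subK]] koszul].
have [//|//|nabla [repr conn tors]] :=
  @koszul_connection_exists R G F F k cF subK cF.
(* [F] and its dual have the same form, and the Koszul condition is symmetric in them because
   dualizing twice gives back [F]. *)
have [||nabla' [repr' conn' tors']] :=
  @koszul_connection_exists R G F (dual_contrast F) k cF subK (dual_contrast_function cF).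
- by move=> Y Z; rewrite contrast_form_dual.
- move=> X Y Z KZ; have [K1 K2] := koszul X Y Z KZ.
  by split; rewrite ?dual_contrastK.
exists nabla, nabla'; do 4 split => //; split => // X Y Z.
exists (contrast_form F Y Z) => x; first by rewrite quot_form_bar.
rewrite (repr X Y).1 quot_form_sym // (repr' X Z).1.
exact: third_dual.
Qed.
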